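(* $\mathrm{OOO}^{S}{+}\mathrm{HMB} \subseteq \mathrm{WMM\text{-}S}$; that is, for every number of processors $n$, every tree topology of the memory system HMB, every $n$-processor program and every initial state, every program behavior of the physical multiprocessor model $\mathrm{OOO}^{S}{+}\mathrm{HMB}$ (with multi-copy non-atomic stores) is also a program behavior of the memory model $\mathrm{WMM\text{-}S}$.
   Context: **Programs and conventions.** There are $n$ processors. Processor $i$ runs a fixed program: $\mathsf{fetch}(pc)$ gives the instruction at $pc$ (never modified). Instructions are: $\mathsf{Nm}$ (non-memory, e.g. ALU/branch: from its source registers and its PC it computes a next PC and a value for a destination register), $\mathsf{Ld}$ (an address is computed from source registers, the loaded value goes to a destination register), $\mathsf{St}$ (address and data are computed from source registers), and the fences $\mathsf{Commit}$ and $\mathsf{Reconcile}$. The next PC of a non-$\mathsf{Nm}$ instruction is determined by its PC alone. Each model is a nondeterministic transition system; a rule may fire atomically whenever its guard holds; an execution is a finite sequence of rule firings from the initial state. All models start with the same registers, PCs and memory values, with all buffers empty. $\epsilon$ means ''not available''. **HMB (hierarchy of shared store buffers / write-through caches).** State: a monolithic memory $m$ with $m[a]=\langle v,t\rangle$ (value and tag of the store that wrote it; initial values carry special tags different from the tags of all stores) and segments $s[1],\dots,s[k]$, each a list of requests from top (newest) to bottom. The segments and $m$ form a fixed tree rooted at $m$, and port $i$ (for processor $i$) is connected to a fixed segment. The methods $\mathsf{reqLd}(idx,a)$, $\mathsf{reqSt}(a,v,t)$, $\mathsf{reqCom}()$ called by processor $i$ add $\langle\mathsf{Ld},i,idx,a\rangle$,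 $\langle\mathsf{St},a,v,t\rangle$, $\langle\mathsf{Commit},i\rangle$ to the top of that segment. Rules: - *HMB-Reorder*: two consecutive requests $r_{new}$ (closer to the top) and $r_{old}$ in a segment may be swapped, unless both are memory accesses (load/store) to the same address, or $r_{new}$ is a $\mathsf{Commit}$ and $r_{old}$ is a store. - *HMB-Bypass*: if a load $\langle\mathsf{Ld},i,idx,a\rangle$ is immediately above a store $\langle\mathsf{St},a,v,t\rangle$ in a segment, remove the load and call $\mathsf{respLd}(idx,v,t)$ of processor $i$. - *HMB-Flow*: remove the bottom request $r$ of a segment. If the parent is a segment, add $r$ to the parent's top. If the parent is $m$: for $\langle\mathsf{Ld},i,idx,a\rangle$ call $\mathsf{respLd}(idx,v,t)$ of processor $i$ with $\langle v,t\rangle=m[a]$; for $\langle\mathsf{Commit},i\rangle$ call $\mathsf{respCom}()$ of processor $i$; for $\langle\mathsf{St},a,v,t\rangle$ set $m[a]:=\langle v,t\rangle$ (no response). **$\mathrm{OOO}^{S}$ (out-of-order processor).** State of each processor: PC register $pcr$, register file $rf$, reorder buffer $rob$, and a bit vector $lf$ (initially all False); there is no store buffer. $rob$ is a list of unbounded length; each new entry gets an index larger than all indices ever used (younger = larger index; indices are never reused). An entry is $\langle pc,npc,ins,ex\rangle$ with $npc$ the (predicted) next PC and $ex\in\{\mathsf{Idle},\mathsf{Exe},\mathsf{ReEx},\mathsf{Done}\}$. The field $ins$ is $\langle\mathsf{Nm},op,srcs,dst,val\rangle$, or $\langle\mathsf{Ld},srcs,dst,a,v,t\rangle$ ($t$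 = tag of the store read), or $\langle\mathsf{St},srcs,a,v,t\rangle$ ($t$ = globally unique tag assigned at fetch), or $\langle\mathsf{Commit}\rangle$, or $\langle\mathsf{Reconcile}\rangle$; the fields $val,a,v$ and the tag of a load are initially $\epsilon$. A source register of an entry is ready if the youngest older $rob$ entry writing that register has a non-$\epsilon$ value (possibly a predicted load value), or if no older entry writes it (then $rf$ is used); an entry is ready if all its source registers are. The commit slot is the oldest entry. Auxiliary operations. $\mathsf{flush}(idx,pc)$: delete all entries with index $\ge idx$, set $pcr:=pc$, and for each deleted $\mathsf{Ld}$ with $ex\in\{\mathsf{Exe},\mathsf{ReEx}\}$ set its $lf$ bit to True. $\mathsf{findBypass}(idx,a)$: search $rob$ from the entry just older than $idx$ to the oldest; return $\langle v,t\rangle$ of the first executed store to $a$ found; return $\epsilon$ if a $\mathsf{Reconcile}$ is met first; return $\top$ if nothing is found. $\mathsf{findAffectedLd}(idx,a)$: search from index $idx+1$ to the youngest entry, stopping at the first $\mathsf{St}$ with computed address $a$; return the list (oldest first) of all $\mathsf{Ld}$ entries met with address $a$ and $ex\ne\mathsf{Idle}$. ''Killing the loads in $list$'' means: for each $k$ in $list$ from oldest to youngest, if $rob[k].ex=\mathsf{Done}$ then $\mathsf{flush}(k,rob[k].pc)$ and stop, else $rob[k].ex:=\mathsf{ReEx}$. Rules: - *Fetch*: $ins=\mathsf{fetch}(pcr)$; choose a prediction $npc$ (arbitrary for $\mathsf{Nm}$, the correct next PC otherwise); append $\langle pcr,npc,ins,ex\rangle$ with $ex=\mathsf{Done}$ for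 $\mathsf{Reconcile}$ and $\mathsf{Idle}$ otherwise (including $\mathsf{Commit}$); $pcr:=npc$. - *NmEx*: for a ready $\mathsf{Idle}$ $\mathsf{Nm}$ entry $idx$, compute $\langle nextpc,val\rangle$, store $val$, set the entry's next-PC field to $nextpc$ and $ex:=\mathsf{Done}$; if $nextpc$ differs from the old $npc$ then $\mathsf{flush}(idx+1,nextpc)$. - *LdAddr*: for a ready $\mathsf{Idle}$ $\mathsf{Ld}$ with address $\epsilon$, compute and record its address. - *LdPred*: for any $\mathsf{Ld}$ entry with $v=\epsilon$ and tag $\epsilon$, set $v$ to an arbitrary predicted value. - *LdBypass*: for a ready $\mathsf{Idle}$ $\mathsf{Ld}$ at $idx$ with computed address $a$, current value $v$ and tag $\epsilon$, if $\mathsf{findBypass}(idx,a)=\langle res,t\rangle$ (neither $\epsilon$ nor $\top$): set value $res$, tag $t$, $ex:=\mathsf{Done}$; if $v\neq\epsilon$ and $v\ne res$ then $\mathsf{flush}(idx+1,npc)$. - *LdReq*: for a ready $\mathsf{Idle}$ $\mathsf{Ld}$ at $idx$ with computed address $a$ and tag $\epsilon$, if $\mathsf{findBypass}(idx,a)=\top$ and $\neg lf[idx]$: let $list=\mathsf{findAffectedLd}(idx,a)$, call $\mathsf{reqLd}(idx,a)$, set $rob[idx].ex:=\mathsf{Exe}$, and kill the loads in $list$. - *StEx*: for a ready $\mathsf{Idle}$ $\mathsf{St}$ at $idx$, compute address $a$ and data $v$, let $list=\mathsf{findAffectedLd}(idx,a)$, record $a,v$, set $ex:=\mathsf{Done}$,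 and kill the loads in $list$. - *NmLdRecCom*: if the commit slot is a $\mathsf{Done}$ $\mathsf{Nm}$, $\mathsf{Ld}$ or $\mathsf{Reconcile}$, remove it and update $rf$ with its result. - *StCom*: if the commit slot is a $\mathsf{Done}$ $\mathsf{St}$, remove it and call $\mathsf{reqSt}(a,v,t)$. - *ComReq*: if the commit slot is an $\mathsf{Idle}$ $\mathsf{Commit}$, set its $ex:=\mathsf{Exe}$ and call $\mathsf{reqCom}()$. Methods called by the memory: $\mathsf{respCom}()$ removes (commits) the $\mathsf{Commit}$ at the commit slot. $\mathsf{respLd}(idx,res,t)$: if $lf[idx]$, set $lf[idx]:=$ False; else, for the $\mathsf{Ld}$ entry at $idx$ (current value $v$): if $ex=\mathsf{ReEx}$ set $ex:=\mathsf{Idle}$; otherwise record value $res$, tag $t$, $ex:=\mathsf{Done}$, and if $v\ne\epsilon$ and $v\neq res$ do $\mathsf{flush}(idx+1,npc)$. $\mathrm{OOO}^{S}{+}\mathrm{HMB}$ is $n$ such processors connected to the $n$ ports of one HMB. **WMM-S.** State: monolithic memory $m$ (address to value) and for each processor $i$: register state (including PC), store buffer $sb_i$ (list of $\langle a,v,t\rangle$, oldest to youngest, $t$ a tag) and invalidation buffer $ib_i$ (list of $\langle a,v\rangle$ in insertion order). Instructions execute instantaneously in program order; executing one updates registers and PC. Each executed store gets a globally unique tag. Rules for processor $i$, by next instruction: - $\mathsf{Nm}$: execute. - $\mathsf{Ld}\ a$, if $sb_i$ contains $a$: return the youngest value for $a$ in $sb_i$. - $\mathsf{Ld}\ a$,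 if $sb_i$ does not contain $a$: return $m[a]$ and remove all entries for $a$ from $ib_i$. - $\mathsf{Ld}\ a$, if $sb_i$ does not contain $a$ and $ib_i$ contains $a$: return the value of any entry for $a$ in $ib_i$ and remove all entries for $a$ inserted in $ib_i$ before that entry. - $\mathsf{St}\ a\ v$ with tag $t$: append $\langle a,v,t\rangle$ to $sb_i$ and remove all entries for $a$ from $ib_i$. - $\mathsf{Commit}$: executes only if $sb_i$ is empty. - $\mathsf{Reconcile}$: execute and empty $ib_i$. Background rules: - *DeqSb*: choose $i$ and an address $a$ in $sb_i$, with oldest store $\langle a,v,t\rangle$ for $a$ in $sb_i$, such that in every $sb_j$ containing tag $t$ the store with tag $t$ is the oldest store for $a$. Let $old=m[a]$ and set $m[a]:=v$. For every $j$: if $sb_j$ contains tag $t$, remove that store from $sb_j$; else if $sb_j$ does not contain $a$, insert $\langle a,old\rangle$ into $ib_j$. - *Copy*: choose $i,j$ and any $\langle a,v,t\rangle$ in $sb_i$ such that $\mathsf{noCycle}(a,t,j)$; append $\langle a,v,t\rangle$ to $sb_j$ and remove all entries for $a$ from $ib_j$. Here the partial coherence order for $a$ is the transitive closure of the relation on tags relating $t_1$ to $t_2$ whenever some store buffer contains a store to $a$ with tag $t_1$ that is older in that buffer than a store to $a$ with tag $t_2$; $\mathsf{noCycle}(a,t,j)$ holds iff this relation has no cycle after the copy (in particular it fails if $sb_j$ already contains tag $t$). **Program behavior.** Consider any finite execution at whose end no store is pending (no store request in any HMB segment; respectively all WMM-S store buffers empty). Its behavior consists of: for each processor, the sequence of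 instructions committed from $rob$ (in WMM-S: executed), with their results ($\mathsf{Nm}$ values and next PCs, store addresses and data, load addresses and loaded values), and the final values in the monolithic memory. $A\subseteq B$ means that every behavior of $A$ is a behavior of $B$, for the same program and initial state. *)

(* Defs.v *)
From mathcomp Require Import all_boot.
From Stdlib Require Import Relation_Operators.

Set Implicit Arguments.
Unset Strict Implicit.
Unset Printing Implicit Defensive.

Section Models.

Variables PC Reg Addr Val : eqType.

(* An opcode is represented by the function it computes: from the PC and the
   source values for non-memory instructions, from the source values alone for
   the address (and data) computation of loads and stores. *)
Inductive instr :=
| INm (op : PC -> seq Val -> PC * Val) (srcs : seq Reg) (dst : Reg)
| ILd (addrf : seq Val -> Addr) (srcs : seq Reg) (dst : Reg)
| ISt (addrf : seq Val -> Addr) (dataf : seq Val -> Val) (srcs : seq Reg)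
| ICommit
| IReconcile.

(* [seqpc] is the next PC of every instruction other than [INm]. *)
Record program := Program { fetch : PC -> instr; seqpc : PC -> PC }.

Record init_state n := InitState {
  init_rf : 'I_n -> Reg -> Val;
  init_pc : 'I_n -> PC;
  init_mem : Addr -> Val
}.

(* A committed (resp. executed) instruction together with its results. *)
Inductive event :=
| EvNm (op : PC -> seq Val -> PC * Val) (srcs : seq Reg) (dst : Reg)
       (v : Val) (npc : PC)
| EvLd (addrf : seq Val -> Addr) (srcs : seq Reg) (dst : Reg)
       (a : Addr) (v : Val)
| EvSt (addrf : seq Val -> Addr) (dataf : seq Val -> Val) (srcs : seq Reg)
       (a : Addr) (v : Val)
| EvCommit
| EvReconcile.

Record behavior n := Behavior {
  beh_trace : 'I_n -> seq event;
  beh_mem : Addr -> Val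
}.

(* Stores are tagged by natural numbers; the initial value of address [a]
   carries the special tag [TInit a]. *)
Inductive vtag := TInit (a : Addr) | TSt (t : nat).

Inductive exstate := Idle | Exe | ReEx | Done.

(* [None] stands for the value "not available". *)
Inductive rob_ins :=
| RNm (op : PC -> seq Val -> PC * Val) (srcs : seq Reg) (dst : Reg)
      (val : option Val)
| RLd (addrf : seq Val -> Addr) (srcs : seq Reg) (dst : Reg)
      (a : option Addr) (v : option Val) (t : option vtag)
| RSt (addrf : seq Val -> Addr) (dataf : seq Val -> Val) (srcs : seq Reg)
      (a : option Addr) (v : option Val) (t : nat)
| RCommit
| RReconcile.

Record entry := Entry {
  e_idx : nat;
  e_pc : PC;
  e_npc : PC;
  e_ins : rob_ins;
  e_ex : exstate
}.

(* [rob] is listed from the oldest entry (the commit slot) to the youngest.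
   All indices ever used are smaller than [bound].  [hist] records the
   committed instructions, oldest first; no rule reads it. *)
Record proc := Proc {
  pcr : PC;
  rf : Reg -> Val;
  rob : seq entry;
  lf : nat -> bool;
  bound : nat;
  hist : seq event
}.

Definition set_rob (p : proc) (es : seq entry) : proc :=
  Proc (pcr p) (rf p) es (lf p) (bound p) (hist p).

Definition commit (p : proc) (es : seq entry) (rf' : Reg -> Val)
    (ev : event) : proc :=
  Proc (pcr p) rf' es (lf p) (bound p) (rcons (hist p) ev).

Definition get_entry (p : proc) (idx : nat) : option entry :=
  ohead [seq e <- rob p | e_idx e == idx].

(* Overwrites the entry that has the index of [e]. *)
Definition put_entry (e : entry) (p : proc) : proc :=
  set_rob p [seq (if e_idx e' == e_idx e then e else e') | e' <- rob p].

Definition set_ex (e : entry) (x : exstate) : entry :=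
  Entry (e_idx e) (e_pc e) (e_npc e) (e_ins e) x.

Definition older (p : proc) (idx : nat) : seq entry :=
  [seq e <- rob p | e_idx e < idx].

Definition younger (p : proc) (idx : nat) : seq entry :=
  [seq e <- rob p | idx < e_idx e].

(* The destination register of an entry, with its possibly missing value. *)
Definition dest (e : entry) : option (Reg * option Val) :=
  match e_ins e with
  | RNm _ _ dst v => Some (dst, v)
  | RLd _ _ dst _ v _ => Some (dst, v)
  | _ => None
  end.

(* The value of [r] seen by entry [idx]: the left fold runs from the oldest to
   the youngest older entry, so that the youngest writer of [r] wins. *)
Definition read_reg (p : proc) (idx : nat) (r : Reg) : option Val :=
  foldl (fun acc e =>
           if dest e is Some (dst, v) then (if dst == r then v else acc)
           else acc)
        (Some (rf p r)) (older p idx).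

Definition ready (p : proc) (idx : nat) (srcs : seq Reg) : bool :=
  all (fun r => isSome (read_reg p idx r)) srcs.

(* Only meaningful when [ready p idx srcs] holds. *)
Definition operands (p : proc) (idx : nat) (srcs : seq Reg) : seq Val :=
  pmap (read_reg p idx) srcs.

Definition load_in_flight (e : entry) : bool :=
  match e_ins e, e_ex e with
  | RLd _ _ _ _ _ _, (Exe | ReEx) => true
  | _, _ => false
  end.

Definition flush (idx : nat) (pc : PC) (p : proc) : proc :=
  Proc pc (rf p) (older p idx)
    (fun k => lf p k ||
       has (fun e => [&& e_idx e == k, idx <= e_idx e & load_in_flight e])
           (rob p))
    (bound p) (hist p).

Inductive bypass_result :=
| BypassNone                       (* "not available": a Reconcile was met *)
| BypassTop                        (* nothing found *)
| BypassHit (v : Val) (t : nat).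

Fixpoint search_bypass (a : Addr) (es : seq entry) : bypass_result :=
  if es is e :: es' then
    match e_ins e, e_ex e with
    | RReconcile, _ => BypassNone
    | RSt _ _ _ (Some a') (Some v) t, Done =>
        if a' == a then BypassHit v t else search_bypass a es'
    | _, _ => search_bypass a es'
    end
  else BypassTop.

Definition find_bypass (p : proc) (idx : nat) (a : Addr) : bypass_result :=
  search_bypass a (rev (older p idx)).

Fixpoint search_affected (a : Addr) (es : seq entry) : seq nat :=
  if es is e :: es' then
    match e_ins e, e_ex e with
    | RSt _ _ _ (Some a') _ _, _ =>
        if a' == a then [::] else search_affected a es'
    | RLd _ _ _ (Some a') _ _, (Exe | ReEx | Done) =>
        if a' == a then e_idx e :: search_affected a es'
        else search_affected a es'
    | _, _ => search_affected a es'
    end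
  else [::].

Definition find_affected_ld (p : proc) (idx : nat) (a : Addr) : seq nat :=
  search_affected a (younger p idx).

Fixpoint kill (ks : seq nat) (p : proc) : proc :=
  if ks is k :: ks' then
    if get_entry p k is Some e then
      if e_ex e is Done then flush k (e_pc e) p
      else kill ks' (put_entry (set_ex e ReEx) p)
    else kill ks' p
  else p.

(* Flushes everything younger than a load at [idx] whose value was predicted
   as [v] and turns out to be [res]. *)
Definition check_pred (v : option Val) (res : Val) (idx : nat) (npc : PC)
    (p : proc) : proc :=
  if v is Some w then (if w != res then flush idx.+1 npc p else p) else p.

Definition resp_com (p : proc) : proc :=
  if rob p is e :: es then
    if e_ins e is RCommit then commit p es (rf p) EvCommit else p
  else p.

Definition resp_ld (idx : nat) (res : Val) (t : vtag) (p : proc) : proc :=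
  if lf p idx then
    Proc (pcr p) (rf p) (rob p) [eta lf p with idx |-> false] (bound p) (hist p)
  else
    match get_entry p idx with
    | Some (Entry k pc npc (RLd addrf srcs dst a v tg) ReEx) =>
        put_entry (Entry k pc npc (RLd addrf srcs dst a v tg) Idle) p
    | Some (Entry k pc npc (RLd addrf srcs dst a v tg) _) =>
        check_pred v res idx npc
          (put_entry
             (Entry k pc npc (RLd addrf srcs dst a (Some res) (Some t)) Done) p)
    | _ => p
    end.

Definition pred_ok (pr : program) (pc npc : PC) : Prop :=
  if fetch pr pc is INm _ _ _ then True else npc = seqpc pr pc.

Definition new_entry (pr : program) (idx : nat) (pc npc : PC) (t : nat)
    : entry :=
  match fetch pr pc with
  | INm op srcs dst => Entry idx pc npc (RNm op srcs dst None) Idle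
  | ILd addrf srcs dst =>
      Entry idx pc npc (RLd addrf srcs dst None None None) Idle
  | ISt addrf dataf srcs =>
      Entry idx pc npc (RSt addrf dataf srcs None None t) Idle
  | ICommit => Entry idx pc npc RCommit Idle
  | IReconcile => Entry idx pc npc RReconcile Done
  end.

(* The tag is consumed only when the fetched instruction is a store. *)
Definition used_after_fetch (pr : program) (pc : PC) (t : nat)
    (used : seq nat) : seq nat :=
  if fetch pr pc is ISt _ _ _ then t :: used else used.

Section HMB.

Variable n : nat.

Inductive request :=
| QLd (i : 'I_n) (idx : nat) (a : Addr)
| QSt (a : Addr) (v : Val) (t : nat)
| QCom (i : 'I_n).

Inductive core_step (pr : program) (i : 'I_n) (used : seq nat) (p : proc) :
  option request -> proc -> seq nat -> Prop :=
| Fetch idx npc t :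
    bound p <= idx ->
    pred_ok pr (pcr p) npc ->
    t \notin used ->
    core_step pr i used p None
      (Proc npc (rf p) (rcons (rob p) (new_entry pr idx (pcr p) npc t))
         (lf p) idx.+1 (hist p))
      (used_after_fetch pr (pcr p) t used)
| NmEx idx pc npc op srcs dst v0 npc' v :
    get_entry p idx = Some (Entry idx pc npc (RNm op srcs dst v0) Idle) ->
    ready p idx srcs ->
    op pc (operands p idx srcs) = (npc', v) ->
    core_step pr i used p None
      (let p' := put_entry (Entry idx pc npc' (RNm op srcs dst (Some v)) Done) p
       in if npc' != npc then flush idx.+1 npc' p' else p')
      used
| LdAddr idx pc npc addrf srcs dst v t :
    get_entry p idx =
      Some (Entry idx pc npc (RLd addrf srcs dst None v t) Idle) ->
    ready p idx srcs ->
    core_step pr i used p None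
      (put_entry
         (Entry idx pc npc
            (RLd addrf srcs dst (Some (addrf (operands p idx srcs))) v t) Idle)
         p)
      used
| LdPred idx pc npc addrf srcs dst a x v :
    get_entry p idx =
      Some (Entry idx pc npc (RLd addrf srcs dst a None None) x) ->
    core_step pr i used p None
      (put_entry (Entry idx pc npc (RLd addrf srcs dst a (Some v) None) x) p)
      used
| LdBypass idx pc npc addrf srcs dst a v res t :
    get_entry p idx =
      Some (Entry idx pc npc (RLd addrf srcs dst (Some a) v None) Idle) ->
    ready p idx srcs ->
    find_bypass p idx a = BypassHit res t ->
    core_step pr i used p None
      (check_pred v res idx npc
         (put_entry
            (Entry idx pc npc
               (RLd addrf srcs dst (Some a) (Some res) (Some (TSt t))) Done) p))
      used
| LdReq idx pc npc addrf srcs dst a v :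
    get_entry p idx =
      Some (Entry idx pc npc (RLd addrf srcs dst (Some a) v None) Idle) ->
    ready p idx srcs ->
    find_bypass p idx a = BypassTop ->
    ~~ lf p idx ->
    core_step pr i used p (Some (QLd i idx a))
      (kill (find_affected_ld p idx a)
         (put_entry
            (Entry idx pc npc (RLd addrf srcs dst (Some a) v None) Exe) p))
      used
| StEx idx pc npc addrf dataf srcs a0 v0 t a v :
    get_entry p idx =
      Some (Entry idx pc npc (RSt addrf dataf srcs a0 v0 t) Idle) ->
    ready p idx srcs ->
    a = addrf (operands p idx srcs) ->
    v = dataf (operands p idx srcs) ->
    core_step pr i used p None
      (kill (find_affected_ld p idx a)
         (put_entry
            (Entry idx pc npc (RSt addrf dataf srcs (Some a) (Some v) t) Done)
            p))
      used
| NmCom idx pc npc op srcs dst v es :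
    rob p = Entry idx pc npc (RNm op srcs dst (Some v)) Done :: es ->
    core_step pr i used p None
      (commit p es [eta rf p with dst |-> v] (EvNm op srcs dst v npc)) used
| LdCom idx pc npc addrf srcs dst a v t es :
    rob p = Entry idx pc npc (RLd addrf srcs dst (Some a) (Some v) t) Done
              :: es ->
    core_step pr i used p None
      (commit p es [eta rf p with dst |-> v] (EvLd addrf srcs dst a v)) used
| RecCom idx pc npc es :
    rob p = Entry idx pc npc RReconcile Done :: es ->
    core_step pr i used p None (commit p es (rf p) EvReconcile) used
| StCom idx pc npc addrf dataf srcs a v t es :
    rob p = Entry idx pc npc (RSt addrf dataf srcs (Some a) (Some v) t) Done
              :: es ->
    core_step pr i used p (Some (QSt a v t))
      (commit p es (rf p) (EvSt addrf dataf srcs a v)) used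
| ComReq idx pc npc es :
    rob p = Entry idx pc npc RCommit Idle :: es ->
    core_step pr i used p (Some (QCom i))
      (set_rob p (Entry idx pc npc RCommit Exe :: es)) used.

(* [parent j = None] means that segment [j] is a child of the monolithic
   memory, which is the root; [rooted] makes the parent map a tree. *)
Record hmb_tree := HmbTree {
  nseg : nat;
  parent : 'I_nseg -> option 'I_nseg;
  rooted : forall j, exists d, iter d (obind parent) (Some j) = None;
  port : 'I_n -> 'I_nseg
}.

Definition access_addr (r : request) : option Addr :=
  match r with
  | QLd _ _ a => Some a
  | QSt a _ _ => Some a
  | QCom _ => None
  end.

Definition same_access (r r' : request) : bool :=
  if (access_addr r, access_addr r') is (Some a, Some a') then a == a'
  else false.

Definition commit_over_store (rnew rold : request) : bool :=
  if (rnew, rold) is (QCom _, QSt _ _ _) then true else false.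

Definition can_reorder (rnew rold : request) : bool :=
  ~~ same_access rnew rold && ~~ commit_over_store rnew rold.

Variables (T : hmb_tree) (prog : 'I_n -> program) (ini : init_state n).

(* A segment is listed from the top (newest request) to the bottom.  [used]
   collects the store tags assigned so far by all processors. *)
Record ooos_state := OoosState {
  procs : 'I_n -> proc;
  segs : 'I_(nseg T) -> seq request;
  hmem : Addr -> Val * vtag;
  used : seq nat
}.

Inductive ooos_step (s : ooos_state) : ooos_state -> Prop :=
| CoreStep i out p used' :
    core_step (prog i) i (used s) (procs s i) out p used' ->
    ooos_step s
      (OoosState [eta procs s with i |-> p]
         (if out is Some r then
            [eta segs s with port T i |-> r :: segs s (port T i)]
          else segs s)
         (hmem s) used')
| HmbReorder j l1 rnew rold l2 :
    segs s j = l1 ++ rnew :: rold :: l2 ->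
    can_reorder rnew rold ->
    ooos_step s
      (OoosState (procs s) [eta segs s with j |-> l1 ++ rold :: rnew :: l2]
         (hmem s) (used s))
| HmbBypass j l1 i idx a v t l2 :
    segs s j = l1 ++ QLd i idx a :: QSt a v t :: l2 ->
    ooos_step s
      (OoosState [eta procs s with i |-> resp_ld idx v (TSt t) (procs s i)]
         [eta segs s with j |-> l1 ++ QSt a v t :: l2]
         (hmem s) (used s))
| HmbFlowSeg j k l r :
    segs s j = rcons l r ->
    parent j = Some k ->
    ooos_step s
      (OoosState (procs s) [eta segs s with j |-> l, k |-> r :: segs s k]
         (hmem s) (used s))
| HmbFlowLd j l i idx a :
    segs s j = rcons l (QLd i idx a) ->
    parent j = None ->
    ooos_step s
      (OoosState
         [eta procs s with i |->
            resp_ld idx (hmem s a).1 (hmem s a).2 (procs s i)]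
         [eta segs s with j |-> l] (hmem s) (used s))
| HmbFlowCom j l i :
    segs s j = rcons l (QCom i) ->
    parent j = None ->
    ooos_step s
      (OoosState [eta procs s with i |-> resp_com (procs s i)]
         [eta segs s with j |-> l] (hmem s) (used s))
| HmbFlowSt j l a v t :
    segs s j = rcons l (QSt a v t) ->
    parent j = None ->
    ooos_step s
      (OoosState (procs s) [eta segs s with j |-> l]
         [eta hmem s with a |-> (v, TSt t)] (used s)).

Definition ooos_init : ooos_state :=
  OoosState
    (fun i => Proc (init_pc ini i) (init_rf ini i) [::] (fun _ => false) 0 [::])
    (fun _ => [::])
    (fun a => (init_mem ini a, TInit a))
    [::].

Definition is_store_req (r : request) : bool :=
  if r is QSt _ _ _ then true else false.

Definition ooos_hmb_behavior (b : behavior n) : Prop :=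
  exists s : ooos_state,
    [/\ clos_refl_trans _ ooos_step ooos_init s,
        forall j, ~~ has is_store_req (segs s j),
        forall i, hist (procs s i) = beh_trace b i
      & forall a, (hmem s a).1 = beh_mem b a].

End HMB.

(* An entry of a store buffer is a triple (address, value, tag); an entry of an
   invalidation buffer is a pair (address, value).  Both buffers are listed from
   the oldest entry to the youngest. *)
Definition sb_entry : Type := Addr * Val * nat.
Definition ib_entry : Type := Addr * Val.

Definition sb_addr (e : sb_entry) : Addr := e.1.1.
Definition sb_tag (e : sb_entry) : nat := e.2.

Definition stores_to (a : Addr) (sb : seq sb_entry) : seq sb_entry :=
  [seq e <- sb | sb_addr e == a].

Definition sb_has (a : Addr) (sb : seq sb_entry) : bool :=
  has (fun e => sb_addr e == a) sb.

Definition sb_has_tag (t : nat) (sb : seq sb_entry) : bool :=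
  has (fun e => sb_tag e == t) sb.

Definition ib_clear (a : Addr) (ib : seq ib_entry) : seq ib_entry :=
  [seq e <- ib | e.1 != a].

Record wproc := WProc {
  wrf : Reg -> Val;
  wpc : PC;
  sb : seq sb_entry;
  ib : seq ib_entry;
  whist : seq event
}.

Definition wargs (p : wproc) (srcs : seq Reg) : seq Val := map (wrf p) srcs.

Definition exec_ld (pr : program) (p : wproc) addrf srcs dst (a : Addr)
    (v : Val) (ib' : seq ib_entry) : wproc :=
  WProc [eta wrf p with dst |-> v] (seqpc pr (wpc p)) (sb p) ib'
    (rcons (whist p) (EvLd addrf srcs dst a v)).

Inductive wmm_exec (pr : program) (m : Addr -> Val) (used : seq nat)
    (p : wproc) : wproc -> seq nat -> Prop :=
| WNm op srcs dst npc v :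
    fetch pr (wpc p) = INm op srcs dst ->
    op (wpc p) (wargs p srcs) = (npc, v) ->
    wmm_exec pr m used p
      (WProc [eta wrf p with dst |-> v] npc (sb p) (ib p)
         (rcons (whist p) (EvNm op srcs dst v npc)))
      used
| WLdSb addrf srcs dst a v t l :
    fetch pr (wpc p) = ILd addrf srcs dst ->
    a = addrf (wargs p srcs) ->
    stores_to a (sb p) = rcons l (a, v, t) ->
    wmm_exec pr m used p (exec_ld pr p addrf srcs dst a v (ib p)) used
| WLdMem addrf srcs dst a :
    fetch pr (wpc p) = ILd addrf srcs dst ->
    a = addrf (wargs p srcs) ->
    ~~ sb_has a (sb p) ->
    wmm_exec pr m used p
      (exec_ld pr p addrf srcs dst a (m a) (ib_clear a (ib p))) used
| WLdIb addrf srcs dst a v l1 l2 :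
    fetch pr (wpc p) = ILd addrf srcs dst ->
    a = addrf (wargs p srcs) ->
    ~~ sb_has a (sb p) ->
    ib p = l1 ++ (a, v) :: l2 ->
    wmm_exec pr m used p
      (exec_ld pr p addrf srcs dst a v (ib_clear a l1 ++ (a, v) :: l2)) used
| WSt addrf dataf srcs a v t :
    fetch pr (wpc p) = ISt addrf dataf srcs ->
    a = addrf (wargs p srcs) ->
    v = dataf (wargs p srcs) ->
    t \notin used ->
    wmm_exec pr m used p
      (WProc (wrf p) (seqpc pr (wpc p)) (rcons (sb p) (a, v, t))
         (ib_clear a (ib p))
         (rcons (whist p) (EvSt addrf dataf srcs a v)))
      (t :: used)
| WCom :
    fetch pr (wpc p) = ICommit ->
    sb p = [::] ->
    wmm_exec pr m used p
      (WProc (wrf p) (seqpc pr (wpc p)) (sb p) (ib p)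
         (rcons (whist p) EvCommit))
      used
| WRec :
    fetch pr (wpc p) = IReconcile ->
    wmm_exec pr m used p
      (WProc (wrf p) (seqpc pr (wpc p)) (sb p) [::]
         (rcons (whist p) EvReconcile))
      used.

(* The store tagged [t] is the oldest store to [a] in the buffer. *)
Definition oldest_store (a : Addr) (t : nat) (b : seq sb_entry) : bool :=
  omap sb_tag (ohead (stores_to a b)) == Some t.

Definition deq_sb (a : Addr) (old : Val) (t : nat) (p : wproc) : wproc :=
  if sb_has_tag t (sb p) then
    WProc (wrf p) (wpc p) [seq e <- sb p | sb_tag e != t] (ib p) (whist p)
  else if ~~ sb_has a (sb p) then
    WProc (wrf p) (wpc p) (sb p) (rcons (ib p) (a, old)) (whist p)
  else p.

Definition copy_st (a : Addr) (v : Val) (t : nat) (p : wproc) : wproc :=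
  WProc (wrf p) (wpc p) (rcons (sb p) (a, v, t)) (ib_clear a (ib p)) (whist p).

Section WMM_S.

Variables (n : nat) (prog : 'I_n -> program) (ini : init_state n).

Record wmms_state := WmmsState {
  wprocs : 'I_n -> wproc;
  wmem : Addr -> Val;
  wused : seq nat
}.

Definition coh_edge (sbs : 'I_n -> seq sb_entry) (a : Addr) (t1 t2 : nat)
    : Prop :=
  exists j, subseq [:: t1; t2] (map sb_tag (stores_to a (sbs j))).

(* The strict partial coherence order remains irreflexive after the copy of
   the store (a, v, t) into the [j]-th store buffer. *)
Definition no_cycle (sbs : 'I_n -> seq sb_entry) (a : Addr) (v : Val) (t : nat)
    (j : 'I_n) : Prop :=
  forall t', ~ clos_trans _
    (coh_edge [eta sbs with j |-> rcons (sbs j) (a, v, t)] a) t' t'.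

Inductive wmms_step (s : wmms_state) : wmms_state -> Prop :=
| WExec i p used' :
    wmm_exec (prog i) (wmem s) (wused s) (wprocs s i) p used' ->
    wmms_step s (WmmsState [eta wprocs s with i |-> p] (wmem s) used')
| WDeqSb i a v t l :
    stores_to a (sb (wprocs s i)) = (a, v, t) :: l ->
    (forall j, sb_has_tag t (sb (wprocs s j)) ->
       oldest_store a t (sb (wprocs s j))) ->
    wmms_step s
      (WmmsState (fun j => deq_sb a (wmem s a) t (wprocs s j))
         [eta wmem s with a |-> v] (wused s))
| WCopy i j l1 a v t l2 :
    sb (wprocs s i) = l1 ++ (a, v, t) :: l2 ->
    no_cycle (fun k => sb (wprocs s k)) a v t j ->
    wmms_step s
      (WmmsState [eta wprocs s with j |-> copy_st a v t (wprocs s j)]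
         (wmem s) (wused s)).

Definition wmms_init : wmms_state :=
  WmmsState
    (fun i => WProc (init_rf ini i) (init_pc ini i) [::] [::] [::])
    (init_mem ini)
    [::].

Definition wmms_behavior (b : behavior n) : Prop :=
  exists s : wmms_state,
    [/\ clos_refl_trans _ wmms_step wmms_init s,
        forall i, sb (wprocs s i) = [::],
        forall i, whist (wprocs s i) = beh_trace b i
      & forall a, wmem s a = beh_mem b a].

End WMM_S.

End Models.

(* Main.v *)
(** WMM-S executes an instruction when the out-of-order processor commits it and
    dequeues a store when HMB writes it to the memory; just before a load commits
    a store that is still pending and not in the local store buffer, that store is
    copied there.

    Fix a processor and an address.  The values the address has taken in the
    memory, followed by the processor's loads and all stores on the route from its
    port to the root (bottom first), form a sequence in which requests to the same
    address never overtake each other: it evolves only by insertions, by the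
    removal of loads, and by replacing an answered load with the store below it.
    In this sequence the newest store observed by a committed instruction comes
    first, then, in program order, the loads of the reorder buffer that do not
    read from a store of that buffer; the recovery rules of the processor keep it
    so.  Hence the store buffer is a subsequence of the pending part, and the
    invalidation buffer holds the overwritten values since the newest observed
    store.  Copies create no cycle, because every route embeds in one list of the
    segments in which children precede their parents.  *)

Require Import Defs.
From mathcomp Require Import all_boot.
From HB Require Import structures.
From Stdlib Require Import Relation_Operators.
From mathcomp Require Import zify.

Set Implicit Arguments.
Unset Strict Implicit.
Unset Printing Implicit Defensive.

(** * Weakly increasing sequences of positions *)

Section Chains.

Variable I : eqType.
Implicit Types (x y z c : I) (A B C S xs ys : seq I).

(** The difficulty is that a load gets its value early and out of order, possibly from a store that
    few processors can see, while WMM-S must produce the value at the commit. Copying when the value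
    arrives would be premature, because the load may still be flushed; its place in the coherence
    sequence has to be remembered instead. One sequence per processor and address suffices, as only
    the fences relate different addresses.

    Positions identify stores only if nothing occurs twice. A tag sits in one reorder-buffer entry
    until its store commits; only then is it used in WMM-S, and from then on it sits in one pending
    request or in the history. A load index has at most one outstanding request; [in_flight]
    therefore also counts requests whose answers will be dropped.

    The fences are local. While a [Commit] is outstanding its processor commits nothing, so its
    store buffer cannot grow, and the stores in it stay below the request until they are written. A
    [Reconcile] in the reorder buffer stops every bypass search, so no younger load is settled when
    it commits. *)

Definition before C x y := index x C <= index y C.

(** Repetitions are allowed, since several loads may read one store. Membership is required because
    [index] gives all absent elements the same default position [size C]. *)
Definition chain C xs := all (mem C) xs && pairwise (before C) xs.

Lemma chain_cons C x xs :
  chain C (x :: xs) = [&& x \in C, all (before C x) xs & chain C xs].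
Proof. by rewrite /chain /= -!andbA; bool_congr; rewrite andbCA. Qed.

Lemma chain_subseq C xs ys : subseq xs ys -> chain C ys -> chain C xs.
Proof.
move=> sub /andP[/allP mys pys]; apply/andP; split.
  by apply/allP => x /(mem_subseq sub)/mys.
exact: subseq_pairwise pys.
Qed.

Lemma before_insert A B z x y :
  x != z -> y != z -> before (A ++ z :: B) x y = before (A ++ B) x y.
Proof.
rewrite /before !index_cat /= ![z == _]eq_sym => /negPf -> /negPf ->.
case: ifPn => xA; case: ifPn => yA //.
- by move: xA; rewrite -index_mem; lia.
- by move: yA; rewrite -index_mem; lia.
- lia.
Qed.

Lemma chain_eq_in C C' xs :
  {in xs, forall x, x \in C -> x \in C'} ->
  {in xs &, forall x y, before C x y -> before C' x y} ->
  chain C xs -> chain C' xs.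
Proof.
move=> memC befC /andP[/allP mxs pxs]; apply/andP; split.
  by apply/allP => x xs_x; apply: memC => //; apply: mxs.
apply: sub_in_pairwise (allss _) pxs => x y /= xs_x xs_y; exact: befC.
Qed.

Lemma chain_insert A B z xs :
  uniq (A ++ z :: B) -> chain (A ++ B) xs -> chain (A ++ z :: B) xs.
Proof.
rewrite -[z :: B]cat1s uniq_catCA cons_uniq => /andP[zAB _] chAB.
have neq x : x \in xs -> x != z.
  move=> xs_x; apply: contraNneq zAB => <-.
  by case/andP: chAB => /allP /(_ x xs_x).
apply: chain_eq_in chAB => [x _ | x y xs_x xs_y].
  by rewrite !mem_cat inE => /orP[] ->; rewrite ?orbT.
by rewrite before_insert ?neq.
Qed.

Lemma chain_delete A B z xs :
  z \notin xs -> chain (A ++ z :: B) xs -> chain (A ++ B) xs.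
Proof.
move=> zxs; have neq x : x \in xs -> x != z.
  by move=> xs_x; apply: contraNneq zxs => <-.
apply: chain_eq_in => [x /neq | x y xs_x xs_y].
  by rewrite !mem_cat inE => /negPf ->.
by rewrite before_insert ?neq.
Qed.

Definition redirect z c x := if x == z then c else x.

(** Nothing lies strictly between the neighbours [c] and [z], so identifying them reverses no
    comparison. With [c] a store and [z] a load, this is what answering the load does to the
    sequence. *)
Lemma chain_collapse A B c z xs :
  uniq (A ++ c :: z :: B) -> chain (A ++ c :: z :: B) xs ->
  chain (A ++ c :: B) (map (redirect z c) xs).
Proof.
move=> uC /andP[/allP mxs pxs]; have [cz cA zA]: [/\ c != z, c \notin A & z \notin A].
  move: uC; rewrite uniq_catC /= inE !mem_cat !negb_or.
  by case/and3P => /and3P[-> _ ->] /andP[_ ->].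
have idxz : index z (A ++ c :: z :: B) = (size A).+1.
  by rewrite index_cat (negPf zA) /= (negPf cz) eqxx addn1.
have idxc : index c (A ++ c :: z :: B) = size A.
  by rewrite index_cat (negPf cA) /= eqxx addn0.
have E x y : x != z -> y != z ->
    before (A ++ c :: B) x y = before (A ++ c :: z :: B) x y.
  move=> xz yz; rewrite -[A ++ c :: B]cat_rcons -[A ++ c :: z :: B]cat_rcons.
  by rewrite before_insert.
(* Position [(size A).+1] belongs to [z] alone, so an element weakly before [z] and different from
   it is weakly before [c]. *)
have idx_inj x : x \in xs -> index x (A ++ c :: z :: B) = (size A).+1 -> x = z.
  by move=> /mxs xC xE; rewrite -(nth_index z xC) xE nth_cat ltnNge leqnSn /= subSnn.
apply/andP; split.
  apply/allP => _ /mapP[x /mxs xC ->]; rewrite /redirect.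
  case: eqP xC => [_ _ | xz] /=; first by rewrite mem_cat inE eqxx orbT.
  rewrite !mem_cat !inE => /or4P[] => [->|->|/eqP|->] //; by rewrite ?orbT.
rewrite pairwise_map.
apply: sub_in_pairwise (allss _) pxs => x y /= xs_x xs_y.
rewrite /redirect; case: (eqVneq x z) => [->|xz]; case: (eqVneq y z) => [->|yz].
- by rewrite /before.
- by rewrite E // /before idxz idxc; lia.
- rewrite E // /before idxz idxc leq_eqVlt.
  by case/predU1P=> [/(idx_inj x xs_x)/eqP|//]; rewrite (negPf xz).
- by rewrite E.
Qed.

Lemma chain_rcons C z xs :
  uniq (rcons C z) -> chain C xs -> chain (rcons C z) (rcons xs z).
Proof.
move=> uC ch; have /andP[m p] : chain (rcons C z) xs.
  by rewrite -cats1; apply: chain_insert; rewrite ?cats1 ?cats0.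
apply/andP; split; first by rewrite all_rcons /= mem_rcons inE eqxx m.
rewrite -[rcons xs z]cats1 pairwise_cat allrel1r p !andbT; apply/allP => x.
case/andP: ch => /allP mC _ /mC /= xC.
rewrite /before -cats1 !index_cat xC.
case: ifP; rewrite /= ?eqxx => zC; last by move: xC; rewrite -index_mem; lia.
by move: uC; rewrite rcons_uniq zC.
Qed.

Lemma chain_const C z xs : z \in C -> all (pred1 z) xs -> chain C xs.
Proof.
move=> zC /allP allz; apply/andP; split.
  by apply/allP => x /allz /eqP ->.
apply/(pairwiseP z) => i j; rewrite !inE => ltis ltjs _.
by rewrite /before (eqP (allz _ (mem_nth z ltis))) (eqP (allz _ (mem_nth z ltjs))).
Qed.

(** As [C] has no duplicates, [S] is [C] filtered by membership; its elements are not after [x] and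
    differ from it, so the filter selects nothing from [x] onwards. This is how a copied store is
    appended to a store buffer. *)
Lemma subseq_rcons_before C S x :
  uniq C -> subseq S C -> x \in C -> x \notin S ->
  {in S, forall y, before C y x} -> subseq (rcons S x) C.
Proof.
move=> uC sSC xC; case: (splitPr xC) uC sSC => A B uC sSC xS bef.
have SE : S = [seq y <- A ++ x :: B | y \in S] by apply/subseq_uniqP.
rewrite -cat_rcons -[rcons S x]cats0; apply: cat_subseq; last exact: sub0seq.
rewrite -!cats1; apply: cat_subseq => //.
rewrite SE filter_cat /= (negPf xS).
have/eq_in_filter -> : {in B, (mem S) =1 pred0}.
  move=> y yB /=; apply/negP => yS; have := bef y yS.
  move: uC; rewrite cat_uniq cons_uniq => /and4P[_ /hasPn nA xB _].
  have yA : y \notin A by apply: nA; rewrite inE yB orbT.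
  have xA : x \notin A by apply: nA; rewrite inE eqxx.
  have xy : x != y by apply: contraNneq xB => ->.
  rewrite /before !index_cat (negPf yA) (negPf xA) /= eqxx (negPf xy); lia.
by rewrite filter_pred0 cats0 filter_subseq.
Qed.

Lemma subseq_before C S : uniq C -> subseq S C -> pairwise (before C) S.
Proof.
move=> uC /subseq_pairwise; apply; case: C uC => // x C uC.
apply/(pairwiseP x) => i j; rewrite !inE => ltiC ltjC ltij.
by rewrite /before !index_uniq // ltnW.
Qed.

Lemma before_antisym C x y : x \in C -> before C x y -> before C y x -> x = y.
Proof.
rewrite /before => xC le_xy le_yx.
have E : index x C = index y C by apply/eqP; rewrite eqn_leq le_xy.
by rewrite -(nth_index x xC) E nth_index // -index_mem -E index_mem.
Qed.

Lemma before_cat A B x y :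
  x \notin A -> y \notin A -> before (A ++ B) x y = before B x y.
Proof. by rewrite /before !index_cat => /negPf-> /negPf->; rewrite leq_add2l. Qed.

Lemma subseq_delete S A B z :
  z \notin S -> subseq S (A ++ z :: B) -> subseq S (A ++ B).
Proof.
move=> zS sub.
have : subseq S [seq y <- A ++ z :: B | y != z].
  rewrite subseq_filter sub andbT; apply/allP => y yS.
  by apply: contraNneq zS => <-.
rewrite filter_cat /= eqxx -filter_cat => sub'.
exact: subseq_trans sub' (filter_subseq _ _).
Qed.

End Chains.

(** * Routes to the root of the memory tree *)

Section Tree.

Variables (n : nat) (T : hmb_tree n).
Implicit Types j k : 'I_(nseg T).

Lemma rooted_bool j :
  exists d, iter d (obind (@parent n T)) (Some j) == None.
Proof. by have [d /eqP] := rooted j; exists d. Qed.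

(** The number of segments from [j] to the memory, [j] included; it serves as the fuel of [upward]
    and as an induction measure. *)
Definition height j : nat := ex_minn (rooted_bool j).

Lemma height_gt0 j : 0 < height j.
Proof. by rewrite /height; case: ex_minnP => -[]. Qed.

Lemma height_parent j k : parent j = Some k -> height j = (height k).+1.
Proof.
move=> jk; rewrite /height.
case: ex_minnP => [[|d]] // + min_d; case: ex_minnP => e ke min_e.
rewrite iterSr /= jk => kd; congr _.+1; apply/eqP.
rewrite eqn_leq min_e // andbT -ltnS; apply: min_d.
by rewrite iterSr /= jk.
Qed.

Fixpoint upward d j :=
  if d is d'.+1 then
    j :: (if parent j is Some k then upward d' k else [::])
  else [::].

Definition route j := upward (height j) j.

Lemma routeE j :
  route j = j :: (if parent j is Some k then route k else [::]).
Proof.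
rewrite /route; case: (height j) (height_gt0 j) (@height_parent j) => //= d _ H.
by case: (parent j) H => // k /(_ k erefl) [->].
Qed.

Lemma mem_route j : j \in route j.
Proof. by rewrite routeE mem_head. Qed.

Lemma route_ind (P : 'I_(nseg T) -> Prop) :
  (forall j, (forall k, parent j = Some k -> P k) -> P j) -> forall j, P j.
Proof.
move=> IH j; have [m] := ubnP (height j); elim: m j => // m IHm j le_m.
by apply: IH => k /height_parent jk; apply: IHm; lia.
Qed.

Lemma route_split j0 j : j \in route j0 -> exists l, route j0 = l ++ route j.
Proof.
elim/route_ind: j0 => j0 IH; rewrite [route j0]routeE inE.
case/predU1P => [->|]; first by exists [::]; rewrite [LHS]/= -routeE.
case def_k: (parent j0) => [k|] // /(IH _ def_k)[l ->].
by exists (j0 :: l).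
Qed.

Lemma height_route j0 j : j \in route j0 -> height j <= height j0.
Proof.
elim/route_ind: j0 => j0 IH; rewrite [route j0]routeE inE.
case/predU1P => [->//|]; case def_k: (parent j0) => [k|] // /(IH _ def_k).
by rewrite (height_parent def_k); lia.
Qed.

Lemma route_uniq j : uniq (route j).
Proof.
elim/route_ind: j => j IH; rewrite routeE.
case def_k: (parent j) => [k|] //=; rewrite (IH _ def_k) andbT.
by apply/negP => /height_route; rewrite (height_parent def_k); lia.
Qed.

Definition level d := [seq j <- enum 'I_(nseg T) | height j == d].

(** Blocks of decreasing height. The height drops by one along each parent link, so a route takes
    one segment from each successive block. *)
Fixpoint levels d := if d is d'.+1 then level d ++ levels d' else [::].

Lemma mem_levels d j : (j \in levels d) = (height j <= d).
Proof.
elim: d => [|d IH] /=; first by have := height_gt0 j; case: (height j).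
by rewrite mem_cat IH mem_filter mem_enum andbT; lia.
Qed.

Lemma levels_uniq d : uniq (levels d).
Proof.
elim: d => //= d IH; rewrite cat_uniq IH filter_uniq ?enum_uniq // andbT /=.
apply/hasPn => j; rewrite mem_levels mem_filter; lia.
Qed.

Definition topological := levels (\max_j height j).

Lemma mem_topological j : j \in topological.
Proof. by rewrite mem_levels leq_bigmax. Qed.

Lemma topological_uniq : uniq topological.
Proof. exact: levels_uniq. Qed.

Lemma route_levels d j : height j <= d -> subseq (route j) (levels d).
Proof.
elim: d j => [|d IH] j; first by have := height_gt0 j; case: (height j).
rewrite leq_eqVlt => /predU1P[hj|]; last first.
  by move/IH => sub /=; apply: subseq_trans sub (suffix_subseq _ _).
rewrite routeE -cat1s; apply: cat_subseq.
  by rewrite sub1seq mem_filter hj eqxx mem_enum.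
case def_k: (parent j) => [k|]; last exact: sub0seq.
by apply: IH; move: hj; rewrite (height_parent def_k); lia.
Qed.

Lemma route_topological j : subseq (route j) topological.
Proof. by apply: route_levels; rewrite leq_bigmax. Qed.

End Tree.

(** * Replacing one block of a concatenation *)

Section Flatten.

Variables (I : eqType) (R : Type).
Implicit Types (f : I -> seq R) (l : seq I).

Lemma flatten_notin f g l :
  {in l, f =1 g} -> flatten (map f l) = flatten (map g l).
Proof. by move/eq_in_map ->. Qed.

(** The witnesses [A] and [B] do not depend on the new block, so the old and the new list can be
    compared around the same place. *)
Lemma flatten_update f l j : uniq l -> j \in l ->
  exists A B, flatten (map f l) = A ++ f j ++ B /\
    forall x, flatten (map [eta f with j |-> x] l) = A ++ x ++ B.
Proof.
move=> + lj; case: (splitPr lj) => l1 l2.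
rewrite uniq_catC /= mem_cat negb_or => /andP[/andP[jl2 jl1] _].
exists (flatten (map f l1)), (flatten (map f l2)).
split=> [|y]; first by rewrite map_cat flatten_cat.
rewrite map_cat flatten_cat /= eqxx.
congr (_ ++ (_ ++ _)); apply: flatten_notin => k kl /=.
  by case: eqP kl jl1 => // -> ->.
by case: eqP kl jl2 => // -> ->.
Qed.

End Flatten.

(** * Out-of-order processors *)

Section Processor.

Variables PC Reg Addr Val : eqType.

Local Notation entry := (entry PC Reg Addr Val).
Local Notation proc := (proc PC Reg Addr Val).
Local Notation program := (program PC Reg Addr Val).
Local Notation item := (Val * option nat + nat)%type.

Implicit Types (pr : program) (p : proc) (e : entry) (es : seq entry) (a : Addr).

Definition reg_update (rs : Reg -> option Val) e : Reg -> option Val :=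
  fun r => if dest e is Some (dst, v) then (if dst == r then v else rs r)
           else rs r.

Definition regs_after rs es : Reg -> option Val := foldl reg_update rs es.

Lemma read_regE p idx r :
  read_reg p idx r = regs_after (Some \o rf p) (older p idx) r.
Proof.
rewrite /read_reg /regs_after -[Some (rf p r)]/((Some \o rf p) r).
elim: (older p idx) (Some \o rf p) => //= e es IH rs.
by rewrite -IH.
Qed.

Definition known (rs : Reg -> option Val) (srcs : seq Reg) :=
  all (fun r => isSome (rs r)) srcs.

(** The source values [rs] may contain predictions of older loads; a wrong prediction is harmless
    because its detection flushes all younger entries. A load has a tag exactly when it is [Done],
    which tells a received value from a predicted one. *)
Definition entry_ok pr (rs : Reg -> option Val) e : Prop :=
  match fetch pr (e_pc e), e_ins e with
  | INm op srcs dst, RNm op' srcs' dst' v =>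
      [/\ op = op', srcs = srcs', dst = dst'
        & if v is Some w then
            [/\ e_ex e = Done, known rs srcs
              & op (e_pc e) (pmap rs srcs) = (e_npc e, w)]
          else e_ex e = Idle]
  | ILd addrf srcs dst, RLd addrf' srcs' dst' a v t =>
      [/\ [/\ addrf = addrf', srcs = srcs' & dst = dst'],
          e_npc e = seqpc pr (e_pc e),
          (if a is Some b then known rs srcs /\ b = addrf (pmap rs srcs)
           else e_ex e = Idle)
        & (if e_ex e is Done then v /\ t else ~~ t)]
  | ISt addrf dataf srcs, RSt addrf' dataf' srcs' a v _ =>
      [/\ [/\ addrf = addrf', dataf = dataf' & srcs = srcs'],
          e_npc e = seqpc pr (e_pc e)
        & match a, v with
          | Some b, Some w =>
              [/\ e_ex e = Done, known rs srcs, b = addrf (pmap rs srcs)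
                & w = dataf (pmap rs srcs)]
          | None, None => e_ex e = Idle
          | _, _ => False
          end]
  | ICommit, RCommit => e_npc e = seqpc pr (e_pc e)
  | IReconcile, RReconcile => e_npc e = seqpc pr (e_pc e) /\ e_ex e = Done
  | _, _ => False
  end.

Fixpoint rob_ok pr rs pc es pc' : Prop :=
  if es is e :: es' then
    [/\ e_pc e = pc, entry_ok pr rs e
      & rob_ok pr (reg_update rs e) (e_npc e) es' pc']
  else pc = pc'.

Lemma rob_ok_cat pr rs pc es1 es2 pc' :
  rob_ok pr rs pc (es1 ++ es2) pc' <->
  exists2 mid, rob_ok pr rs pc es1 mid
             & rob_ok pr (regs_after rs es1) mid es2 pc'.
Proof.
elim: es1 rs pc => [|e es1 IH] rs pc /=.
  by split=> [|[mid <- //]]; exists pc.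
split=> [[pcE eok /IH[mid ok1 ok2]] | [mid [pcE eok ok1] ok2]].
  by exists mid.
by split=> //; apply/IH; exists mid.
Qed.

Definition regs_le (rs rs' : Reg -> option Val) :=
  forall r v, rs r = Some v -> rs' r = Some v.

Lemma regs_le_known rs rs' srcs :
  regs_le rs rs' -> known rs srcs ->
  known rs' srcs /\ pmap rs' srcs = pmap rs srcs.
Proof.
move=> le; elim: srcs => //= r srcs IH /andP[].
case def_v: (rs r) => [v|] //= _ /IH[kn ->].
by rewrite (le _ _ def_v) kn.
Qed.

Lemma entry_ok_mono pr rs rs' e :
  regs_le rs rs' -> entry_ok pr rs e -> entry_ok pr rs' e.
Proof.
move=> le; rewrite /entry_ok.
case: (fetch pr _) => [op srcs dst|addrf srcs dst|addrf dataf srcs||];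
  case: (e_ins e) => [op' srcs' dst' v|addrf' srcs' dst' a v t|
                      addrf' dataf' srcs' a v t||] //.
- case: v => [v|] // -[-> -> -> [-> kn <-]].
  by have [? ->] := regs_le_known le kn.
- case: a => [a|] // -[eqs -> [kn ->] ?].
  by have [? ->] := regs_le_known le kn.
- case: a v => [a|] [v|] // [eqs -> [-> kn -> ->]].
  by have [? ->] := regs_le_known le kn.
Qed.

Lemma reg_update_mono rs rs' e :
  regs_le rs rs' -> regs_le (reg_update rs e) (reg_update rs' e).
Proof.
move=> le r v; rewrite /reg_update; case: (dest e) => [[dst w]|]; last exact: le.
by case: eqP => // _; apply: le.
Qed.

Lemma rob_ok_mono pr rs rs' pc es pc' :
  regs_le rs rs' -> rob_ok pr rs pc es pc' -> rob_ok pr rs' pc es pc'.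
Proof.
elim: es rs rs' pc => //= e es IH rs rs' pc le [-> eok ok].
split=> //; first exact: entry_ok_mono eok.
by apply: IH ok; apply: reg_update_mono.
Qed.

Definition is_reconcile e := if e_ins e is RReconcile then true else false.

Definition executed_store a e : option (Val * nat) :=
  match e_ins e, e_ex e with
  | RSt _ _ _ (Some b) (Some v) t, Done => if b == a then Some (v, t) else None
  | _, _ => None
  end.

Lemma search_bypass_cons a e es :
  search_bypass a (e :: es) =
    if is_reconcile e then @BypassNone Val
    else if executed_store a e is Some (v, t) then BypassHit v t
    else search_bypass a es.
Proof.
rewrite /is_reconcile /executed_store /=.
case: (e_ins e) => [||addrf dataf srcs [b|] [v|] t||] //=; case: (e_ex e) => //.
by case: eqP.
Qed.

(** A finished load agrees with what bypassing would return now, because accesses that could spoil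
    this kill it. Under [BypassTop] its value came from the memory system or from a store that has
    committed since; its place is then tracked by [settled]. [BypassNone] is excluded since a
    [Reconcile] is found by every search from its fetch on. *)
Definition load_ok (prev : seq entry) e : Prop :=
  if e_ins e is RLd _ _ _ (Some a) v t then
    match e_ex e with
    | Exe => search_bypass a prev = @BypassTop Val
    | Done =>
        match search_bypass a prev with
        | BypassHit w t' => v = Some w /\ t = Some (TSt Addr t')
        | BypassTop => True
        | BypassNone => False
        end
    | _ => True
    end
  else True.

(* [prev] lists the older entries, youngest first. *)
Fixpoint loads_ok (prev es : seq entry) : Prop :=
  if es is e :: es' then load_ok prev e /\ loads_ok (e :: prev) es' else True.

Lemma loads_ok_cat prev es1 es2 :
  loads_ok prev (es1 ++ es2) <->
  loads_ok prev es1 /\ loads_ok (rev es1 ++ prev) es2.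
Proof.
elim: es1 prev => [|e es1 IH] prev /=; first by split=> [|[]].
by rewrite IH rev_cons cat_rcons; split=> [[? []]|[[]]].
Qed.

(** [BypassTop] is what an [Exe] load requires, and it puts no constraint on a [Done] one. Removing
    the oldest entry can change a search result only to [BypassTop], so this covers the commit. *)
Lemma loads_ok_weaken prev prev' es :
  (forall a, search_bypass a prev' = search_bypass a prev
             \/ search_bypass a prev' = @BypassTop Val) ->
  loads_ok prev es -> loads_ok prev' es.
Proof.
elim: es prev prev' => //= e es IH prev prev' H [lok ok]; split.
  move: lok; rewrite /load_ok; case: (e_ins e) => // addrf srcs dst [a|] v t //.
  by case: (H a) => ->; case: (e_ex e).
apply: IH ok => a; rewrite !search_bypass_cons.
by case: (is_reconcile e); [left|case: (executed_store a e) => [[v t]|]; [left|]].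
Qed.

Lemma loads_ok_eq prev prev' es :
  (forall a, search_bypass a prev' = search_bypass a prev) ->
  loads_ok prev es -> loads_ok prev' es.
Proof. by move=> H; apply: loads_ok_weaken => a; left. Qed.

Definition stag (t : vtag Addr) : option nat := if t is TSt t then Some t else None.

(* Where the value of an access to [a] sits: a store with its value and tag
   (tag [None] for the initial value), or a load request still in the memory. *)
Definition access a e : seq item :=
  if e_ins e is RLd _ _ _ (Some b) v t then
    if b == a then
      match e_ex e, v, t with
      | Exe, _, _ => [:: inr (e_idx e)]
      | Done, Some w, Some tg => [:: inl (w, stag tg)]
      | _, _, _ => [::]
      end
    else [::]
  else [::].

(* The loads from [a] that do not read from an executed store of the buffer. *)
Fixpoint settled a es : seq item :=
  if es is e :: es' then
    if executed_store a e then [::] else access a e ++ settled a es'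
  else [::].

Lemma settled_cat a es1 es2 :
  settled a (es1 ++ es2) =
    settled a es1 ++ if has (executed_store a) es1 then [::] else settled a es2.
Proof.
elim: es1 => //= e es1 ->.
by case: (executed_store a e) => //=; rewrite catA.
Qed.

Lemma bypass_top_not_executed a es :
  search_bypass a (rev es) = @BypassTop Val -> ~~ has (executed_store a) es.
Proof.
rewrite -[es]revK has_rev; rewrite !revK; elim: (rev es) => //= e es' IH.
rewrite -/(search_bypass a (e :: es')) search_bypass_cons.
by case: ifP => // _; case: (executed_store a e) => [[]|].
Qed.

Lemma bypass_hit_executed a es v t :
  search_bypass a (rev es) = BypassHit v t -> has (executed_store a) es.
Proof.
rewrite -[es]revK has_rev; rewrite !revK; elim: (rev es) => //= e es' IH.
rewrite -/(search_bypass a (e :: es')) search_bypass_cons.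
by case: ifP => // _; case: (executed_store a e) => [[]|].
Qed.

(** No executed store to [a] separates a settled load from [prev], so the load agrees with the
    search in [prev]. The use is for a single committing entry: behind a store, the loads that
    become settled all read it; behind a [Reconcile], there are none. *)
Lemma settled_bypass a prev es :
  loads_ok prev es ->
  match search_bypass a prev with
  | BypassHit v t => all (pred1 (inl (v, Some t))) (settled a es)
  | BypassTop => True
  | BypassNone => settled a es = [::]
  end.
Proof.
elim: es prev => [|e es IH] prev /=; first by case: search_bypass.
case=> lok /IH; rewrite search_bypass_cons.
case xst: (executed_store a e) => [[v t]|] /=; first by case: search_bypass.
case rec: (is_reconcile e) => tl.
  by rewrite tl; rewrite /access; move: rec; rewrite /is_reconcile;
     case: (e_ins e) => //; case: search_bypass.
case def_s: (search_bypass a prev) tl => [||v t] //.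
  move=> ->; move: lok; rewrite /load_ok /access.
  case: (e_ins e) => // addrf srcs dst [b|] v t //; case: eqP => // ->.
  by rewrite def_s; case: (e_ex e).
move=> tl; rewrite all_cat tl andbT; move: lok; rewrite /load_ok /access.
case: (e_ins e) => // addrf srcs dst [b|] v' t' //; case: eqP => // ->.
by rewrite def_s; case: (e_ex e) => // -[-> ->]; rewrite /= eqxx.
Qed.

(** * Flushed and re-executed suffixes of the reorder buffer *)

Definition flight k e := (e_idx e == k) && load_in_flight e.

(* The effect on the younger entries of flushing a suffix of them and of
   sending some of their loads back for re-execution. *)
Inductive trim : seq entry -> seq entry -> Prop :=
| TrimCut es : trim es [::]
| TrimKeep e es es' : trim es es' -> trim (e :: es) (e :: es')
| TrimReEx e es es' :
    load_in_flight e -> trim es es' -> trim (e :: es) (set_ex e ReEx :: es').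

Lemma trim_refl es : trim es es.
Proof. by elim: es => [|e es IH]; constructor. Qed.

Lemma flight_ReEx k e : load_in_flight e -> flight k (set_ex e ReEx) = flight k e.
Proof.
by rewrite /flight /load_in_flight /=; case: (e_ex e); case: (e_ins e).
Qed.

Lemma trim_flight k es es' : trim es es' -> has (flight k) es' -> has (flight k) es.
Proof.
elim=> [es0|e es0 es1 _ IH|e es0 es1 fl _ IH] //=.
  by case/orP => [->|/IH ->]; rewrite ?orbT.
by rewrite flight_ReEx // => /orP[->|/IH ->]; rewrite ?orbT.
Qed.

Lemma trim_idx es es' :
  trim es es' -> subseq (map (@e_idx _ _ _ _) es') (map (@e_idx _ _ _ _) es).
Proof.
elim=> [es0|e es0 es1 _ IH|e es0 es1 fl _ IH] /=; rewrite ?sub0seq //.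
  by rewrite eqxx.
by rewrite eqxx.
Qed.

Definition rtag e : option nat := if e_ins e is RSt _ _ _ _ _ t then Some t else None.

Definition rtags es := pmap rtag es.

Lemma trim_rtags es es' : trim es es' -> subseq (rtags es') (rtags es).
Proof.
elim=> [es0|e es0 es1 _ IH|e es0 es1 fl _ IH] /=; rewrite ?sub0seq //.
  by case: (rtag e) => //= t; rewrite eqxx.
by rewrite /rtag /=; case: (e_ins e) => //= *; rewrite eqxx.
Qed.

Lemma executed_store_ReEx a e :
  load_in_flight e -> executed_store a (set_ex e ReEx) = executed_store a e.
Proof. by rewrite /executed_store /load_in_flight /=; case: (e_ins e). Qed.

Lemma access_ReEx a e : access a (set_ex e ReEx) = [::].
Proof.
rewrite /access /=; case: (e_ins e) => // addrf srcs dst [b|] v t //.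
by case: eqP.
Qed.

Lemma trim_settled a es es' : trim es es' -> subseq (settled a es') (settled a es).
Proof.
elim=> [es0|e es0 es1 _ IH|e es0 es1 fl _ IH] /=; rewrite ?sub0seq //.
  by case: (executed_store a e) => //=; rewrite cat_subseq.
rewrite executed_store_ReEx // access_ReEx; case: (executed_store a e) => //=.
exact: subseq_trans IH (suffix_subseq _ _).
Qed.

(** Unlike [load_in_flight], this excludes [ReEx]: such a load still has a request in the memory,
    but the answer will be discarded, so it has no item in [settled]. *)
Definition awaiting e : bool :=
  match e_ins e, e_ex e with RLd _ _ _ _ _ _, Exe => true | _, _ => false end.

Lemma awaiting_flight e : awaiting e -> load_in_flight e.
Proof. by rewrite /awaiting /load_in_flight; case: (e_ex e); case: (e_ins e). Qed.

Lemma trim_awaiting (P : pred nat) es es' :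
  trim es es' -> all (fun e => awaiting e ==> P (e_idx e)) es ->
  all (fun e => awaiting e ==> P (e_idx e)) es'.
Proof.
elim=> [es0|e es0 es1 _ IH|e es0 es1 fl _ IH] //= /andP[? /IH ->].
  by rewrite andbT.
by rewrite /awaiting /=; case: (e_ins e).
Qed.

Definition increasing es := pairwise ltn (map (@e_idx _ _ _ _) es).

Lemma increasing_cat es1 es2 :
  increasing (es1 ++ es2) ->
  [/\ {in map (@e_idx _ _ _ _) es1 & map (@e_idx _ _ _ _) es2, forall k l, k < l},
      increasing es1 & increasing es2].
Proof.
rewrite /increasing map_cat pairwise_cat => /and3P[/allrelP H -> ->]; split=> //.
Qed.

Lemma has_idx_flight k es : has (flight k) es -> k \in map (@e_idx _ _ _ _) es.
Proof.
elim: es => //= e es IH; rewrite inE /flight => /orP[/andP[/eqP -> _]|/IH ->].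
  by rewrite eqxx.
by rewrite orbT.
Qed.

(** * The processor invariant and local changes of one entry *)

Record proc_ok pr p (pc : PC) : Prop := ProcOk {
  pok_rob : rob_ok pr (Some \o rf p) pc (rob p) (pcr p);
  pok_inc : increasing (rob p);
  pok_bound : all (fun e => e_idx e < bound p) (rob p);
  pok_loads : loads_ok [::] (rob p);
  pok_lf : all (fun e => awaiting e ==> ~~ lf p (e_idx e)) (rob p)
}.

(** A set [lf] bit stands for a flushed load whose answer is still to come. Counting it together
    with the entries bounds the requests in the memory with index [k]. *)
Definition in_flight p k := lf p k || has (flight k) (rob p).

Definition at_commit p :=
  if rob p is e :: _ then
    match e_ins e, e_ex e with RCommit, Exe => true | _, _ => false end
  else false.

(* [p'] results from [p] by replacing the entry [e] with [e'] and trimming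
   the younger entries. *)
Record focus p p' es1 e e' es2 es2' : Prop := Focus {
  fo_old : rob p = es1 ++ e :: es2;
  fo_new : rob p' = es1 ++ e' :: es2';
  fo_rf : rf p' = rf p;
  fo_bound : bound p' = bound p;
  fo_hist : hist p' = hist p;
  fo_idx : e_idx e' = e_idx e;
  fo_pc : e_pc e' = e_pc e;
  fo_tag : rtag e' = rtag e;
  fo_ins : if e_ins e is RCommit then False else True;
  fo_trim : trim es2 es2';
  fo_lf : forall k,
    lf p' k = lf p k || (has (flight k) es2 && ~~ has (flight k) es2')
}.

Lemma increasing_cons e es :
  increasing (e :: es) -> all (fun k => e_idx e < k) (map (@e_idx _ _ _ _) es).
Proof. by rewrite /increasing /= => /andP[]. Qed.

Lemma focus_lf p p' es1 e e' es2 es2' k :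
  focus p p' es1 e e' es2 es2' -> increasing (rob p) ->
  (k \in map (@e_idx _ _ _ _) es1) || (k == e_idx e) -> lf p' k = lf p k.
Proof.
case=> -> _ _ _ _ _ _ _ _ _ -> /increasing_cat[lt12 _ inc2].
case h: (has (flight k) es2); last by rewrite orbF.
have k2 := has_idx_flight h.
case/orP => [k1|/eqP ke].
  by have := lt12 k k k1; rewrite inE k2 orbT ltnn => /(_ isT).
by have := allP (increasing_cons inc2) k k2; rewrite ke /= ltnn.
Qed.

Lemma focus_proc_ok pr pc p p' es1 e e' es2 es2' :
  focus p p' es1 e e' es2 es2' -> proc_ok pr p pc ->
  entry_ok pr (regs_after (Some \o rf p) es1) e' ->
  rob_ok pr (reg_update (regs_after (Some \o rf p) es1) e') (e_npc e') es2' (pcr p') ->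
  load_ok (rev es1) e' -> loads_ok (e' :: rev es1) es2' ->
  (awaiting e' -> ~~ lf p (e_idx e)) ->
  proc_ok pr p' pc.
Proof.
move=> fo ok eok rok lok lsok lfok.
have inc := pok_inc ok; have flf k := @focus_lf _ _ _ _ _ _ _ k fo inc.
case: (fo) => old new rfE bE _ ei epc _ _ tr lfE.
split.
- move: (pok_rob ok); rewrite rfE old new !rob_ok_cat => -[mid ok1 [eE _ _]].
  by exists mid => //=; split=> //; rewrite epc.
- move: inc; rewrite /increasing old new !map_cat /= ei.
  by apply: subseq_pairwise; rewrite cat_subseq //= eqxx trim_idx.
- have /allP bd: all (fun k => k < bound p) (map (@e_idx _ _ _ _) (rob p)).
    by rewrite all_map (pok_bound ok).
  rewrite bE -(all_map (@e_idx _ _ _ _) (fun k => k < bound p)).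
  apply/allP => k k_in; apply: bd; apply: mem_subseq k k_in.
  by rewrite old new !map_cat /= ei cat_subseq //= eqxx trim_idx.
- move: (pok_loads ok); rewrite old new !loads_ok_cat /= cats0 => -[ok1 _].
  by split.
- have := pok_lf ok; rewrite old new !all_cat /=.
  have -> : all (fun e => awaiting e ==> ~~ lf p' (e_idx e)) es1 =
            all (fun e => awaiting e ==> ~~ lf p (e_idx e)) es1.
    have: forall k, k \in map (@e_idx _ _ _ _) es1 -> lf p' k = lf p k.
      by move=> k k1; apply: flf; rewrite k1.
    elim: es1 {old new flf fo eok rok lok lsok} => //= x es1 IH H.
    rewrite IH ?H ?inE ?eqxx // => k k1; apply: H; by rewrite inE k1 orbT.
  case/and3P => -> _ ok2; rewrite /= ei flf ?eqxx ?orbT //.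
  apply/andP; split; first by apply/implyP.
  have := trim_awaiting (P := fun k => ~~ lf p k) tr ok2.
  (* A surviving in-flight entry witnesses [has (flight k) es2'] for its own index, so the last
     disjunct of [fo_lf] is false there and its [lf] bit is unchanged. *)
  have: all (fun e => load_in_flight e ==> has (flight (e_idx e)) es2') es2'.
    elim: es2' {new fo rok lsok flf tr lfE} => //= x s IH.
    rewrite /flight eqxx /=; apply/andP; split; first by case: load_in_flight.
    by apply: sub_all IH => y; case: load_in_flight => //= ->; rewrite orbT.
  elim: {2 3 4}es2' => //= x s IH /andP[fl /IH{}IH] /andP[aw /IH ->]; rewrite andbT.
  apply/implyP => awx; rewrite lfE; move: fl aw; rewrite awx awaiting_flight //= => ->.
  by rewrite andbF orbF.
Qed.

(** A flushed in-flight load passes from the buffer to its [lf] bit, and a load marked [ReEx] stays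
    in flight. Trimming thus loses no outstanding request; only the status of [e] may change. *)
Lemma focus_in_flight p p' es1 e e' es2 es2' k :
  focus p p' es1 e e' es2 es2' -> increasing (rob p) ->
  in_flight p' k =
    if k == e_idx e then lf p k || load_in_flight e' else in_flight p k.
Proof.
move=> fo inc; have flf := @focus_lf _ _ _ _ _ _ _ k fo inc.
rewrite /in_flight; case: eqP => [ke|/eqP neq].
  rewrite flf ?ke ?eqxx ?orbT //; congr (_ || _).
  case: fo => old new _ _ _ ei _ _ _ tr _.
  rewrite new has_cat /= {2}/flight ei eqxx /=.
  move: inc; rewrite old => /increasing_cat[lt12 _ inc2].
  case h1: (has _ es1).
    have := lt12 _ _ (has_idx_flight h1) (mem_head _ _); by rewrite ltnn.
  case h2: (has _ es2'); last by rewrite orbF.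
  have := allP (increasing_cons inc2) _ (has_idx_flight (trim_flight tr h2)).
  by rewrite /= ltnn.
case: fo => old new _ _ _ ei _ _ _ tr ->.
rewrite old new !has_cat /=.
have [-> ->]: flight k e' = false /\ flight k e = false.
  by rewrite /flight ei eq_sym (negPf neq).
have := @trim_flight k _ _ tr.
case: (lf p k) => //=; case: (has _ es1); rewrite ?orbT //=.
by case: (has _ es2) (has _ es2') => [] [] // /(_ isT).
Qed.

Lemma focus_rtags p p' es1 e e' es2 es2' :
  focus p p' es1 e e' es2 es2' -> subseq (rtags (rob p')) (rtags (rob p)).
Proof.
case=> -> -> _ _ _ _ _ tg _ tr _; rewrite /rtags !pmap_cat cat_subseq //=.
rewrite tg; have := trim_rtags tr; rewrite /rtags.
by case: (rtag e) => //= t; rewrite eqxx.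
Qed.

Lemma focus_at_commit p p' es1 e e' es2 es2' :
  focus p p' es1 e e' es2 es2' -> at_commit p -> at_commit p'.
Proof.
case=> + + _ _ _ _ _ _ ins _ _; rewrite /at_commit.
case: es1 => [|x s] -> -> //=; by case: (e_ins e) ins.
Qed.

Lemma focus_settled a p p' es1 e e' es2 es2' :
  focus p p' es1 e e' es2 es2' ->
  isSome (executed_store a e) ==> isSome (executed_store a e') ->
  subseq (access a e') (access a e) ->
  subseq (settled a (rob p')) (settled a (rob p)).
Proof.
case=> -> -> _ _ _ _ _ _ _ tr _ xst acc; rewrite !settled_cat cat_subseq //.
case: ifP => // _ /=; case: (executed_store a e) xst => /= [? ->//|_].
by case: (executed_store a e') => [?|] /=; rewrite ?sub0seq ?cat_subseq ?trim_settled.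
Qed.

Lemma get_entry_split p k e :
  get_entry p k = Some e ->
  e_idx e = k /\ exists es1 es2, rob p = es1 ++ e :: es2.
Proof.
rewrite /get_entry; elim: (rob p) => //= x s IH; case: eqP => [kE|_].
  by case=> <-; split=> //; exists [::], s.
by case/IH => -> [es1 [es2 ->]]; split=> //; exists (x :: es1), es2.
Qed.

Section Split.

Variables (es1 es2 : seq entry) (e : entry).
Hypothesis inc : increasing (es1 ++ e :: es2).

Lemma split_lt : all (fun x => e_idx x < e_idx e) es1.
Proof.
have [lt12 _ _] := increasing_cat inc.
rewrite -(all_map (@e_idx _ _ _ _) (fun k => k < e_idx e)).
by apply/allP => k k1; apply: lt12 => //; rewrite mem_head.
Qed.

Lemma split_gt : all (fun x => e_idx e < e_idx x) es2.
Proof.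
have [_ _ /increasing_cons] := increasing_cat inc; by rewrite all_map.
Qed.

Lemma split_filter (P : pred nat) :
  (forall k, k < e_idx e -> P k) -> (forall k, e_idx e < k -> ~~ P k) ->
  [seq x <- es1 ++ e :: es2 | P (e_idx x)] = es1 ++ (if P (e_idx e) then [:: e] else [::]).
Proof.
move=> Plt Pgt; rewrite filter_cat /=.
have -> : [seq x <- es1 | P (e_idx x)] = es1.
  by apply/all_filterP; apply: sub_all split_lt => x; apply: Plt.
have -> : [seq x <- es2 | P (e_idx x)] = [::].
  apply: size0nil; apply/eqP; rewrite size_filter -leqn0 leqNgt -has_count -all_predC.
  by apply: sub_all split_gt => x; apply: Pgt.
by [].
Qed.

End Split.

Lemma older_split p es1 e es2 :
  increasing (rob p) -> rob p = es1 ++ e :: es2 -> older p (e_idx e) = es1.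
Proof.
rewrite /older => inc E; rewrite E in inc *.
rewrite (split_filter inc (P := fun k => k < e_idx e)) ?ltnn ?cats0 //.
by move=> k; rewrite -leqNgt; apply: ltnW.
Qed.

Lemma older_split_succ p es1 e es2 :
  increasing (rob p) -> rob p = es1 ++ e :: es2 ->
  older p (e_idx e).+1 = es1 ++ [:: e].
Proof.
rewrite /older => inc E; rewrite E in inc *.
rewrite (split_filter inc (P := fun k => k < (e_idx e).+1)) ?ltnSn //.
  by move=> k /ltnW.
by move=> k; rewrite -leqNgt.
Qed.

Lemma younger_split p es1 e es2 :
  increasing (rob p) -> rob p = es1 ++ e :: es2 -> younger p (e_idx e) = es2.
Proof.
rewrite /younger => inc E; rewrite E in inc *; rewrite filter_cat /= ltnn.
have /all_filterP -> := split_gt inc.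
have := split_lt inc; elim: es1 {E inc} => //= x s IH /andP[lt /IH{}IH].
by rewrite ltnNge (ltnW lt).
Qed.

Lemma get_entry_focus p es1 e es2 :
  increasing (rob p) -> rob p = es1 ++ e :: es2 -> get_entry p (e_idx e) = Some e.
Proof.
rewrite /get_entry => inc E; rewrite E in inc *; rewrite filter_cat /= eqxx.
have := split_lt inc; elim: es1 {E inc} => //= x s IH /andP[lt /IH].
by rewrite ltn_eqF.
Qed.

Lemma put_entry_split p es1 e es2 e' :
  increasing (rob p) -> rob p = es1 ++ e :: es2 -> e_idx e' = e_idx e ->
  put_entry e' p = set_rob p (es1 ++ e' :: es2).
Proof.
rewrite /put_entry => inc E ei; rewrite E in inc *; congr set_rob.
rewrite map_cat /= ei eqxx; congr (_ ++ _ :: _).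
  have := split_lt inc; elim: es1 {E inc} => //= x s IH /andP[lt /IH ->].
  by rewrite ltn_eqF.
have := split_gt inc; elim: es2 {E inc} => //= x s IH /andP[lt /IH ->].
by rewrite gtn_eqF.
Qed.

End Processor.

(** * Killing, flushing and overwriting entries *)

Section ProcessorSteps.

Variables PC Reg Addr Val : eqType.

Local Notation entry := (entry PC Reg Addr Val).
Local Notation proc := (proc PC Reg Addr Val).
Local Notation program := (program PC Reg Addr Val).

Implicit Types (pr : program) (p : proc) (e : entry) (es : seq entry) (a : Addr).

Definition blocks a e : bool :=
  if e_ins e is RSt _ _ _ (Some b) _ _ then b == a else false.

Definition affected a e : bool :=
  match e_ins e, e_ex e with
  | RLd _ _ _ (Some b) _ _, (Exe | ReEx | Done) => b == a
  | _, _ => false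
  end.

Lemma search_affected_cons a e es :
  search_affected a (e :: es) =
    if blocks a e then [::]
    else if affected a e then e_idx e :: search_affected a es
    else search_affected a es.
Proof.
rewrite /blocks /affected /=.
by case: (e_ins e) => [||? ? ? [?|]||] //= ? ? ? [?|] // ? ?; case: (e_ex e).
Qed.

(* The outcome of [kill] on the entries younger than the killing access: what
   remains of them, and the program counter of the first flushed one. *)
Fixpoint killed a es : seq entry * option PC :=
  if es is e :: es' then
    let: (es'', pc) := killed a es' in
    if blocks a e then (es, None)
    else if affected a e then
      if e_ex e is Done then ([::], Some (e_pc e)) else (set_ex e ReEx :: es'', pc)
    else (e :: es'', pc)
  else ([::], None).

Lemma affected_in_flight a e :
  affected a e -> if e_ex e is Done then true else load_in_flight e.
Proof.
by rewrite /affected /load_in_flight; case: (e_ins e) => //; case: (e_ex e) => //;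
   move=> ? ? ? [].
Qed.

(** Indices are strictly increasing, so each lookup by index in [kill] finds the very entry met at
    that point of the search, and the effect can be computed by recursion on the list. *)
Lemma kill_killed a p es1 es2 :
  increasing (rob p) -> rob p = es1 ++ es2 ->
  let p' := kill (search_affected a es2) p in
  [/\ rob p' = es1 ++ (killed a es2).1,
      pcr p' = odflt (pcr p) (killed a es2).2,
      [/\ rf p' = rf p, bound p' = bound p & hist p' = hist p]
    & forall k, lf p' k = lf p k ||
        (has (flight k) es2 && ~~ has (flight k) (killed a es2).1)].
Proof.
elim: es2 es1 p => [|e es2 IH] es1 p inc E.
  by split=> //= k; rewrite orbF.
rewrite search_affected_cons; have gt := split_gt (es1 := es1) (es2 := es2) (e := e).
rewrite E in gt inc; move/(_ inc) in gt; rewrite -E in inc.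
have fl2 k : flight k e -> has (flight k) es2 = false.
  case/andP => /eqP <- _; apply/negbTE; rewrite -all_predC.
  by apply: sub_all gt => x /=; rewrite /flight => /gtn_eqF ->.
case bl: (blocks a e).
  rewrite /= bl; case: (killed a es2) => es2' pc'.
  by split=> //= k; rewrite andbN orbF.
case aff: (affected a e); last first.
  have [|rE pE rest lfE] := IH (es1 ++ [:: e]) p inc; first by rewrite -catA.
  case def_k: (killed a es2) rE pE rest lfE => [es2' pc'] rE pE rest lfE.
  rewrite /= bl aff def_k; split=> //; first by rewrite rE -catA.
  move=> k; rewrite lfE /=; congr (_ || _).
  by case fl: (flight k e) => //=; rewrite fl2.
have := affected_in_flight aff; rewrite /=.
rewrite (get_entry_focus inc E); case def_x: (e_ex e) => fl; last first.
- rewrite bl aff; case: (killed a es2) => es2' pc'; rewrite cats0.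
  split=> //=; first exact: (older_split inc E).
  move=> k; rewrite E has_cat /= andbT; congr (_ || _).
  have lt := split_lt (es1 := es1) (es2 := es2) (e := e).
  rewrite E in inc; have {}lt := lt inc.
  have -> : has (fun e0 => [&& e_idx e0 == k, e_idx e <= e_idx e0
                              & load_in_flight e0]) es1 = false.
    apply/negbTE; rewrite -all_predC; apply: sub_all lt => x /=.
    by rewrite ltnNge => /negPf ->; rewrite andbF.
  rewrite leqnn /=; congr (_ || _).
  by elim: es2 gt {E inc IH fl2} => //= x s IH /andP[/ltnW -> /IH ->].
all: pose e' := set_ex e ReEx; rewrite (put_entry_split (e' := e') inc E) //.
all: have {def_x} fle : load_in_flight e by move: fl; rewrite ?def_x.
all: case: (IH (es1 ++ [:: e']) (set_rob p (es1 ++ e' :: es2))).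
all: try by move: inc; rewrite /increasing E !map_cat.
all: try by rewrite -catA.
all: rewrite bl aff; case: (killed a es2) => es2' pc' rE pE [rfE bE hE] lfE.
all: split=> //; first by rewrite rE -catA.
all: move=> k; rewrite lfE /= flight_ReEx //; congr (_ || _).
all: by case fle': (flight k e) => //=; rewrite fl2.
Qed.

Lemma killed_trim a es : trim es (killed a es).1.
Proof.
elim: es => [|e es IH] /=; first exact: TrimCut.
case: (killed a es) IH => es' pc' /= IH.
case: ifP => _; first exact: trim_refl.
case aff: (affected a e); last exact: TrimKeep.
have := affected_in_flight aff.
by case: (e_ex e) => fl; constructor.
Qed.

Lemma killed_rob_ok a pr rs pc es pc' :
  rob_ok pr rs pc es pc' ->
  rob_ok pr rs pc (killed a es).1 (odflt pc' (killed a es).2).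
Proof.
elim: es rs pc => //= e es IH rs pc [pcE eok ok]; have := IH _ _ ok.
case: (killed a es) => es' pc'' /= ok'.
case: ifP => _ //; case aff: (affected a e) => //.
have := affected_in_flight aff.
move: (aff) eok ok'; rewrite /affected /entry_ok /=.
case def_x: (e_ex e) => //= aff_e eok ok' _; (split=> //).
all: rewrite /entry_ok /=.
all: case: (e_ins e) aff_e eok => // addrf' srcs' dst' [b|] v t //= _.
all: by case: (fetch pr _).
Qed.

(** [StEx] computes the address and finishes the store in one step, so the store that stops
    [search_affected] also stops [settled]. *)
Lemma blocks_executed a pr rs e :
  entry_ok pr rs e -> blocks a e -> executed_store a e.
Proof.
rewrite /entry_ok /blocks /executed_store.
case: (fetch pr _) => [op srcs dst|addrf srcs dst|addrf dataf srcs||];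
  case: (e_ins e) => [op' srcs' dst' v|addrf' srcs' dst' a' v t|
                      addrf' dataf' srcs' a' v t||] //.
by case: a' => [b|] //; case: v => [v|] [_ _] // [-> _ _ _] ->.
Qed.

(** Up to the first store to [a], every started load from [a] is flushed or marked [ReEx]; beyond
    that store [settled] does not look. Hence a load that issues its request becomes the last
    settled load of its address. *)
Lemma killed_settled a pr rs pc es pc' :
  rob_ok pr rs pc es pc' -> settled a (killed a es).1 = [::].
Proof.
elim: es rs pc => //= e es IH rs pc [_ eok /IH].
case: (killed a es) => es' pc'' /= setE.
case bl: (blocks a e) => /=; first by rewrite (blocks_executed eok bl).
case aff: (affected a e); last first.
  rewrite /= setE cats0; case: ifP => // _; move: aff; rewrite /affected /access.
  case: (e_ins e) => // addrf' srcs' dst' [b|] v t //.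
  by case: (e_ex e) => [_|->|->|->] //; case: ifP.
have := affected_in_flight aff.
by case: (e_ex e) => fl //=; rewrite access_ReEx setE; case: ifP.
Qed.

(** Searches for [a] may change: the started loads from [a] that would notice are killed, and the
    first store to [a] shields those behind it. *)
Lemma killed_loads_ok a pr rs pc es pc' prev prev' :
  (forall b, b != a -> search_bypass b prev' = search_bypass b prev) ->
  rob_ok pr rs pc es pc' -> loads_ok prev es -> loads_ok prev' (killed a es).1.
Proof.
elim: es rs pc prev prev' => //= e es IH rs pc prev prev' H [_ eok ok] [lok lsok].
have {}IH := IH _ _ (e :: prev) (e :: prev') _ ok lsok.
case: (killed a es) IH => es' pc'' IH.
have {}IH : loads_ok (e :: prev') es'.
  apply: IH => b ba; rewrite !search_bypass_cons H //.
case bl: (blocks a e) => /=.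
  split; first by move: bl; rewrite /blocks /load_ok; case: (e_ins e).
  apply: loads_ok_eq lsok => b; rewrite !search_bypass_cons.
  have [->|ba] := eqVneq b a; last by rewrite H.
  have := blocks_executed eok bl.
  by case: (executed_store a e) => [[v t]|].
case aff: (affected a e); last first.
  split=> //; move: aff lok; rewrite /affected /load_ok.
  case: (e_ins e) => // addrf' srcs' dst' [b|] v t //.
  by case: (e_ex e) => // ba; rewrite H ?ba.
have := affected_in_flight aff.
case: (e_ex e) => fl //=; split; rewrite ?/load_ok /=.
all: try by case: (e_ins e) => // ? ? ? [].
all: apply: loads_ok_eq IH => b; rewrite !search_bypass_cons.
all: by rewrite executed_store_ReEx.
Qed.

Definition retouched e e' : Prop :=
  [/\ e_idx e' = e_idx e, e_pc e' = e_pc e, rtag e' = rtag e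
    & if e_ins e is RCommit then False else True].

Lemma focus_put p es1 e es2 e' :
  increasing (rob p) -> rob p = es1 ++ e :: es2 -> retouched e e' ->
  focus p (put_entry e' p) es1 e e' es2 es2.
Proof.
move=> inc E [ei epc et ins]; rewrite (put_entry_split inc E ei).
split=> //; first exact: trim_refl.
by move=> k /=; rewrite andbN orbF.
Qed.

Lemma increasing_retouch es1 e es2 e' :
  e_idx e' = e_idx e -> increasing (es1 ++ e :: es2) -> increasing (es1 ++ e' :: es2).
Proof. by rewrite /increasing !map_cat /= => ->. Qed.

Lemma focus_flush p es1 e es2 e' npc :
  increasing (rob p) -> rob p = es1 ++ e :: es2 -> retouched e e' ->
  focus p (flush (e_idx e).+1 npc (put_entry e' p)) es1 e e' es2 [::].
Proof.
move=> inc E [ei epc et ins]; rewrite (put_entry_split inc E ei).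
have inc' : increasing (es1 ++ e' :: es2).
  by apply: increasing_retouch ei _; rewrite -E.
split=> //=.
- by rewrite -ei (older_split_succ (p := set_rob p (es1 ++ e' :: es2)) inc' erefl).
- exact: TrimCut.
- move=> k; rewrite andbT has_cat /= ei ltnn andbF /=; congr (_ || _).
  have -> : has (fun e0 => [&& e_idx e0 == k, e_idx e < e_idx e0
                              & load_in_flight e0]) es1 = false.
    apply/negbTE; rewrite -all_predC; apply: sub_all (split_lt inc') => x /=.
    by rewrite ei => /ltnW; rewrite leqNgt => /negPf ->; rewrite andbF.
  have := split_gt inc'; rewrite ei.
  by elim: es2 {E inc inc'} => //= x s IH /andP[-> /IH ->].
Qed.

Lemma focus_kill a p es1 e es2 e' :
  increasing (rob p) -> rob p = es1 ++ e :: es2 -> retouched e e' ->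
  let p' := kill (find_affected_ld p (e_idx e) a) (put_entry e' p) in
  focus p p' es1 e e' es2 (killed a es2).1 /\
  pcr p' = odflt (pcr p) (killed a es2).2.
Proof.
move=> inc E [ei epc et ins]; rewrite (put_entry_split inc E ei) /=.
rewrite /find_affected_ld (younger_split inc E).
have inc' : increasing (es1 ++ e' :: es2).
  by apply: increasing_retouch ei _; rewrite -E.
have := @kill_killed a (set_rob p (es1 ++ e' :: es2)) (es1 ++ [:: e']) es2 inc'.
case=> [|rE pE [rfE bE hE] lfE]; first by rewrite -catA.
split=> //; split=> //; first by rewrite rE -catA.
exact: killed_trim.
Qed.

(* A step of a processor that no other component of the system can observe. *)
Record quiet pr pc p p' : Prop := Quiet {
  quiet_ok : proc_ok pr p' pc;
  quiet_rf : rf p' = rf p;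
  quiet_hist : hist p' = hist p;
  quiet_flight : forall k, in_flight p k -> in_flight p' k;
  quiet_rtags : forall t, count_mem t (rtags (rob p')) <= count_mem t (rtags (rob p));
  quiet_commit : at_commit p -> at_commit p';
  quiet_settled : forall a, subseq (settled a (rob p')) (settled a (rob p))
}.

Lemma in_flight_entry p es1 e es2 :
  increasing (rob p) -> rob p = es1 ++ e :: es2 ->
  (if e_ins e is RCommit then False else True) ->
  in_flight p (e_idx e) = lf p (e_idx e) || load_in_flight e.
Proof.
move=> inc E ins.
have fo : focus p p es1 e e es2 es2.
  split=> //; first exact: trim_refl.
  by move=> k'; rewrite andbN orbF.
by rewrite (focus_in_flight _ fo inc) eqxx.
Qed.

Lemma focus_quiet pr pc p p' es1 e e' es2 es2' :
  focus p p' es1 e e' es2 es2' -> increasing (rob p) -> proc_ok pr p' pc ->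
  load_in_flight e = load_in_flight e' ->
  (forall a, subseq (settled a (rob p')) (settled a (rob p))) ->
  quiet pr pc p p'.
Proof.
move=> fo inc ok fl sub; split=> //.
- by case: fo.
- by case: fo.
- move=> k; rewrite (focus_in_flight k fo inc) -fl; case: eqP => // ->.
  by case: fo => E _ _ _ _ _ _ _ ins _ _; rewrite (in_flight_entry inc E ins).
- by move=> t; apply: leq_count_subseq; exact: focus_rtags fo.
- exact: focus_at_commit fo.
Qed.

Lemma proc_ok_split pr p pc es1 e es2 :
  proc_ok pr p pc -> rob p = es1 ++ e :: es2 ->
  [/\ entry_ok pr (regs_after (Some \o rf p) es1) e,
      rob_ok pr (reg_update (regs_after (Some \o rf p) es1) e) (e_npc e) es2 (pcr p),
      load_ok (rev es1) e & loads_ok (e :: rev es1) es2].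
Proof.
move=> ok E; have := pok_rob ok; have := pok_loads ok; rewrite E.
rewrite rob_ok_cat loads_ok_cat cats0 /= => -[_ [lok lsok]] [mid _ [_ eok rok]].
by split.
Qed.

Lemma ready_known pr p pc es1 e es2 srcs :
  proc_ok pr p pc -> rob p = es1 ++ e :: es2 -> ready p (e_idx e) srcs ->
  known (regs_after (Some \o rf p) es1) srcs /\
  operands p (e_idx e) srcs = pmap (regs_after (Some \o rf p) es1) srcs.
Proof.
move=> ok E; rewrite /ready /operands /known.
have rE r : read_reg p (e_idx e) r = regs_after (Some \o rf p) es1 r.
  by rewrite read_regE (older_split (pok_inc ok) E).
move=> rd; split; last exact: eq_pmap.
by rewrite -(eq_all (a1 := fun r => isSome (read_reg p (e_idx e) r))) // => r; rewrite rE.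
Qed.

Lemma reg_update_refine rs e e' :
  match dest e, dest e' with
  | Some (d, v), Some (d', v') => d = d' /\ (v = None \/ v = v')
  | None, None => True
  | _, _ => False
  end ->
  regs_le (reg_update rs e) (reg_update rs e').
Proof.
rewrite /reg_update; case: (dest e) (dest e') => [[d v]|] [[d' v']|] //.
  by case=> <- [] -> r w; case: eqP.
by move=> _ r.
Qed.

End ProcessorSteps.

(** * Execution rules of the reorder buffer *)

Section QuietSteps.

Variables PC Reg Addr Val : eqType.

Local Notation entry := (entry PC Reg Addr Val).
Local Notation proc := (proc PC Reg Addr Val).
Local Notation program := (program PC Reg Addr Val).

Implicit Types (pr : program) (p : proc) (e : entry) (es : seq entry) (a : Addr).

Lemma search_bypass_eq e e' es b :
  is_reconcile e' = is_reconcile e -> executed_store b e' = executed_store b e ->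
  search_bypass b (e' :: es) = search_bypass b (e :: es).
Proof. by rewrite !search_bypass_cons => -> ->. Qed.

(** Shared by bypassing and by answers of the memory. If the value was missing or correctly
    predicted, the younger entries see a refinement of the registers; otherwise they are flushed and
    nothing is left to check. *)
Lemma resolve_load pr pc p es1 es2 idx epc npc f srcs dst a v t0 x res tg :
  let e := Entry idx epc npc (RLd PC f srcs dst (Some a) v t0) x in
  let e' := Entry idx epc npc (RLd PC f srcs dst (Some a) (Some res) (Some tg)) Done in
  let p' := check_pred v res idx npc (put_entry e' p) in
  proc_ok pr p pc -> rob p = es1 ++ e :: es2 -> load_ok (rev es1) e' ->
  proc_ok pr p' pc /\ exists es2', focus p p' es1 e e' es2 es2'.
Proof.
move=> e e' p' ok E lok; have [eok rok _ lsok] := proc_ok_split ok E.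
have re : retouched e e' by [].
have inc := pok_inc ok.
have eok' : entry_ok pr (regs_after (Some \o rf p) es1) e'.
  by move: eok; rewrite /entry_ok /=; case: (fetch pr epc) => // ? ? ? [].
have lsok' : loads_ok (e' :: rev es1) es2.
  by apply: loads_ok_eq lsok => b; apply: search_bypass_eq.
have keep : v = None \/ v = Some res ->
    rob_ok pr (reg_update (regs_after (Some \o rf p) es1) e') npc es2 (pcr p).
  by move=> vE; apply: rob_ok_mono rok; apply: reg_update_refine.
rewrite /p' /check_pred; case: v @e @e' @p' E lok re eok eok' {rok} lsok lsok' keep
  => [w|] e e' p' E lok re eok eok' lsok lsok' keep; last first.
  have fo := focus_put inc E re; split; last by exists es2.
  by apply: (focus_proc_ok fo ok) => //; apply: keep; left.
case: eqVneq => [wE|_] /=.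
  have fo := focus_put inc E re; split; last by exists es2.
  by apply: (focus_proc_ok fo ok) => //; apply: keep; right; rewrite wE.
have fo := focus_flush npc inc E re; split; last by exists [::].
exact: (focus_proc_ok fo ok).
Qed.

Section Steps.

Variables (pr : program) (pc : PC) (p : proc).
Hypothesis ok : proc_ok pr p pc.

Let inc : increasing (rob p) := pok_inc ok.

Lemma nm_ex_quiet idx epc npc op srcs dst v0 npc' v :
  get_entry p idx = Some (Entry idx epc npc (RNm Addr op srcs dst v0) Idle) ->
  ready p idx srcs -> op epc (operands p idx srcs) = (npc', v) ->
  let p' := put_entry (Entry idx epc npc' (RNm Addr op srcs dst (Some v)) Done) p in
  quiet pr pc p (if npc' != npc then flush idx.+1 npc' p' else p').
Proof.
set e := Entry idx _ _ _ _; set e' := Entry idx _ _ _ Done.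
move=> /get_entry_split[_ [es1 [es2 E]]] rd opE p'.
have [eok rok _ lsok] := proc_ok_split ok E.
have [kn argE] := ready_known (e := e) ok E rd.
have v0E : v0 = None.
  move: eok; rewrite /entry_ok /=; case: (fetch pr epc) => // ? ? ? [_ _ _].
  by case: (v0) => // ? [].
have re : retouched e e' by [].
have eok' : entry_ok pr (regs_after (Some \o rf p) es1) e'.
  move: eok; rewrite /entry_ok /=; case: (fetch pr epc) => // ? ? ? [-> -> -> _].
  by split=> //; split=> //; rewrite -argE.
have lsok' : loads_ok (e' :: rev es1) es2.
  by apply: loads_ok_eq lsok => b; apply: search_bypass_eq.
have q p'' es2' : focus p p'' es1 e e' es2 es2' -> proc_ok pr p'' pc ->
    quiet pr pc p p''.
  by move=> fo ok''; apply: (focus_quiet fo) => // a; exact: focus_settled fo _ _.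
case: eqVneq => [npcE|_] /=.
  have fo := focus_put inc E re; apply: (q _ _ fo).
  apply: (focus_proc_ok fo ok) => //=; rewrite npcE.
  apply: rob_ok_mono rok; apply: reg_update_refine => /=.
  by split=> //; left.
have fo := focus_flush npc' inc E re; apply: (q _ _ fo).
exact: (focus_proc_ok fo ok).
Qed.

Lemma ld_addr_quiet idx epc npc f srcs dst v t :
  get_entry p idx = Some (Entry idx epc npc (RLd PC f srcs dst None v t) Idle) ->
  ready p idx srcs ->
  quiet pr pc p
    (put_entry (Entry idx epc npc
       (RLd PC f srcs dst (Some (f (operands p idx srcs))) v t) Idle) p).
Proof.
set e := Entry idx _ _ (RLd _ _ _ _ None _ _) _; set e' := Entry idx _ _ _ Idle.
move=> /get_entry_split[_ [es1 [es2 E]]] rd.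
have [eok rok _ lsok] := proc_ok_split ok E.
have [kn argE] := ready_known (e := e) ok E rd.
have re : retouched e e' by [].
have fo := focus_put inc E re; apply: (focus_quiet fo) => //.
  apply: (focus_proc_ok fo ok) => //=.
  - move: eok; rewrite /entry_ok /=; case: (fetch pr epc) => // ? ? ? [[-> eqs ->] npcE _ tE].
    by split=> //; rewrite eqs argE.
  - by apply: loads_ok_eq lsok => b; apply: search_bypass_eq.
move=> a; apply: focus_settled fo _ _ => //.
by rewrite /access /=; case: ifP.
Qed.

Lemma ld_pred_quiet idx epc npc f srcs dst oa x v :
  get_entry p idx = Some (Entry idx epc npc (RLd PC f srcs dst oa None None) x) ->
  quiet pr pc p (put_entry (Entry idx epc npc (RLd PC f srcs dst oa (Some v) None) x) p).
Proof.
set e := Entry idx _ _ (RLd _ _ _ _ _ None _) _; set e' := Entry idx _ _ _ x.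
move=> /get_entry_split[_ [es1 [es2 E]]].
have [eok rok lok lsok] := proc_ok_split ok E.
(* The value is still missing, which a [Done] load rules out. *)
have xD : if x is Done then False else True.
  move: eok; rewrite /entry_ok /=; case: (fetch pr epc) => // ? ? ? [_ _ _].
  by case: (x) => // -[].
have re : retouched e e' by [].
have fo := focus_put inc E re; apply: (focus_quiet fo) => //.
  apply: (focus_proc_ok fo ok) => //=.
  - move: eok; rewrite /entry_ok /=; case: (fetch pr epc) => // ? ? ? [].
    by case: (x) xD.
  - by apply: rob_ok_mono rok; apply: reg_update_refine => /=; split=> //; left.
  - by move: lok; rewrite /load_ok /=; case: (oa) => // b; case: (x) xD.
  - by apply: loads_ok_eq lsok => b; apply: search_bypass_eq.
  - have := pok_lf ok; rewrite E all_cat /= => /and3P[_ /implyP] H _ aw.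
    by apply: H; move: aw; rewrite /awaiting.
move=> b; apply: focus_settled fo _ _ => //.
Qed.

Lemma ld_bypass_quiet idx epc npc f srcs dst a v res t :
  get_entry p idx = Some (Entry idx epc npc (RLd PC f srcs dst (Some a) v None) Idle) ->
  find_bypass p idx a = BypassHit res t ->
  quiet pr pc p
    (check_pred v res idx npc
       (put_entry (Entry idx epc npc
          (RLd PC f srcs dst (Some a) (Some res) (Some (TSt Addr t))) Done) p)).
Proof.
set e := Entry idx _ _ (RLd _ _ _ _ _ _ None) _; set e' := Entry idx _ _ _ Done.
move=> /get_entry_split[_ [es1 [es2 E]]].
rewrite /find_bypass (older_split (e := e) inc E) => hit.
have lok' : load_ok (rev es1) e' by rewrite /load_ok /= hit.
have [ok' [es2' fo]] := resolve_load ok E lok'.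
apply: (focus_quiet fo) => // b.
(* The store that supplies the value lies in [es1] and ends [settled a] there, so nothing changes
   for this address. *)
have [->|ba] := eqVneq b a.
  case: (fo) => -> -> _ _ _ _ _ _ _ _ _.
  by rewrite !settled_cat (bypass_hit_executed hit) !cats0.
by apply: focus_settled fo _ _ => //; rewrite /access /= eq_sym (negPf ba).
Qed.

(** The executed store now ends [settled a] at its own position, so the settled list can only
    shrink. The kill is what restores [load_ok] for younger loads that had looked past this
    store. *)
Lemma st_ex_quiet idx epc npc f g srcs oa v0 t :
  get_entry p idx = Some (Entry idx epc npc (RSt PC f g srcs oa v0 t) Idle) ->
  ready p idx srcs ->
  let a := f (operands p idx srcs) in
  quiet pr pc p
    (kill (find_affected_ld p idx a)
       (put_entry (Entry idx epc npc
          (RSt PC f g srcs (Some a) (Some (g (operands p idx srcs))) t) Done) p)).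
Proof.
set e := Entry idx _ _ _ Idle => gE rd a; set e' := Entry idx _ _ _ Done.
have [_ [es1 [es2 E]]] := get_entry_split gE.
have [eok rok _ lsok] := proc_ok_split ok E.
have [kn argE] := ready_known (e := e) ok E rd.
have re : retouched e e' by [].
have xst b : executed_store b e = None.
  by rewrite /executed_store /=; case: (oa) => // ?; case: (v0).
have [fo pcrE] := focus_kill a inc E re.
apply: (focus_quiet fo) => //.
  apply: (focus_proc_ok fo ok) => //=.
  - move: eok; rewrite /entry_ok /=; case: (fetch pr epc) => // ? ? ? [[-> -> eqs] npcE _].
    by split=> //; rewrite eqs /a argE.
  - rewrite pcrE; apply: killed_rob_ok; apply: rob_ok_mono rok.
    exact: reg_update_refine.
  - apply: (killed_loads_ok (prev := e :: rev es1) _ rok) => // b ba.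
    by apply: search_bypass_eq => //; rewrite xst /executed_store /= eq_sym (negPf ba).
by move=> b; apply: focus_settled fo _ _ => //; rewrite xst.
Qed.

End Steps.

Lemma ld_req_focus pr pc p es1 es2 idx epc npc f srcs dst a v :
  let e := Entry idx epc npc (RLd PC f srcs dst (Some a) v None) Idle in
  let e' := Entry idx epc npc (RLd PC f srcs dst (Some a) v None) Exe in
  let p' := kill (find_affected_ld p idx a) (put_entry e' p) in
  proc_ok pr p pc -> rob p = es1 ++ e :: es2 ->
  find_bypass p idx a = @BypassTop Val -> ~~ lf p idx ->
  [/\ proc_ok pr p' pc, focus p p' es1 e e' es2 (killed a es2).1,
      settled a (rob p') = rcons (settled a es1) (inr idx),
      subseq (settled a es1) (settled a (rob p))
    & forall b, b != a -> subseq (settled b (rob p')) (settled b (rob p))].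
Proof.
move=> e e' p' ok E; have inc := pok_inc ok.
rewrite /find_bypass (older_split (e := e) inc E) => top nlf.
have [eok rok _ lsok] := proc_ok_split ok E.
have re : retouched e e' by [].
have [fo pcrE] := focus_kill a inc E re.
have nx := bypass_top_not_executed top.
split=> //.
- apply: (focus_proc_ok fo ok) => //=.
  + rewrite pcrE; apply: killed_rob_ok; apply: rob_ok_mono rok.
    by apply: reg_update_refine => /=; split=> //; right.
  + exact: (killed_loads_ok (prev := e :: rev es1) _ rok).
- case: fo => _ -> _ _ _ _ _ _ _ _ _.
  rewrite settled_cat (negPf nx) /= (killed_settled _ rok) /access /= eqxx.
  by rewrite cats1.
- by rewrite E settled_cat prefix_subseq.
move=> b ba; apply: focus_settled fo _ _ => //.
by rewrite /access /= eq_sym (negPf ba).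
Qed.

End QuietSteps.

(** * Requests and views of the memory *)

Section Requests.

Variables (Addr Val : eqType) (n : nat).

Definition request_code (r : request Addr Val n)
    : 'I_n * nat * Addr + (Addr * Val * nat + 'I_n) :=
  match r with
  | QLd i k a => inl (i, k, a)
  | QSt a v t => inr (inl (a, v, t))
  | QCom i => inr (inr i)
  end.

Definition request_decode (c : 'I_n * nat * Addr + (Addr * Val * nat + 'I_n))
    : request Addr Val n :=
  match c with
  | inl (i, k, a) => QLd Val i k a
  | inr (inl (a, v, t)) => QSt n a v t
  | inr (inr i) => QCom Addr Val i
  end.

Lemma request_codeK : cancel request_code request_decode.
Proof. by case. Qed.

HB.instance Definition _ := Equality.copy (request Addr Val n) (can_type request_codeK).

Local Notation request := (request Addr Val n).
Local Notation item := (Val * option nat + nat)%type.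

Definition has_tag t (r : request) : bool := if r is QSt _ _ t' then t' == t else false.

Definition is_load i k (r : request) : bool :=
  if r is QLd i' k' _ then (i' == i) && (k' == k) else false.

Definition issued_by i (r : request) : bool :=
  match r with QLd i' _ _ | QCom i' => i' == i | QSt _ _ _ => false end.

Definition item_of i a (r : request) : option item :=
  match r with
  | QLd i' k b => if (i' == i) && (b == a) then Some (inr k) else None
  | QSt b v t => if b == a then Some (inl (v, Some t)) else None
  | QCom _ => None
  end.

(* The requests of processor [i] to [a] and all stores to [a] of a view, the
   closest to the memory first. *)
Definition pending i a (V : seq request) : seq item := rev (pmap (item_of i a) V).

Definition coherence i a (H : seq (Val * option nat)) V : seq item :=
  map inl H ++ pending i a V.

Lemma pending_cat i a V1 V2 : pending i a (V1 ++ V2) = pending i a V2 ++ pending i a V1.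
Proof. by rewrite /pending pmap_cat rev_cat. Qed.

Lemma pending_cons i a r V :
  pending i a (r :: V) = pending i a V ++ seq_of_opt (item_of i a r).
Proof.
by rewrite /pending /=; case: (item_of i a r) => [z|] /=; rewrite ?cats0 // rev_cons cats1.
Qed.

Lemma mem_pending_store i a v t V : (inl (v, Some t) \in pending i a V) = (QSt n a v t \in V).
Proof.
rewrite mem_rev; elim: V => //= r V IH; rewrite inE -IH.
case: r => [i' k b|b w u|i'] /=.
- by case: ifP.
- case: (b =P a) => [->|ba]; last by case: eqP => // -[/esym].
  by rewrite inE; congr (_ || _); apply/eqP/eqP => [[-> ->]|[-> ->]].
- by [].
Qed.

Lemma pending_None i a v V : (inl (v, None) \in pending i a V) = false.
Proof.
rewrite mem_rev; elim: V => //= r V IH.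
by case: r => [i' k b|b w u|i'] //=; case: ifP => // _; rewrite inE IH orbF; apply/eqP.
Qed.

Lemma mem_pending_load i a k V : (inr k \in pending i a V) = (QLd Val i k a \in V).
Proof.
rewrite mem_rev; elim: V => //= r V IH; rewrite inE -IH.
case: r => [i' k' b|b w u|i'] /=.
- case: ifP => [/andP[/eqP-> /eqP->]|nia].
    by rewrite inE; congr (_ || _); apply/eqP/eqP => [[->]|[->]].
  by case: (QLd Val i k a =P _) nia => // -[-> _ ->]; rewrite !eqxx.
- by case: ifP.
- by [].
Qed.

Lemma count_pmap_le (I : Type) (J : eqType) (f : I -> option J) (P : pred I) x s :
  (forall r, f r = Some x -> P r) -> count_mem x (pmap f s) <= count P s.
Proof.
move=> fP; elim: s => //= r s IH; case def_y: (f r) => [y|] /=; last first.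
  exact: leq_trans IH (leq_addl _ _).
by apply: leq_add => //; case: eqP => // yx; rewrite fP // def_y yx.
Qed.

(** A repeated item would mean a tag occurring twice among pending and past stores, a load request
    occurring twice, or two initial values. *)
Lemma coherence_uniq i a H V :
  (forall t, count (has_tag t) V + count (fun x => x.2 == Some t) H <= 1) ->
  (forall k, count (is_load i k) V <= 1) ->
  count (fun x => x.2 == None) H <= 1 -> uniq (coherence i a H V).
Proof.
move=> st ld init; apply: count_mem_uniq => x.
suff: count_mem x (coherence i a H V) <= 1.
  move=> le1; case: (boolP (x \in _)) => [xC|/count_memPn //].
  by apply/eqP; rewrite eqn_leq le1 -has_count has_pred1.
rewrite count_cat count_rev count_map.
have st_le v t : count_mem (inl (v, Some t)) (pmap (item_of i a) V) <= count (has_tag t) V.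
  apply: count_pmap_le => -[i' k b|b w u|i'] //=; case: ifP => //= _ [_ ->]; exact: eqxx.
case: x => [[v [t|]]|k].
- apply: leq_trans (st t); rewrite addnC leq_add //; apply: sub_count => y /=.
  by case/eqP => ->.
- have := pending_None i a v V; rewrite mem_rev => /count_memPn ->; rewrite addn0.
  by apply: leq_trans init; apply: sub_count => y /= /eqP[->].
- rewrite (eq_count (a2 := pred0)) // count_pred0 add0n.
  apply: leq_trans (ld k); apply: count_pmap_le => -[i' k' b|b w u|i'] //=.
    by case: ifP => //= /andP[-> _] [->]; rewrite eqxx.
  by case: ifP.
Qed.

End Requests.

(** * The requests along a route *)

Section Views.

Variables (Addr Val : eqType) (n : nat) (T : hmb_tree n).

Local Notation request := (request Addr Val n).
Implicit Types (f : 'I_(nseg T) -> seq request) (j k : 'I_(nseg T)) (r : request).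

Definition view f j : seq request := flatten (map f (route j)).

Definition all_requests f : seq request := flatten (map f (topological T)).

Lemma subseq_flatten (I : eqType) (g : I -> seq request) s1 s2 :
  subseq s1 s2 -> subseq (flatten (map g s1)) (flatten (map g s2)).
Proof.
elim: s2 s1 => [|y s2 IH] [|x s1] //= sub; first exact: sub0seq.
case: eqP sub => [->|_] /IH sub; first by rewrite cat_subseq.
exact: subseq_trans sub (suffix_subseq _ _).
Qed.

Lemma view_subseq f j : subseq (view f j) (all_requests f).
Proof. exact/subseq_flatten/route_topological. Qed.

Lemma count_view f j P : count P (view f j) <= count P (all_requests f).
Proof. exact/leq_count_subseq/view_subseq. Qed.

Lemma all_requestsP f r : reflect (exists j, r \in f j) (r \in all_requests f).
Proof.
apply: (iffP flatten_mapP) => [[j _ rj]|[j rj]]; exists j => //.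
exact: mem_topological.
Qed.

Lemma mem_viewP f j r : r \in view f j -> r \in all_requests f.
Proof. exact/mem_subseq/view_subseq. Qed.

Lemma count_update f j x P :
  count P (all_requests [eta f with j |-> x]) + count P (f j) =
  count P (all_requests f) + count P x.
Proof.
have [A [B [fE uE]]] := flatten_update f (topological_uniq T) (mem_topological j).
by rewrite /all_requests fE uE !count_cat; lia.
Qed.

Lemma view_update f j j0 :
  if j \in route j0 then
    exists A B, view f j0 = A ++ f j ++ B /\
      forall x, view [eta f with j |-> x] j0 = A ++ x ++ B
  else forall x, view [eta f with j |-> x] j0 = view f j0.
Proof.
case: ifPn => jr; first exact: flatten_update (route_uniq j0) jr.
move=> x; apply: flatten_notin => k kr /=; case: eqP => // kj.
by rewrite -kj kr in jr.
Qed.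

Lemma view_push f j x : view [eta f with j |-> x :: f j] j = x :: view f j.
Proof.
rewrite /view; have := route_uniq j; rewrite routeE /= eqxx => /andP[jk _].
congr (_ :: _ ++ _); apply: flatten_notin => k kr /=; case: eqP => // kj.
by move: jk; rewrite -{1}kj kr.
Qed.

(** A segment whose parent is the memory ends every route through it, so its bottom request is the
    last of each such view. *)
Lemma view_root f j l r j0 :
  f j = rcons l r -> parent j = None ->
  if j \in route j0 then view f j0 = rcons (view [eta f with j |-> l] j0) r
  else view [eta f with j |-> l] j0 = view f j0.
Proof.
move=> fj jr; have := view_update f j j0; case: ifP => [jj0|_ -> //] _.
have [s def_r] := route_split jj0; have := route_uniq j0.
rewrite /view def_r routeE jr cat_uniq /= => /and3P[_ js _].
rewrite !map_cat !flatten_cat /= eqxx fj !cats0 rcons_cat; congr (_ ++ _).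
apply: flatten_notin => k ks /=; case: eqP => // kj.
by rewrite -kj ks in js.
Qed.

(** On a route through [j], the top of [k] comes right after the bottom of [j], so the move does not
    alter the concatenation. On a route that meets [k] but not [j], the request is new: this is
    where a store becomes visible to another subtree. *)
Lemma view_flow f j k l r j0 :
  f j = rcons l r -> parent j = Some k ->
  let f' := [eta f with j |-> l, k |-> r :: f k] in
  view f' j0 = view f j0 \/
  j \notin route j0 /\ exists A B, view f j0 = A ++ B /\ view f' j0 = A ++ r :: B.
Proof.
move=> fj jk f'; have jNk : j != k.
  by apply/eqP => E; have := height_parent jk; rewrite E; lia.
case jj0: (j \in route j0).
  left; have [s def_r] := route_split jj0; have := route_uniq j0.
  rewrite /view def_r routeE jk routeE cat_uniq /=.
  rewrite inE !negb_or => /and5P[_ /and3P[js ks rs] /andP[_ jq] kq _].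
  rewrite !map_cat !flatten_cat /= !eqxx eq_sym (negPf jNk) fj cat_rcons.
  set q := (if parent k is Some k' then route k' else [::]) in jq kq rs *.
  congr (_ ++ (_ ++ (_ :: (_ ++ _)))); apply: flatten_notin => z zq /=.
    case: eqP => [zj|_]; first by rewrite -zj zq in js.
    by case: eqP => // zk; rewrite -zk zq in ks.
  case: eqP => [zj|_]; first by rewrite -zj zq in jq.
  by case: eqP => // zk; rewrite -zk zq in kq.
have fE : view f' j0 = view [eta f with k |-> r :: f k] j0.
  apply: flatten_notin => z zr /=; case: eqP => // zj.
  by rewrite -zj zr in jj0.
have := view_update f k j0; case: ifP => [_ [A [B [vE uE]]]|_ uE].
  by right; split=> //; exists A, (f k ++ B); rewrite fE uE.
by left; rewrite fE uE.
Qed.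

Lemma count_flow f j k l r P :
  f j = rcons l r -> parent j = Some k ->
  count P (all_requests [eta f with j |-> l, k |-> r :: f k]) = count P (all_requests f).
Proof.
move=> fj jk; have jNk : (j == k) = false.
  by apply/eqP => E; have := height_parent jk; rewrite E; lia.
have := count_update [eta f with k |-> r :: f k] j l P.
have := count_update f k (r :: f k) P.
rewrite /= jNk fj -cats1 count_cat /=.
set x := count P (all_requests [eta f with j |-> l, k |-> r :: f k]).
rewrite -/x; lia.
Qed.

End Views.

(** * Store and invalidation buffers against the coherence order *)

Section Observation.

Variables (Addr Val : eqType) (n : nat).

Local Notation request := (request Addr Val n).
Local Notation item := (Val * option nat + nat)%type.
Local Notation sb_entry := (sb_entry Addr Val).
Local Notation ib_entry := (ib_entry Addr Val).

Implicit Types (a b : Addr) (i : 'I_n) (r : request) (V : seq request).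
Implicit Types (H : seq (Val * option nat)).
Implicit Types (K x : Val * option nat) (S : seq item).
Implicit Types (sb : seq sb_entry) (ib : seq ib_entry).

Definition sb_item (e : sb_entry) : item := inl (e.1.2, Some e.2).

Definition sb_items a sb : seq item := map sb_item (stores_to a sb).

Definition ib_values a ib : seq Val := [seq e.2 | e <- ib & e.1 == a].

(* [H] lists the values taken by [a] in the monolithic memory, [K] is the
   newest store to [a] that a committed instruction has observed, and [S] are
   the settled loads from [a] that are still in the reorder buffer. *)
Record observed i a H V (m : Val) sb ib K S : Prop := Observed {
  obs_sub : subseq (sb_items a sb) (pending i a V);
  obs_last :
    (exists h1 h2, [/\ H = h1 ++ K :: h2, stores_to a sb = [::]
                     & rcons (ib_values a ib) m = map fst (K :: h2)]) \/
    (exists l v t, [/\ stores_to a sb = rcons l (a, v, t), K = (v, Some t)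
                     & ib_values a ib = [::]]);
  obs_chain : chain (coherence i a H V) (inl K :: S)
}.

Lemma stores_to_rcons a sb b v t :
  stores_to a (rcons sb (b, v, t)) =
    if b == a then rcons (stores_to a sb) (b, v, t) else stores_to a sb.
Proof. by rewrite /stores_to filter_rcons. Qed.

Lemma sb_has_stores a sb : sb_has a sb = (stores_to a sb != [::]).
Proof. by rewrite /sb_has has_filter. Qed.

Lemma ib_values_clear a b ib :
  ib_values a (ib_clear b ib) = if b == a then [::] else ib_values a ib.
Proof.
rewrite /ib_values /ib_clear -filter_predI; case: eqVneq => [->|ba].
  by rewrite (eq_filter (a2 := pred0)) ?filter_pred0 // => e /=; rewrite andbN.
congr map; apply: eq_filter => e /=; case: eqP => // ->.
by rewrite eq_sym ba.
Qed.

Lemma ib_values_cat a ib1 ib2 :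
  ib_values a (ib1 ++ ib2) = ib_values a ib1 ++ ib_values a ib2.
Proof. by rewrite /ib_values filter_cat map_cat. Qed.

Lemma ib_values_split a ib s1 v s2 : ib_values a ib = s1 ++ v :: s2 ->
  exists l1 l2, [/\ ib = l1 ++ (a, v) :: l2, ib_values a l1 = s1 & ib_values a l2 = s2].
Proof.
rewrite /ib_values; elim: ib s1 => [|[b w] ib IH] s1 /=; first by case: s1.
case: eqP => [->|ba] /=; last first.
  case/IH => l1 [l2 [-> <- <-]]; exists ((b, w) :: l1), l2; split=> //=.
  by case: eqP.
case: s1 => [[-> <-]|u s1 [-> /IH[l1 [l2 [-> <- <-]]]]]; first by exists [::], ib.
by exists ((a, u) :: l1), l2; split=> //=; rewrite eqxx.
Qed.

Lemma obs_settled i a H V m sb ib K S S' :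
  subseq S' S -> observed i a H V m sb ib K S -> observed i a H V m sb ib K S'.
Proof.
move=> sub [s l c]; split=> //; apply: chain_subseq c => /=.
by rewrite eqxx.
Qed.

Lemma obs_buffers i a H V m sb ib sb' ib' K S :
  stores_to a sb' = stores_to a sb -> ib_values a ib' = ib_values a ib ->
  observed i a H V m sb ib K S -> observed i a H V m sb' ib' K S.
Proof. by move=> sbE ibE [s l c]; split; rewrite // /sb_items ?sbE ?ibE. Qed.

(** No buffer and no load refers to the new item, and the relative positions of the others are kept,
    so it may enter anywhere in the view. *)
Lemma obs_insert i a H A r B m sb ib K S :
  uniq (coherence i a H (A ++ r :: B)) ->
  observed i a H (A ++ B) m sb ib K S -> observed i a H (A ++ r :: B) m sb ib K S.
Proof.
rewrite /coherence !pending_cat pending_cons => u [s l c]; split=> //.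
  apply: subseq_trans s _; rewrite !pending_cat pending_cons -catA cat_subseq //.
  exact: suffix_subseq.
move: u c; rewrite /coherence !pending_cat pending_cons.
case: (item_of i a r) => [z|] /=; rewrite ?cats0 // -!catA !(catA (map _ H)) /=.
exact: chain_insert.
Qed.

Lemma obs_delete i a H A B m sb ib K S j k b :
  (j = i -> b = a -> inr k \notin S) ->
  observed i a H (A ++ QLd Val j k b :: B) m sb ib K S ->
  observed i a H (A ++ B) m sb ib K S.
Proof.
rewrite /coherence => kS [s l c]; split=> //.
  move: s; rewrite !pending_cat pending_cons /=.
  case: ifP => _ /=; rewrite ?cats0 // -catA /= => s.
  by apply: subseq_delete s; apply/mapP => -[].
move: c; rewrite /coherence !pending_cat pending_cons /=.
case: ifP => [/andP[/eqP ji /eqP ba]|_] /=; rewrite ?cats0 // -!catA !(catA (map _ H)).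
by apply: chain_delete; rewrite inE negb_or kS.
Qed.

Lemma obs_pending i a H V V' m sb ib K S :
  pending i a V' = pending i a V ->
  observed i a H V m sb ib K S -> observed i a H V' m sb ib K S.
Proof. by move=> E [s l c]; split; rewrite // /coherence E. Qed.

Lemma item_of_addr i a r z : item_of i a r = Some z -> access_addr r = Some a.
Proof.
case: r => [j k b|b v t|j] //=; last by case: eqP => // ->.
by case: andP => // -[_ /eqP ->].
Qed.

(** At most one of two swappable requests contributes an item: two items would be accesses to the
    same address. *)
Lemma pending_reorder i a A B (rnew rold : request) :
  can_reorder rnew rold ->
  pending i a (A ++ rold :: rnew :: B) = pending i a (A ++ rnew :: rold :: B).
Proof.
rewrite !pending_cat !pending_cons /can_reorder /same_access => /andP[+ _] /=.
case def_y: (item_of i a rnew) => [y|] /=; last by rewrite !cats0.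
case def_z: (item_of i a rold) => [z|] /=; last by rewrite !cats0.
by rewrite (item_of_addr def_y) (item_of_addr def_z) eqxx.
Qed.

Lemma obs_in_view i a H V m sb ib K S v t :
  observed i a H V m sb ib K S -> (a, v, t) \in sb -> QSt n a v t \in V.
Proof.
case=> s _ _ e_sb; rewrite -(mem_pending_store i); apply: (mem_subseq s).
by apply/mapP; exists (a, v, t) => //; rewrite mem_filter eqxx.
Qed.

(** A store in the store buffer is pending, hence by uniqueness not in the history. Only the first
    alternative of [obs_last] is left, where the invalidation buffer followed by the memory value
    spells out the values from [K] on. *)
Lemma obs_uniq_last i a H V m sb ib K S :
  uniq (coherence i a H V) -> observed i a H V m sb ib K S ->
  K \in H ->
  exists h1 h2, [/\ H = h1 ++ K :: h2, stores_to a sb = [::]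
                   & rcons (ib_values a ib) m = map fst (K :: h2)].
Proof.
move=> u [s [//|[l [v [t [sbE KE _]]]]] _] KH.
move: u; rewrite cat_uniq => /and3P[_ /hasPn/(_ (inl K)) + _].
rewrite /= mem_map ?KH; last by move=> ? ? [].
suff -> : inl K \in pending i a V by move/(_ isT).
by apply: (mem_subseq s); rewrite /sb_items sbE map_rcons mem_rcons KE mem_head.
Qed.

(* The cases are the WMM-S rules that can return [x]: from the store buffer,
   from it after a copy, from the memory, from the invalidation buffer. *)
Lemma obs_load i a H V m sb ib K x S :
  uniq (coherence i a H V) ->
  observed i a H V m sb ib K (inl x :: S) ->
  [\/ exists l t, [/\ stores_to a sb = rcons l (a, x.1, t)
                    & observed i a H V m sb ib x S],
      exists t, [/\ x.2 = Some t, QSt n a x.1 t \in V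
                  & observed i a H V m (rcons sb (a, x.1, t)) (ib_clear a ib) x S],
      [/\ ~~ sb_has a sb, x.1 = m & observed i a H V m sb (ib_clear a ib) x S]
    | ~~ sb_has a sb /\ exists l1 l2, ib = l1 ++ (a, x.1) :: l2 /\
        observed i a H V m sb (ib_clear a l1 ++ (a, x.1) :: l2) x S].
Proof.
move=> u obs; case: (obs) => s l c.
move: (c); rewrite !chain_cons /= => /and3P[KC /andP[Kx _] /and3P[xC _ _]].
have c' : chain (coherence i a H V) (inl x :: S).
  by apply: chain_subseq c; exact: subseq_cons.
have idx_lt (y : Val * option nat) : (inl y : item) \in map inl H ->
    index (inl y) (coherence i a H V) < size H.
  by move=> yH; rewrite /coherence index_cat yH -(size_map (@inl _ nat)) index_mem.
have [xH|xH] := boolP (x \in H).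
  (* [K] is not after [x], and the history is the initial part of the sequence. *)
  have KH : K \in H.
    rewrite -(mem_map (f := @inl _ nat)); last by move=> ? ? [].
    apply: contraLR (idx_lt x _) => [KH|]; last by rewrite map_f.
    move: Kx; rewrite /before {1}/coherence index_cat (negPf KH) size_map.
    by rewrite -leqNgt; apply: leq_trans; exact: leq_addr.
  have [h1 [h2 [HE sb0 ibE]]] := obs_uniq_last u obs KH.
  have sbN : ~~ sb_has a sb by rewrite sb_has_stores sb0.
  have uH : uniq H.
    move: u; rewrite cat_uniq => /and3P[+ _ _].
    by rewrite map_inj_uniq // => ? ? [].
  (* The values in [h1] come strictly before [K], whereas [x] does not. *)
  have xh2 : x \in K :: h2.
    move: (xH); rewrite HE mem_cat => /orP[xh1|//].
    have Kh1 : K \notin h1.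
      by move: uH; rewrite HE uniq_catC /= mem_cat negb_or => /andP[/andP[]].
    move: Kx; rewrite /before /coherence !index_cat !map_f // ?index_map;
      [|by move=> ? ? []..].
    by rewrite HE !index_cat xh1 (negPf Kh1) /= eqxx addn0 leqNgt index_mem xh1.
  have [s1 [s2 E]] : exists s1 s2, K :: h2 = s1 ++ x :: s2.
    by case: (splitPr xh2) => s1 s2; exists s1, s2.
  have HE' : H = (h1 ++ s1) ++ x :: s2 by rewrite HE E catA.
  (* If [x] ends the history, it is the memory value. Otherwise it has been overwritten and is in
     the invalidation buffer, and the entries behind it are exactly the later overwritten values. *)
  move: ibE; rewrite E map_cat /=; case/lastP: s2 {E} HE' => [|s2 y] HE' ibE.
    constructor 3; move: ibE; rewrite cats1 => /rcons_inj[_ mE]; split=> //.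
    split=> //; left; exists (h1 ++ s1), [::]; split=> //.
    by rewrite ib_values_clear eqxx /= mE.
  constructor 4; split=> //; move: ibE; rewrite map_rcons -rcons_cons -rcons_cat.
  case/rcons_inj => /ib_values_split[l1 [l2 [-> _ v2]]] mE.
  exists l1, l2; split=> //; split=> //; left; exists (h1 ++ s1), (rcons s2 y).
  split=> //; rewrite ib_values_cat ib_values_clear eqxx /ib_values /= eqxx /=.
  by rewrite -/(ib_values a l2) v2 mE map_rcons.
have xP : inl x \in pending i a V.
  move: xC; rewrite mem_cat mem_map; last by move=> ? ? [].
  by rewrite (negPf xH).
have [t xt] : exists t, x.2 = Some t.
  by case: x xP {Kx xC c c' obs xH} => v [t|]; [exists t|rewrite pending_None].
have def_x : x = (x.1, Some t) by rewrite -xt; case: (x).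
have sC : subseq (sb_items a sb) (coherence i a H V).
  by apply: subseq_trans s _; exact: suffix_subseq.
have HN (y : item) : y \in pending i a V -> y \notin map inl H.
  by move: u; rewrite cat_uniq => /and3P[_ /hasPn HV _] /HV.
have sbK : {in sb_items a sb, forall y, before (coherence i a H V) y (inl K)}.
  case: l => [[h1 [h2 [_ sb0 _]]]|[l [v [t' [sbE KE _]]]]] y.
    by rewrite /sb_items sb0.
  have := subseq_before u sC; rewrite /sb_items sbE map_rcons /sb_item /= -KE.
  rewrite -cats1 pairwise_cat allrel1r => /and3P[/allP bef _ _].
  by rewrite cats1 mem_rcons inE => /predU1P[->|/bef //]; rewrite /before.
(* No store of the buffer is after [K], and [x] is not before [K]. So if [x] is in the buffer it
   equals [K], the youngest store there; if not, it lies after the whole buffer and can be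
   appended. *)
have [xS|xS] := boolP (inl x \in sb_items a sb).
  have [xK] : inl x = inl K :> item.
    by apply: before_antisym Kx; [exact: xC|exact: sbK].
  constructor 1; case: l => [[h1 [h2 [_ sb0 _]]]|[l [v [t' [sbE KE _]]]]].
    by move: xS; rewrite /sb_items sb0.
  exists l, t'; split; first by rewrite sbE xK KE.
  by rewrite xK; apply: obs_settled obs; exact: subseq_cons.
constructor 2; exists t; split=> //.
  by rewrite -(mem_pending_store i a) -def_x.
have sbE : stores_to a (rcons sb (a, x.1, t)) = rcons (stores_to a sb) (a, x.1, t).
  by rewrite stores_to_rcons eqxx.
split=> //.
- rewrite /sb_items sbE map_rcons /sb_item /= -def_x.
  apply: subseq_rcons_before => //.
    by move: u; rewrite cat_uniq => /and3P[].
  move=> y yS; have yP := mem_subseq s yS.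
  rewrite -(before_cat (A := map inl H)) ?HN //.
  by apply: leq_trans Kx; apply: sbK.
- right; exists (stores_to a sb), x.1, t; split=> //.
  by rewrite ib_values_clear eqxx.
Qed.

(** The loads that the commit uncovers all read the new store, so the chain is constant and there is
    no order left to check. *)
Lemma obs_store i a H V m sb ib K S v t :
  uniq (coherence i a H (QSt n a v t :: V)) ->
  all (pred1 (inl (v, Some t))) S ->
  observed i a H V m sb ib K [::] ->
  observed i a H (QSt n a v t :: V) m (rcons sb (a, v, t)) (ib_clear a ib)
    (v, Some t) S.
Proof.
move=> u allS [s l c]; split.
- rewrite /sb_items stores_to_rcons eqxx map_rcons pending_cons /= eqxx /=.
  by rewrite cats1 -!cats1 cat_subseq.
- right; exists (stores_to a sb), v, t; split=> //; first by rewrite stores_to_rcons eqxx.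
  by rewrite ib_values_clear eqxx.
- apply: (@chain_const _ _ (inl (v, Some t))); last by rewrite /= eqxx.
  by rewrite mem_cat mem_pending_store mem_head orbT.
Qed.

Lemma obs_push_load i a H V m sb ib K S k :
  uniq (coherence i a H (QLd Val i k a :: V)) ->
  observed i a H V m sb ib K S ->
  observed i a H (QLd Val i k a :: V) m sb ib K (rcons S (inr k)).
Proof.
move=> u [s l c]; split=> //.
  by rewrite pending_cons /= !eqxx /= (subseq_trans s) // prefix_subseq.
move: u; rewrite /coherence pending_cons /= !eqxx /= catA cats1 => u.
by rewrite -rcons_cons; apply: chain_rcons.
Qed.

(* A load is answered by the store that sits directly below it. *)
Lemma obs_collapse i a H V V' m sb ib K S S' X c k Y :
  uniq (coherence i a H V) ->
  coherence i a H V = X ++ inl c :: inr k :: Y ->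
  coherence i a H V' = X ++ inl c :: Y ->
  subseq S' (map (redirect (inr k) (inl c)) S) ->
  observed i a H V m sb ib K S -> observed i a H V' m sb ib K S'.
Proof.
move=> u E E' sub [s l ch]; split=> //.
  have : subseq (sb_items a sb) (coherence i a H V').
    rewrite E' -cat_rcons; apply: (@subseq_delete _ _ _ _ (inr k)).
      by apply/mapP => -[].
    by rewrite cat_rcons -E; apply: subseq_trans s _; exact: suffix_subseq.
  (* No buffered store is in the history, so the history can be peeled off the front of the
     sequence. *)
  move=> s'; have : {in sb_items a sb, forall y, y \notin map inl H}.
    move=> y /(mem_subseq s); move: u; rewrite cat_uniq.
    by case/and3P => _ /hasPn HV _ /HV.
  move: s'; rewrite /coherence.
  elim: (map inl H) (sb_items a sb) => //= z h IH [|y q]; first by rewrite !sub0seq.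
  move=> sq nin; apply: IH; last first.
    by move=> x xq; have := nin x xq; rewrite inE negb_or => /andP[].
  by move: sq; have := nin y (mem_head _ _); rewrite inE negb_or => /andP[/negPf ->].
apply: (@chain_subseq _ _ _ (map (redirect (inr k) (inl c)) (inl K :: S))).
  by rewrite /= /redirect /= eqxx.
by rewrite E'; apply: chain_collapse; rewrite -E.
Qed.

(* Emptying the invalidation buffer: every later load from memory must read
   the newest value. *)
Lemma obs_reconcile i a H V m sb ib K x :
  uniq (coherence i a (rcons H x) V) -> x.1 = m ->
  observed i a (rcons H x) V m sb ib K [::] ->
  observed i a (rcons H x) V m sb [::] (if K \in rcons H x then x else K) [::].
Proof.
move=> u xm obs; case: ifPn => KH.
  have [h1 [h2 [HE sb0 ibE]]] := obs_uniq_last u obs KH; split; first by case: obs.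
    by left; exists H, [::]; rewrite cats1 /= xm.
  apply: (@chain_const _ _ (inl x)); rewrite /= ?eqxx //.
  by rewrite mem_cat map_f // mem_rcons mem_head.
case: obs => s [[h1 [h2 [HE _ _]]]|[l [v [t [sbE KE ib0]]]]] c.
  by move: KH; rewrite HE mem_cat mem_head orbT.
by split=> //; right; exists l, v, t.
Qed.

End Observation.

(** * Writing a store to the monolithic memory *)

Section Dequeue.

Variables (PC Reg Addr Val : eqType) (n : nat).

Local Notation request := (request Addr Val n).
Local Notation wproc := (wproc PC Reg Addr Val).

Variables (i : 'I_n) (a : Addr) (v : Val) (t : nat) (V V' : seq request) (w : wproc).

(** Either the route passes through the segment that releases the store, and the view loses its last
    request, or the view is unaffected. *)
Hypothesis VE : V = rcons V' (QSt n a v t) \/ V = V'.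
Hypothesis tV' : ~~ has (has_tag t) V'.
Hypothesis sbV : forall e, e \in sb w -> QSt n e.1.1 e.1.2 e.2 \in V.

Lemma tagged_store e : e \in sb w -> e.2 = t ->
  e = (a, v, t) /\ V = rcons V' (QSt n a v t).
Proof.
move=> /sbV; case: e => [[b u] t'] /= + tt'; rewrite {t'}tt' => eV.
have eN : QSt n b u t \notin V'.
  by apply: contra tV' => eV'; apply/hasP; exists (QSt n b u t) => //=.
case: VE eV eN => ->; last by move=> ->.
by rewrite mem_rcons inE => /orP[/eqP[-> ->]|->].
Qed.

Lemma view_dequeue :
  V = rcons V' (QSt n a v t) -> pending i a V = inl (v, Some t) :: pending i a V'.
Proof. by move=> ->; rewrite -cats1 pending_cat pending_cons /= eqxx. Qed.

Lemma pending_fresh : inl (v, Some t) \notin pending i a V'.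
Proof.
rewrite mem_pending_store; apply: contra tV' => eV'.
by apply/hasP; exists (QSt n a v t) => //=.
Qed.

(** The released store is the first pending item, so a subsequence that contains it must begin with
    it. This provides the guard of [WDeqSb]. *)
Lemma tagged_oldest :
  subseq (sb_items a (sb w)) (pending i a V) -> sb_has_tag t (sb w) ->
  exists2 S1, stores_to a (sb w) = (a, v, t) :: S1
            & subseq (map (@sb_item _ _) S1) (pending i a V').
Proof.
move=> s /hasP[e e_sb /eqP et]; have [eE VE'] := tagged_store e_sb et.
rewrite eE in e_sb.
have e_st : (a, v, t) \in stores_to a (sb w) by rewrite mem_filter eqxx.
move: s; rewrite /sb_items view_dequeue //.
case def_s: (stores_to a (sb w)) e_st => [//|y S1] /=.
have ya : y.1.1 = a.
  have : y \in stores_to a (sb w) by rewrite def_s mem_head.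
  by rewrite mem_filter => /andP[/eqP].
case: y ya {def_s} => [[_ v'] t'] /= ->.
rewrite /sb_item /=; case: eqP => [[-> ->] _ sub|_ st sub]; first by exists S1.
case/negP: pending_fresh; apply: (mem_subseq sub).
exact: (map_f (@sb_item _ _) st).
Qed.

Lemma obs_dequeue H m K S :
  uniq (coherence i a (rcons H (v, Some t)) V') ->
  observed i a H V m (sb w) (ib w) K S ->
  observed i a (rcons H (v, Some t)) V' v
    (sb (deq_sb a m t w)) (ib (deq_sb a m t w)) K S.
Proof.
move=> u [s l c].
(* If the store was in the view, its item only crosses from the pending part to the end of the
   history and the sequence is the same; otherwise it is inserted at that boundary. *)
have c' : chain (coherence i a (rcons H (v, Some t)) V') (inl K :: S).
  move: c u; rewrite /coherence map_rcons cat_rcons.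
  by case: VE => E; [rewrite view_dequeue|rewrite E => c u; apply: chain_insert].
rewrite /deq_sb; case: ifPn => [tag|ntag] /=.
  have [S1 sE sS1] := tagged_oldest s tag.
  have fE : stores_to a [seq e <- sb w | sb_tag e != t] = S1.
    rewrite /stores_to -filter_predI.
    rewrite (eq_filter (a2 := predI (fun e => sb_tag e != t) (fun e => sb_addr e == a)));
      last by move=> y /=; rewrite andbC.
    rewrite filter_predI -/(stores_to a (sb w)) sE /= eqxx /=.
    apply/all_filterP/allP => y yS1; apply: contra tV' => /eqP yt.
    have := mem_subseq sS1 (map_f (@sb_item _ _) yS1).
    rewrite mem_pending_store => yV; apply/hasP; exists (QSt n a y.1.2 y.2) => //=.
    exact/eqP.
  split=> //; first by rewrite /sb_items fE.
  rewrite fE; case: l => [[h1 [h2 [_ sb0 _]]]|[l [v' [t' [sbE KE ib0]]]]].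
    by move: sE; rewrite sb0.
  (* If the removed store was the only one to [a], it was [K], and it now ends the history, with no
     stale value to keep. *)
  rewrite sE in sbE; case: l sbE => [|y l] [] => [-> -> ->|_ ->].
    by left; exists H, [::]; rewrite cats1 KE ib0.
  by right; exists l, v', t'.
have s' : subseq (sb_items a (sb w)) (pending i a V').
  case: VE => E; last by rewrite -E.
  apply: (@subseq_delete _ _ [::] _ (inl (v, Some t))); last by rewrite cat0s -view_dequeue.
  apply: contra ntag => /mapP[e]; rewrite mem_filter => /andP[_ e_sb] [_ te].
  by apply/hasP; exists e => //; apply/eqP.
rewrite sb_has_stores; case: l => [[h1 [h2 [HE sb0 ibE]]]|[l [v' [t' [sbE KE ib0]]]]].
  (* The old value enters the invalidation buffer as the new one enters the history, so both sides
     of the equation grow by one. *)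
  rewrite sb0 eqxx /=; split=> //; left; exists h1, (rcons h2 (v, Some t)).
  split=> //; first by rewrite HE rcons_cat.
  rewrite /ib_values filter_rcons eqxx map_rcons -/(ib_values a (ib w)) ibE.
  by rewrite /= map_rcons.
rewrite sbE; case: eqP => [|_] /=; first by case: (l).
by split=> //; right; exists l, v', t'.
Qed.

Lemma obs_dequeue_other b H m m' K S : b != a ->
  observed i b H V m (sb w) (ib w) K S ->
  observed i b H V' m (sb (deq_sb a m' t w)) (ib (deq_sb a m' t w)) K S.
Proof.
move=> ba obs; apply: (@obs_pending _ _ _ _ _ _ V).
  case: VE => -> //; rewrite -cats1 pending_cat pending_cons /=.
  by rewrite eq_sym (negPf ba).
apply: obs_buffers obs; rewrite /deq_sb; case: ifP => //= _.
- rewrite /stores_to -filter_predI; apply: eq_in_filter => e e_sb /=.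
  case: eqP => //= eb; apply/eqP => /(tagged_store e_sb)[eE _].
  by move: eb; rewrite eE /sb_addr /= => ab; rewrite ab eqxx in ba.
- by case: ifP.
- case: ifP => //= _; rewrite /ib_values filter_rcons /= eq_sym.
  by rewrite (negPf ba).
Qed.

End Dequeue.

(** * Acyclicity of the partial coherence order *)

Section Acyclicity.

Variables (Addr Val : eqType) (n : nat).

Local Notation request := (request Addr Val n).
Local Notation item := (Val * option nat + nat)%type.

Lemma subseq_pmap (I J : eqType) (f : I -> option J) s1 s2 :
  subseq s1 s2 -> subseq (pmap f s1) (pmap f s2).
Proof.
elim: s2 s1 => [|y s2 IH] [|x s1] //= sub; first exact: sub0seq.
case: eqP sub => [->|_] /IH sub; first by case: (f y) => //= z; rewrite eqxx.
by apply: subseq_trans sub _; case: (f y) => //= z; exact: subseq_cons.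
Qed.

Definition store_tag a (r : request) : option nat :=
  if r is QSt b _ t then (if b == a then Some t else None) else None.

Definition item_tag (x : item) : option nat := if x is inl y then y.2 else None.

Lemma item_tag_pending i a V :
  pmap item_tag (pending i a V) = rev (pmap (store_tag a) V).
Proof.
elim: V => //= r V IH; rewrite pending_cons pmap_cat IH.
by case: r => [j k b|b v t|j] /=; rewrite ?cats0 //; case: ifP => _ //=;
   rewrite ?cats0 // rev_cons cats1.
Qed.

(* [G] lists every request of the memory, children before their parents. *)
Lemma coh_edge_acyclic (G : seq request) a (sbs : 'I_n -> seq (sb_entry Addr Val)) :
  (forall t, count (has_tag t) G <= 1) ->
  (forall k, exists2 V, subseq V G & subseq (sb_items a (sbs k)) (pending k a V)) ->
  forall t, ~ clos_trans _ (coh_edge sbs a) t t.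
Proof.
(* The reversal puts the oldest store first, as in the store buffers; every coherence edge then
   strictly increases the position in [tags]. *)
move=> uG sub; pose tags := rev (pmap (store_tag a) G).
have uT : uniq tags.
  apply: count_mem_uniq => t; rewrite count_rev.
  have le1 : count_mem t (pmap (store_tag a) G) <= 1.
    apply: leq_trans (uG t); apply: count_pmap_le => -[j k b|b v t'|j] //=.
    by case: ifP => // _ [->].
  rewrite mem_rev; case: (boolP (t \in _)) => [tG|/count_memPn //].
  by apply/eqP; rewrite eqn_leq le1 -has_count has_pred1.
have lt x y : clos_trans _ (coh_edge sbs a) x y -> index x tags < index y tags.
  elim=> {x y} [x y [k]|x y z _ lt_xy _]; last exact: ltn_trans.
  have [V VG sV] := sub k.
  have -> : map (@sb_tag _ _) (stores_to a (sbs k)) = pmap item_tag (sb_items a (sbs k)).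
    by rewrite /sb_items; elim: (stores_to a _) => //= e s ->.
  move=> sub_xy; have xy : subseq [:: x; y] tags.
    apply: subseq_trans sub_xy _; apply: subseq_trans (subseq_pmap item_tag sV) _.
    by rewrite item_tag_pending subseq_rev subseq_pmap.
  have := subseq_before uT xy; rewrite /= andbT /before leq_eqVlt andbT.
  case/orP => // /eqP E; have := subseq_uniq xy uT; rewrite /= inE.
  have xT : x \in tags by apply: (mem_subseq xy); rewrite mem_head.
  have yT : y \in tags by apply: (mem_subseq xy); rewrite !inE eqxx orbT.
  by rewrite -(nth_index x xT) E nth_index // eqxx.
by move=> t /lt; rewrite ltnn.
Qed.

End Acyclicity.

(** * Answers of the memory and commits, seen by the processor *)

Section Responses.

Variables PC Reg Addr Val : eqType.

Local Notation entry := (entry PC Reg Addr Val).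
Local Notation proc := (proc PC Reg Addr Val).
Local Notation program := (program PC Reg Addr Val).

Implicit Types (pr : program) (p : proc) (e : entry) (es : seq entry) (a : Addr).

Lemma settled_awaiting k a es :
  inr k \in settled a es -> has (fun e => awaiting e && (e_idx e == k)) es.
Proof.
elim: es => //= e es IH; case: (executed_store a e) => //=; rewrite mem_cat.
case/orP => [|/IH ->]; last by rewrite orbT.
rewrite /access /awaiting; case: (e_ins e) => // f srcs dst [b|] v t //.
case: eqP => // _; case: (e_ex e) => //; last by case: v t => [v|] [t|].
by rewrite inE => /eqP[->]; rewrite eqxx.
Qed.

Lemma has_idx (P : pred entry) k es :
  has (fun e => P e && (e_idx e == k)) es -> k \in map (@e_idx _ _ _ _) es.
Proof.
elim: es => //= e es IH; rewrite inE => /orP[/andP[_ /eqP->]|/IH ->].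
  by rewrite eqxx.
by rewrite orbT.
Qed.

Lemma redirect_id (I : eqType) (z c : I) s : z \notin s -> map (redirect z c) s = s.
Proof.
move=> zs; rewrite -[RHS]map_id; apply/eq_in_map => x xs.
by rewrite /redirect; case: eqP zs => // <-; rewrite xs.
Qed.

(** One redirection covers all answers: an awaiting load ends up at [x], and when the answer is
    dropped [inr k] does not occur in [settled], so redirecting does nothing. *)
Record responded pr pc (x : Val * option nat) k p p' : Prop := Responded {
  resp_ok : proc_ok pr p' pc;
  resp_rf : rf p' = rf p;
  resp_hist : hist p' = hist p;
  resp_flight : forall k', k' != k -> in_flight p' k' = in_flight p k';
  resp_rtags : forall t, count_mem t (rtags (rob p')) <= count_mem t (rtags (rob p));
  resp_commit : at_commit p -> at_commit p';
  resp_settled : forall b,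
    subseq (settled b (rob p')) (map (redirect (inr k) (inl x)) (settled b (rob p)))
}.

Lemma focus_awaiting b p es1 e es2 :
  increasing (rob p) -> rob p = es1 ++ e :: es2 -> ~~ awaiting e ->
  inr (e_idx e) \notin settled b (rob p).
Proof.
move=> inc E naw; apply/negP => /settled_awaiting.
rewrite E in inc *; have [lt12 _ /increasing_cons/allP gt] := increasing_cat inc.
rewrite has_cat /= (negPf naw) /= => /orP[/has_idx k1|/has_idx k2].
  by have := lt12 _ _ k1 (mem_head _ _); rewrite ltnn.
by have := gt _ k2; rewrite /= ltnn.
Qed.

Lemma in_flight_split p k :
  in_flight p k -> lf p k = false ->
  exists es1 e es2, [/\ rob p = es1 ++ e :: es2, e_idx e = k & load_in_flight e].
Proof.
rewrite /in_flight => + lfk; rewrite lfk /=.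
elim: (rob p) => //= e es IH /orP[/andP[/eqP ke fl]|/IH[es1 [e' [es2 [-> ke fl]]]]].
  by exists [::], e, es.
by exists (e :: es1), e', es2.
Qed.

Lemma lf_not_awaiting pr pc p k b :
  proc_ok pr p pc -> lf p k -> inr k \notin settled b (rob p).
Proof.
move=> ok lfk; apply/negP => /settled_awaiting; have := pok_lf ok.
elim: (rob p) => //= e es IH /andP[aw /IH{}IH] /orP[/andP[awe /eqP ke]|/IH //].
by move: aw; rewrite awe ke lfk.
Qed.

Lemma resp_ld_responded pr pc p k x tg :
  proc_ok pr p pc -> in_flight p k -> stag tg = x.2 ->
  responded pr pc x k p (resp_ld k x.1 tg p).
Proof.
move=> ok fl tgE; have inc := pok_inc ok.
rewrite /resp_ld; case lfk: (lf p k).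
  split=> //=.
  - case: ok => ? ? ? ? lfok; split=> //=; apply: sub_all lfok => e /=.
    by case: (e_idx e == k); rewrite ?implybT.
  - by move=> k' /negPf kk'; rewrite /in_flight /= kk'.
  - by move=> b; rewrite redirect_id // (lf_not_awaiting _ ok).
have [es1 [e [es2 [E ke fle]]]] := in_flight_split fl lfk.
have [eok rok lok lsok] := proc_ok_split ok E.
rewrite -ke (get_entry_focus inc E).
have fo_resp e' es2' p' : focus p p' es1 e e' es2 es2' -> proc_ok pr p' pc ->
    (forall b, subseq (settled b (rob p'))
       (map (redirect (inr k) (inl x)) (settled b (rob p)))) ->
    responded pr pc x (e_idx e) p p'.
  move=> fo ok' sub; split=> //; try by case: fo.
  - by move=> k' /negPf k'k; rewrite (focus_in_flight k' fo inc) k'k.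
  - by move=> t; apply: leq_count_subseq; exact: focus_rtags fo.
  - exact: focus_at_commit fo.
  - by rewrite ke.
case: e E ke fle eok rok lok lsok fo_resp
  => idx epc npc [? ? ? ?|f srcs dst a v t|? ? ? ? ? ?||] [] //.
  move=> E /= ke _ eok rok lok lsok fo_resp.
  set e := Entry idx epc npc _ Exe in E eok rok lok lsok fo_resp *.
  case: a @e E eok rok lok lsok fo_resp => [a|] e E eok rok lok lsok fo_resp; last first.
    by move: eok; rewrite /entry_ok /=; case: (fetch pr epc) => // ? ? ? [].
  have top : search_bypass a (rev es1) = @BypassTop Val by [].
  have lok' : load_ok (rev es1)
      (Entry idx epc npc (RLd PC f srcs dst (Some a) (Some x.1) (Some tg)) Done).
    by rewrite /load_ok /= top.
  have [ok' [es2' fo]] := resolve_load ok E lok'.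
  apply: (fo_resp _ _ _ fo) => // b.
  case: (fo) => -> -> _ _ _ _ _ _ _ tr _; rewrite !settled_cat.
  have k1 : inr k \notin settled b es1.
    apply/negP => /settled_awaiting/has_idx k1.
    rewrite E in inc; have [lt12 _ _] := increasing_cat inc.
    by have := lt12 k k k1; rewrite inE /= ke eqxx ltnn => /(_ isT).
  have k2 : inr k \notin settled b es2.
    apply/negP => /settled_awaiting/has_idx k2.
    rewrite E in inc; have [_ _ /increasing_cons/allP gt] := increasing_cat inc.
    by have := gt k k2; rewrite /= ke ltnn.
  rewrite map_cat (redirect_id _ k1) cat_subseq //; case: ifP => //= _.
  rewrite map_cat (redirect_id _ k2) cat_subseq //; last exact: trim_settled.
  rewrite /access /=; case: ifP => //= _.
  by rewrite ke /redirect eqxx tgE; case: (x) => ? ?; rewrite eqxx.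
move=> E /= ke _ eok rok lok lsok fo_resp.
set e := Entry idx epc npc _ ReEx in E eok rok lok lsok fo_resp *.
set e' := Entry idx epc npc _ Idle.
have re : retouched e e' by [].
have fo := focus_put inc E re; apply: (fo_resp _ _ _ fo).
  apply: (focus_proc_ok fo ok) => //=.
  - move: eok; rewrite /entry_ok /=; case: (fetch pr epc) => // ? ? ? [].
    by case: (a).
  - by apply: loads_ok_eq lsok => b; apply: search_bypass_eq.
move=> b; rewrite redirect_id; last first.
  by rewrite -ke; apply: focus_awaiting inc E _.
apply: focus_settled fo _ _ => //.
Qed.

Lemma commit_proc_ok pr pc p e es rf' ev :
  proc_ok pr p pc -> rob p = e :: es ->
  regs_le (reg_update (Some \o rf p) e) (Some \o rf') ->
  proc_ok pr (commit p es rf' ev) (e_npc e).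
Proof.
case=> rok inc bd lok lfok E le; move: rok inc bd lok lfok; rewrite E /=.
case=> _ _ rok /andP[_ inc] /andP[_ bd] [_ lok] /andP[_ lfok]; split=> //=.
  exact: rob_ok_mono le rok.
apply: loads_ok_weaken lok => a; rewrite search_bypass_cons /=.
case: (is_reconcile e); first by right.
by case: (executed_store a e) => [[v t]|]; [right|left].
Qed.

Lemma commit_in_flight p e es rf' ev k :
  rob p = e :: es -> ~~ load_in_flight e -> in_flight (commit p es rf' ev) k = in_flight p k.
Proof. by rewrite /in_flight => -> /negPf fl /=; rewrite /flight fl andbF. Qed.

End Responses.

(** * Requests below a given request *)

Section After.

Variable I : eqType.
Implicit Types (c x z : I) (A B V : seq I).

(** Views list the newest request first, so this is what lies below [c], closer to the memory. For a
    [Commit] it has to contain all stores in the store buffer of its processor. *)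
Definition after c V := drop (index c V).+1 V.

Lemma after_cat c A B :
  after c (A ++ B) = if c \in A then after c A ++ B else after c B.
Proof.
rewrite /after index_cat; case: ifPn => cA.
  rewrite drop_cat; move: cA; rewrite -index_mem leq_eqVlt => /predU1P[E|->//].
  by rewrite E ltnn subnn drop0 drop_size.
rewrite drop_cat ltnNge -addnS leq_addr /=; congr drop; lia.
Qed.

Lemma after_cons c z V : after c (z :: V) = if z == c then V else after c V.
Proof. by rewrite /after /=; case: eqP => _ //=; rewrite drop0. Qed.

Definition inserted r V V' :=
  V' = V \/ exists A B, V = A ++ B /\ V' = A ++ r :: B.

Lemma after_inserted c r x V V' :
  r != c -> inserted r V V' -> (c \in V -> x \in after c V) ->
  c \in V' -> x \in after c V'.
Proof.
move=> rc [->//|[A [B [-> ->]]]].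
rewrite !mem_cat inE [c == r]eq_sym (negPf rc) /= !after_cat after_cons (negPf rc).
by case: ifP => // _ H /H; rewrite !mem_cat inE => /orP[->|->]; rewrite ?orbT.
Qed.

Lemma after_deleted c z x A B :
  z != c -> x != z -> (c \in A ++ z :: B -> x \in after c (A ++ z :: B)) ->
  c \in A ++ B -> x \in after c (A ++ B).
Proof.
move=> zc xz; rewrite !mem_cat inE [c == z]eq_sym (negPf zc) /= !after_cat after_cons.
rewrite (negPf zc); case: ifP => // _ H /H.
by rewrite !mem_cat inE (negPf xz).
Qed.

End After.

(** * The simulation *)

Section Simulation.

Variables (PC Reg Addr Val : eqType) (n : nat) (T : hmb_tree n).
Variables (prog : 'I_n -> program PC Reg Addr Val).
Variables (ini : init_state PC Reg Addr Val n).

Local Notation entry := (entry PC Reg Addr Val).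
Local Notation proc := (proc PC Reg Addr Val).
Local Notation wproc := (wproc PC Reg Addr Val).
Local Notation request := (request Addr Val n).
Local Notation ostate := (ooos_state PC Reg Addr Val T).
Local Notation wstate := (wmms_state PC Reg Addr Val n).
Local Notation value := (Val * option nat)%type.

Implicit Types (s : ostate) (w : wstate) (H : Addr -> seq value).
Implicit Types (K : 'I_n -> Addr -> value) (f : 'I_(nseg T) -> seq request).
Implicit Types (r : request) (p : proc) (q : wproc) (a b : Addr).

Definition port_view f (i : 'I_n) := view f (port T i).

(* The ghost components are those of [observed]: the values [H] taken by each
   address in the memory and the newest observed stores [K]. *)
Record sim s w H K : Prop := Sim {
  sim_proc : forall i, proc_ok (prog i) (procs s i) (wpc (wprocs w i));
  sim_rf : forall i, wrf (wprocs w i) = rf (procs s i);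
  sim_hist : forall i, whist (wprocs w i) = hist (procs s i);
  sim_tags : forall t,
    (\sum_i count_mem t (rtags (rob (procs s i)))) + (t \in wused w) <= (t \in used s);
  sim_stores : forall a t,
    count (has_tag t) (all_requests (segs s)) + count (fun x => x.2 == Some t) (H a)
      <= (t \in wused w);
  sim_loads : forall i k,
    count (is_load i k) (all_requests (segs s)) <= in_flight (procs s i) k;
  sim_commits : forall i,
    count_mem (QCom Addr Val i) (all_requests (segs s)) <= at_commit (procs s i);
  sim_place : forall i j r,
    r \in segs s j -> issued_by i r -> j \in route (port T i);
  sim_source : forall a v t,
    QSt n a v t \in all_requests (segs s) -> exists i, (a, v, t) \in sb (wprocs w i);
  sim_initial : forall a, count (fun x => x.2 == None) (H a) <= 1;
  sim_mem : forall a, exists h x,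
    [/\ H a = rcons h x, (hmem s a).1 = x.1, stag (hmem s a).2 = x.2 & wmem w a = x.1];
  sim_below : forall i e, e \in sb (wprocs w i) ->
    QCom Addr Val i \in port_view (segs s) i ->
    QSt n e.1.1 e.1.2 e.2 \in after (QCom Addr Val i) (port_view (segs s) i);
  sim_obs : forall i a,
    observed i a (H a) (port_view (segs s) i) (wmem w a)
      (sb (wprocs w i)) (ib (wprocs w i)) (K i a) (settled a (rob (procs s i)))
}.

Lemma views_uniq f H i a :
  (forall t, count (has_tag t) (all_requests f) + count (fun x => x.2 == Some t) (H a) <= 1) ->
  (forall k, count (is_load i k) (all_requests f) <= 1) ->
  count (fun x => x.2 == None) (H a) <= 1 ->
  uniq (coherence i a (H a) (port_view f i)).
Proof.
move=> st ld nn; apply: coherence_uniq => // [t|k].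
  by apply: leq_trans (st t); rewrite leq_add2r count_view.
by apply: leq_trans (ld k); rewrite count_view.
Qed.

Lemma sim_uniq s w H K i a : sim s w H K -> uniq (coherence i a (H a) (port_view (segs s) i)).
Proof.
move=> sm; apply: views_uniq (sim_initial sm a) => [t|k].
  exact: leq_trans (sim_stores sm a t) (leq_b1 _).
exact: leq_trans (sim_loads sm i k) (leq_b1 _).
Qed.

Lemma sum_update (F : proc -> nat) (P : 'I_n -> proc) i p :
  \sum_j F ([eta P with i |-> p] j) + F (P i) = \sum_j F (P j) + F p.
Proof.
rewrite (bigD1 i) //= eqxx [in RHS](bigD1 i) //=.
rewrite (eq_bigr (fun j => F (P j))); last by move=> j /negPf ->.
lia.
Qed.

Lemma sim_quiet s w H K i p : sim s w H K ->
  quiet (prog i) (wpc (wprocs w i)) (procs s i) p ->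
  sim (OoosState [eta procs s with i |-> p] (segs s) (hmem s) (used s)) w H K.
Proof.
move=> sm q; split=> /=.
- by move=> j; case: eqP => [->|_]; [case: q|exact: sim_proc sm j].
- by move=> j; case: eqP => [->|_]; rewrite (sim_rf sm) //; case: q.
- by move=> j; case: eqP => [->|_]; rewrite (sim_hist sm) //; case: q.
- move=> t; apply: leq_trans (sim_tags sm t); rewrite leq_add2r.
  have := sum_update (fun p => count_mem t (rtags (rob p))) (procs s) i p.
  have := quiet_rtags q t; rewrite /=; lia.
- exact: sim_stores sm.
- move=> j k; have := sim_loads sm j k; case: eqP => [->|//].
  have := quiet_flight q (k := k).
  by case: (in_flight (procs s i) k) => [->//|_]; rewrite leqn0 => /eqP->.
- move=> j; have := sim_commits sm j; case: eqP => [->|//].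
  have := quiet_commit q.
  by case: (at_commit (procs s i)) => [->//|_]; rewrite leqn0 => /eqP->.
- exact: sim_place sm.
- exact: sim_source sm.
- exact: sim_initial sm.
- exact: sim_mem sm.
- exact: sim_below sm.
- move=> j a; case: eqP => [->|_]; last exact: sim_obs sm _ _.
  exact: obs_settled (quiet_settled q a) (sim_obs sm i a).
Qed.

Lemma new_entryP pr idx pc npc t : let e := new_entry pr idx pc npc t : entry in
  [/\ e_idx e = idx, e_pc e = pc, e_npc e = npc, ~~ load_in_flight e
    & (forall a, executed_store a e = None /\ access a e = [::])].
Proof. by rewrite /new_entry; case: (fetch pr pc). Qed.

Lemma new_entry_ok pr rs idx pc npc t prev :
  pred_ok pr pc npc ->
  entry_ok pr rs (new_entry pr idx pc npc t : entry) /\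
  load_ok prev (new_entry pr idx pc npc t : entry).
Proof.
by rewrite /pred_ok /new_entry /entry_ok /load_ok; case def_i: (fetch pr pc);
   rewrite /= def_i.
Qed.

Lemma awaitingN_flight (e : entry) : ~~ load_in_flight e -> awaiting e = false.
Proof. by move=> nf; apply/negP => /awaiting_flight; apply/negP. Qed.

Lemma fetch_proc_ok pr pc p idx npc t :
  proc_ok pr p pc -> bound p <= idx -> pred_ok pr (pcr p) npc ->
  proc_ok pr (Proc npc (rf p) (rcons (rob p) (new_entry pr idx (pcr p) npc t))
    (lf p) idx.+1 (hist p)) pc.
Proof.
move=> [rok inc bd lok lfok] le_idx pok.
set e := new_entry _ _ _ _ _; have [ei epc enpc efl _] := new_entryP pr idx (pcr p) npc t.
split=> /=; rewrite -?cats1.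
- apply/rob_ok_cat; exists (pcr p) => //=; split=> //.
  exact: (new_entry_ok _ _ _ [::] pok).1.
- rewrite /increasing map_cat pairwise_cat; apply/and3P; split=> //.
  apply/allrelP => k l; rewrite inE => k_in /eqP->; rewrite ei; apply: leq_trans le_idx.
  by move: bd; rewrite -(all_map (@e_idx _ _ _ _) (fun k => k < bound p)) => /allP; apply.
- rewrite all_cat /= ei ltnSn !andbT; apply: sub_all bd => x xb.
  by rewrite ltnS; apply: ltnW; apply: leq_trans le_idx.
- by apply/loads_ok_cat; split=> //=; split=> //; exact: (new_entry_ok (fun=> None) _ _ _ pok).2.
- by rewrite all_cat lfok /= awaitingN_flight.
Qed.

Lemma sim_fetch s w H K i idx npc t : sim s w H K ->
  bound (procs s i) <= idx -> pred_ok (prog i) (pcr (procs s i)) npc -> t \notin used s ->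
  let p := procs s i in
  let p' := Proc npc (rf p) (rcons (rob p) (new_entry (prog i) idx (pcr p) npc t))
              (lf p) idx.+1 (hist p) in
  sim (OoosState [eta procs s with i |-> p'] (segs s) (hmem s)
         (used_after_fetch (prog i) (pcr p) t (used s))) w H K.
Proof.
move=> sm le_idx pok tN p p'; have [ei epc enpc efl exs] := new_entryP (prog i) idx (pcr p) npc t.
split=> /=.
- move=> j; case: eqP => [->|_]; last exact: sim_proc sm j.
  exact: fetch_proc_ok (sim_proc sm i) le_idx pok.
- by move=> j; case: eqP => [->|_]; rewrite (sim_rf sm).
- by move=> j; case: eqP => [->|_]; rewrite (sim_hist sm).
- move=> t'; have := sum_update (fun p => count_mem t' (rtags (rob p))) (procs s) i p'.
  have := sim_tags sm t'.
  rewrite {2}/p' /rtags -cats1 pmap_cat count_cat /= /used_after_fetch /new_entry.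
  set sum' := \sum_j _; set sum := \sum_j _.
  case: (fetch _ _) => [op srcs dst|f srcs dst|f g srcs||] /=; try by rewrite -/p; lia.
  rewrite -/p inE; have [->|tt'] /= := eqVneq t' t; last by lia.
  rewrite (negPf tN); lia.
- exact: sim_stores sm.
- move=> j k; have := sim_loads sm j k; case: eqP => [->|//].
  by rewrite {2}/in_flight /= -cats1 has_cat /= {2}/flight (negPf efl) andbF !orbF.
- move=> j; have := sim_commits sm j; case: eqP => [->|//].
  rewrite /at_commit /= -/p; case: (rob p) => [|x y] //=.
  by rewrite leqn0 => /eqP ->.
- exact: sim_place sm.
- exact: sim_source sm.
- exact: sim_initial sm.
- exact: sim_mem sm.
- exact: sim_below sm.
- move=> j a; case: eqP => [->|_]; last exact: sim_obs sm _ _.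
  rewrite /= -cats1 settled_cat /=; have [-> ->] := exs a.
  rewrite /= if_same cats0; exact: sim_obs sm i a.
Qed.

(** * Issuing requests *)

Lemma count_push f j r P :
  count P (all_requests [eta f with j |-> r :: f j]) = count P (all_requests f) + P r.
Proof.
have := count_update f j (r :: f j) P; rewrite [count P (r :: _)]/=.
set x := count P (all_requests _); lia.
Qed.

Lemma mem_push f j r x :
  (x \in all_requests [eta f with j |-> r :: f j]) = (x == r) || (x \in all_requests f).
Proof.
rewrite -!has_pred1 !has_count count_push /= eq_sym.
by case: (x == r); rewrite ?addn0 // addn1.
Qed.

Lemma view_inserted f j r j0 :
  inserted r (view f j0) (view [eta f with j |-> r :: f j] j0).
Proof.
have := view_update f j j0; case: ifP => [_ [A [B [fE uE]]]|_ uE].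
  by right; exists A, (f j ++ B); rewrite fE uE.
by left; rewrite uE.
Qed.

Lemma obs_inserted i a h r V V' m sb ib k S :
  uniq (coherence i a h V') -> inserted r V V' ->
  observed i a h V m sb ib k S -> observed i a h V' m sb ib k S.
Proof. by move=> u [->//|[A [B [-> E]]]]; rewrite E in u *; apply: obs_insert. Qed.

Lemma place_push s w H K i r : sim s w H K -> (forall j, issued_by j r -> j = i) ->
  forall i' j r', r' \in [eta segs s with port T i |-> r :: segs s (port T i)] j ->
    issued_by i' r' -> j \in route (port T i').
Proof.
move=> sm ri i' j r' /=; case: eqP => [->|_]; last exact: sim_place sm _ _ _.
rewrite inE => /orP[/eqP -> /ri ->|]; first exact: mem_route.
exact: sim_place sm _ _ _.
Qed.

Lemma sim_obs_in_view s w H K i e : sim s w H K -> e \in sb (wprocs w i) ->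
  QSt n e.1.1 e.1.2 e.2 \in port_view (segs s) i.
Proof. by case: e => [[a v] t] sm; exact: obs_in_view (sim_obs sm i a). Qed.

Lemma push_uniq f H (W : seq nat) (i : 'I_(nseg T)) (i' : 'I_n) a r :
  (forall t, count (has_tag t) (all_requests [eta f with i |-> r :: f i]) +
     count (fun x => x.2 == Some t) (H a) <= (t \in W)) ->
  (forall k, count (is_load i' k) (all_requests [eta f with i |-> r :: f i]) <= 1) ->
  count (fun x => x.2 == None) (H a) <= 1 ->
  uniq (coherence i' a (H a) (port_view [eta f with i |-> r :: f i] i')).
Proof.
move=> st ld nn; apply: views_uniq => // t.
exact: leq_trans (st t) (leq_b1 _).
Qed.

Lemma sim_ld_req s w H K i idx epc npc g srcs dst a v : sim s w H K ->
  let p := procs s i in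
  get_entry p idx = Some (Entry idx epc npc (RLd PC g srcs dst (Some a) v None) Idle) ->
  find_bypass p idx a = @BypassTop Val -> ~~ lf p idx ->
  let p' := kill (find_affected_ld p idx a)
    (put_entry (Entry idx epc npc (RLd PC g srcs dst (Some a) v None) Exe) p) in
  sim (OoosState [eta procs s with i |-> p']
         [eta segs s with port T i |-> QLd Val i idx a :: segs s (port T i)]
         (hmem s) (used s)) w H K.
Proof.
move=> sm p gE top nlf p'.
set e := Entry _ _ _ _ Idle in gE; have [_ [es1 [es2 E]]] := get_entry_split gE.
have inc := pok_inc (sim_proc sm i).
have [ok fo setE sub1 sub2] := ld_req_focus (sim_proc sm i) E top nlf.
rewrite -/p' in ok fo setE sub2.
set r := QLd Val i idx a; set f' := [eta segs s with port T i |-> r :: segs s (port T i)].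
have st : forall a t, count (has_tag t) (all_requests f') +
    count (fun x => x.2 == Some t) (H a) <= (t \in wused w).
  by move=> b t; rewrite count_push addn0; exact: sim_stores sm b t.
(* The load is [Idle] and its [lf] bit is off, so no request with its index is outstanding and the
   new one is unique. *)
have fl0 : in_flight p idx = false.
  by rewrite (in_flight_entry (e := e) inc E) //= (negPf nlf).
have ld : forall j k, count (is_load j k) (all_requests f')
    <= in_flight ([eta procs s with i |-> p'] j) k.
  move=> j k; rewrite count_push /=; have := sim_loads sm j k.
  rewrite [i == j]eq_sym; case: eqP => [->|_]; last by rewrite addn0.
  rewrite (focus_in_flight k fo inc) [idx == k]eq_sym /=.
  case: eqP => [->|_]; last by rewrite addn0.
  by rewrite -/p fl0 leqn0 => /eqP->; rewrite orbT.
have u j b : uniq (coherence j b (H b) (port_view f' j)).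
  apply: (@push_uniq _ _ (wused w)) => //; last exact: sim_initial sm b.
  by move=> k; apply: leq_trans (ld j k) (leq_b1 _).
split=> //=.
- by move=> j; case: eqP => [->//|_]; exact: sim_proc sm j.
- by move=> j; case: eqP => [->|_]; rewrite (sim_rf sm) //; case: fo.
- by move=> j; case: eqP => [->|_]; rewrite (sim_hist sm) //; case: fo.
- move=> t; apply: leq_trans (sim_tags sm t); rewrite leq_add2r.
  have := sum_update (fun p => count_mem t (rtags (rob p))) (procs s) i p'.
  have := leq_count_subseq (pred1 t) (focus_rtags fo); rewrite -/p /=; lia.
- move=> j; rewrite count_push addn0; have := sim_commits sm j; case: eqP => [->|//].
  have := focus_at_commit fo; rewrite -/p.
  by case: (at_commit p) => [->//|_]; rewrite leqn0 => /eqP->.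
- by apply: (place_push sm) => j /= /eqP.
- by move=> b u' t; rewrite mem_push /=; exact: sim_source sm b u' t.
- exact: sim_initial sm.
- exact: sim_mem sm.
- move=> j x xj; apply: (after_inserted (r := r)) => //; first exact: view_inserted.
  exact: sim_below sm j x xj.
- move=> j b; case: eqP => [->|_]; last first.
    exact: (obs_inserted (u j b) (view_inserted _ _ _ _) (sim_obs sm j b)).
  have [->|ba] := eqVneq b a; last first.
    apply: (obs_inserted (u i b) (view_inserted _ _ _ _)).
    exact: obs_settled (sub2 b ba) (sim_obs sm i b).
  rewrite setE; have := u i a; rewrite /port_view view_push => ui.
  apply: obs_push_load ui _.
  exact: obs_settled sub1 (sim_obs sm i a).
Qed.

Lemma no_commit s w H K i : sim s w H K -> ~~ at_commit (procs s i) ->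
  QCom Addr Val i \notin all_requests (segs s).
Proof.
move=> sm /negPf nc; have := sim_commits sm i; rewrite nc leqn0 => /eqP E.
by apply/count_memPn.
Qed.

(* Covers every commit that sends no request to the memory. *)
Lemma sim_retire s w w' H K K' i e es rf' ev : sim s w H K ->
  let p := procs s i in
  rob p = e :: es -> ~~ load_in_flight e -> rtag e = None ->
  QCom Addr Val i \notin all_requests (segs s) ->
  regs_le (reg_update (Some \o rf p) e) (Some \o rf') ->
  wrf (wprocs w' i) = rf' -> wpc (wprocs w' i) = e_npc e ->
  whist (wprocs w' i) = rcons (whist (wprocs w i)) ev ->
  {subset sb (wprocs w i) <= sb (wprocs w' i)} ->
  (forall j, j != i -> wprocs w' j = wprocs w j) ->
  wmem w' = wmem w -> wused w' = wused w ->
  (forall j, j != i -> K' j = K j) ->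
  (forall a, observed i a (H a) (port_view (segs s) i) (wmem w a)
     (sb (wprocs w' i)) (ib (wprocs w' i)) (K' i a) (settled a es)) ->
  sim (OoosState [eta procs s with i |-> commit p es rf' ev] (segs s) (hmem s) (used s))
    w' H K'.
Proof.
move=> sm p E fle tge nc le rfE pcE hE sbE otherE mE uE KE obs.
split=> /=.
- move=> j; case: eqVneq => [->|ji]; last by rewrite otherE //; exact: sim_proc sm j.
  rewrite pcE; exact: commit_proc_ok (sim_proc sm i) E le.
- by move=> j; case: eqVneq => [->//|ji]; rewrite otherE // (sim_rf sm).
- move=> j; case: eqVneq => [->|ji]; last by rewrite otherE // (sim_hist sm).
  by rewrite hE (sim_hist sm).
- move=> t; rewrite uE; apply: leq_trans (sim_tags sm t); rewrite leq_add2r.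
  have := sum_update (fun p => count_mem t (rtags (rob p))) (procs s) i (commit p es rf' ev).
  rewrite [procs s i]/= -/p E {2}/rtags /= tge /= -/(rtags es); lia.
- by move=> a t; rewrite uE; exact: sim_stores sm a t.
- move=> j k; have := sim_loads sm j k; case: eqP => [->|//].
  by rewrite (commit_in_flight _ _ _ E).
- move=> j; have := sim_commits sm j; case: eqP => [->|//] _.
  by move/count_memPn: nc => ->.
- exact: sim_place sm.
- move=> a v t /(sim_source sm)[j jsb]; exists j.
  by have [ji|ji] := eqVneq j i; [rewrite ji in jsb *; exact: sbE|rewrite otherE].
- exact: sim_initial sm.
- by move=> a; rewrite mE; exact: sim_mem sm a.
- move=> j x; have [->|ji] := eqVneq j i; last by rewrite otherE //; exact: sim_below sm j x.
  by move=> _ /(mem_viewP); rewrite (negPf nc).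
- move=> j a; rewrite mE; case: eqVneq => [->|ji]; first exact: obs.
  by rewrite otherE // KE //; exact: sim_obs sm j a.
Qed.

Lemma sim_com_req s w H K i idx epc npc es : sim s w H K ->
  let p := procs s i in
  rob p = Entry idx epc npc (RCommit PC Reg Addr Val) Idle :: es ->
  sim (OoosState
    [eta procs s with i |-> set_rob p (Entry idx epc npc (RCommit PC Reg Addr Val) Exe :: es)]
    [eta segs s with port T i |-> QCom Addr Val i :: segs s (port T i)]
    (hmem s) (used s)) w H K.
Proof.
move=> sm p E; set p' := set_rob _ _.
set r := QCom Addr Val i; set f' := [eta segs s with port T i |-> r :: segs s (port T i)].
have ncom : count_mem r (all_requests (segs s)) = 0.
  by apply/count_memPn/(no_commit sm); rewrite /at_commit -/p E.
have st : forall a t, count (has_tag t) (all_requests f') +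
    count (fun x => x.2 == Some t) (H a) <= (t \in wused w).
  by move=> b t; rewrite count_push addn0; exact: sim_stores sm b t.
have ld : forall j k, count (is_load j k) (all_requests f')
    <= in_flight ([eta procs s with i |-> p'] j) k.
  move=> j k; rewrite count_push /= addn0; have := sim_loads sm j k.
  by case: eqP => [->|//]; rewrite /in_flight /= -/p E /= /flight /= !andbF.
have u j b : uniq (coherence j b (H b) (port_view f' j)).
  apply: (@push_uniq _ _ (wused w)) => //; last exact: sim_initial sm b.
  by move=> k; apply: leq_trans (ld j k) (leq_b1 _).
split=> //=.
- move=> j; case: eqP => [->|_]; last exact: sim_proc sm j.
  have [rok inc bd lok lfok] := sim_proc sm i.
  move: rok inc bd lok lfok; rewrite -/p E => rok inc bd lok lfok; split=> //=.
  case: lok => _ lok; split=> //; apply: loads_ok_eq lok => a.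
  exact: search_bypass_eq.
- by move=> j; case: eqP => [->|_]; rewrite (sim_rf sm).
- by move=> j; case: eqP => [->|_]; rewrite (sim_hist sm).
- move=> t; apply: leq_trans (sim_tags sm t); rewrite leq_add2r.
  have := sum_update (fun p => count_mem t (rtags (rob p))) (procs s) i p'.
  rewrite [procs s i]/= -/p E /=; lia.
- move=> j; rewrite count_push; have := sim_commits sm j; case: eqP => [->|ji].
    by rewrite ncom /= eqxx.
  move=> le; rewrite /=; suff -> : (r == QCom Addr Val j) = false by rewrite addn0.
  by apply/eqP => -[/esym].
- by apply: (place_push sm) => j /= /eqP.
- by move=> b u' t; rewrite mem_push /=; exact: sim_source sm b u' t.
- exact: sim_initial sm.
- exact: sim_mem sm.
- move=> j x xj; have [ji|ji] := eqVneq j i.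
    (* The new request is the top of its own view, and every buffered store is in that view. *)
    rewrite ji in xj *; rewrite /port_view view_push after_cons eqxx => _.
    exact: sim_obs_in_view sm xj.
  apply: (after_inserted (r := r)); first by apply: contra ji => /eqP[->].
    exact: view_inserted.
  exact: sim_below sm j x xj.
- move=> j b; apply: (obs_inserted (u j b) (view_inserted _ _ _ _)).
  have := sim_obs sm j b; case: eqP => [->|//].
  by rewrite -/p E.
Qed.

(** * Commits of instructions *)

Lemma pmap_Some (f : Reg -> Val) srcs : pmap (Some \o f) srcs = map f srcs.
Proof. by elim: srcs => //= r srcs ->. Qed.

Lemma sim_head s w H K i e es : sim s w H K -> rob (procs s i) = e :: es ->
  [/\ wpc (wprocs w i) = e_pc e,
      entry_ok (prog i) (Some \o wrf (wprocs w i)) e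
    & loads_ok [:: e] es].
Proof.
move=> sm E; have [+ _ _ + _] := sim_proc sm i; rewrite E /= -(sim_rf sm).
by move=> [<- ? _] [_ ?].
Qed.

Lemma step_nm_com s w H K i idx epc npc op srcs dst v es : sim s w H K ->
  let p := procs s i in
  rob p = Entry idx epc npc (RNm Addr op srcs dst (Some v)) Done :: es ->
  exists2 w', wmms_step prog w w' &
  sim (OoosState [eta procs s with i |->
         commit p es [eta rf p with dst |-> v] (EvNm Addr op srcs dst v npc)]
         (segs s) (hmem s) (used s)) w' H K.
Proof.
move=> sm p E; have [pcE eok _] := sim_head sm E.
move: eok; rewrite /entry_ok /=; case def_i: (fetch _ _) => [op' srcs' dst'||||] //.
case=> [? ? ?]; subst op' srcs' dst' => -[_ _]; rewrite pmap_Some => opE.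
eexists.
  by apply: (@WExec _ _ _ _ _ prog w i); apply: WNm; rewrite pcE //=; [exact: def_i|exact: opE].
apply: (sim_retire sm E) => //=; rewrite ?eqxx //=.
- by apply: (no_commit sm); rewrite /at_commit E.
- by move=> r u; rewrite /reg_update /= [r == dst]eq_sym; case: eqP.
- by rewrite (sim_rf sm).
- by move=> j /negPf ->.
- by move=> a; have := sim_obs sm i a; rewrite E.
Qed.

Lemma step_rec_com s w H K i idx epc npc es : sim s w H K ->
  let p := procs s i in
  rob p = Entry idx epc npc (RReconcile PC Reg Addr Val) Done :: es ->
  exists2 w', wmms_step prog w w' & exists K',
  sim (OoosState [eta procs s with i |->
         commit p es (rf p) (EvReconcile PC Reg Addr Val)]
         (segs s) (hmem s) (used s)) w' H K'.
Proof.
move=> sm p E; have [pcE eok lok] := sim_head sm E.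
move: eok; rewrite /entry_ok /=; case def_i: (fetch _ _) => //= -[npcE _].
eexists.
  by apply: (@WExec _ _ _ _ _ prog w i); apply: WRec; rewrite pcE; exact: def_i.
(* With the invalidation buffer emptied, the current memory value counts as observed. An address
   with a store in the local buffer keeps that younger store instead. *)
pose K' j a := if j == i then (if K j a \in H a then last (K j a) (H a) else K j a) else K j a.
exists K'; apply: (sim_retire sm E) => //=; rewrite ?eqxx //=.
- by apply: (no_commit sm); rewrite /at_commit E.
- by rewrite (sim_rf sm).
- by rewrite pcE.
- by move=> j /negPf ->.
- by move=> j /negPf ji; rewrite /K' ji.
move=> a; rewrite /K' eqxx; have u := sim_uniq i a sm.
have [h [x [HE _ _ xm]]] := sim_mem sm a; rewrite HE last_rcons in u *.
have -> : settled a es = [::] := settled_bypass a lok.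
apply: obs_reconcile => //; rewrite -HE.
exact: obs_settled (sub0seq _) (sim_obs sm i a).
Qed.


(** The four ways of serving a load differ only in the resulting buffers of its processor; this is
    their common part. *)
Lemma sim_ld_com s w w' H K i idx epc npc g srcs dst a v tg es sb' ib' :
  sim s w H K ->
  let p := procs s i in
  let x := (v, stag tg) in
  rob p = Entry idx epc npc (RLd PC g srcs dst (Some a) (Some v) (Some tg)) Done :: es ->
  wprocs w' i = WProc [eta wrf (wprocs w i) with dst |-> v] npc sb' ib'
    (rcons (whist (wprocs w i)) (EvLd PC g srcs dst a v)) ->
  (forall j, j != i -> wprocs w' j = wprocs w j) ->
  wmem w' = wmem w -> wused w' = wused w ->
  {subset sb (wprocs w i) <= sb'} ->
  (forall b, b != a -> stores_to b sb' = stores_to b (sb (wprocs w i))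
                    /\ ib_values b ib' = ib_values b (ib (wprocs w i))) ->
  observed i a (H a) (port_view (segs s) i) (wmem w a) sb' ib' x (settled a es) ->
  sim (OoosState [eta procs s with i |->
         commit p es [eta rf p with dst |-> v] (EvLd PC g srcs dst a v)]
         (segs s) (hmem s) (used s)) w' H
      (fun j b => if (j == i) && (b == a) then x else K j b).
Proof.
move=> sm p x E w'E otherE mE uE sbE bE obs.
apply: (sim_retire sm E) => //; rewrite ?w'E //=.
- by apply: (no_commit sm); rewrite /at_commit E.
- by move=> r u; rewrite /reg_update /= [r == dst]eq_sym; case: eqP.
- by rewrite (sim_rf sm).
- by move=> j /negPf ->.
move=> b; rewrite eqxx /=; case: eqVneq => [->//|ba].
have [sbbE ibbE] := bE b ba; apply: obs_buffers sbbE ibbE _.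
by have := sim_obs sm i b; rewrite E /= /access /= eq_sym (negPf ba).
Qed.

Lemma step_ld_com s w H K i idx epc npc g srcs dst a v t es : sim s w H K ->
  let p := procs s i in
  rob p = Entry idx epc npc (RLd PC g srcs dst (Some a) (Some v) t) Done :: es ->
  exists2 w', clos_refl_trans _ (wmms_step prog) w w' & exists K',
  sim (OoosState [eta procs s with i |->
         commit p es [eta rf p with dst |-> v] (EvLd PC g srcs dst a v)]
         (segs s) (hmem s) (used s)) w' H K'.
Proof.
move=> sm p E; have [tg tE] : exists tg, t = Some tg.
  have [_ + _] := sim_head sm E; rewrite /entry_ok /=.
  by case: (fetch _ _) => // ? ? ? [_ _ _ []]; case: (t) => // tg; exists tg.
subst t; have [pcE eok lok] := sim_head sm E.
move: eok; rewrite /entry_ok /=; case def_i: (fetch _ _) => [|g' srcs' dst'|||] //=.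
case=> [[? ? ?] npcE [_ aE] _]; subst g' srcs' dst'; rewrite pmap_Some in aE.
have def_i' : fetch (prog i) (wpc (wprocs w i)) = ILd PC g srcs dst by rewrite pcE.
have obs : observed i a (H a) (port_view (segs s) i) (wmem w a) (sb (wprocs w i))
    (ib (wprocs w i)) (K i a) (inl (v, stag tg) :: settled a es).
  by have := sim_obs sm i a; rewrite E /= /access /= eqxx.
have u := sim_uniq i a sm.
have clear_ib b ib : b != a -> ib_values b (ib_clear a ib) = ib_values b ib.
  by move=> ba; rewrite ib_values_clear eq_sym (negPf ba).
case: (obs_load u obs) => [[l [t [sbE obs']]]|[t [/= tE tV obs']]|[sbN /= vm obs']
                          |[sbN [l1 [l2 [ibE obs']]]]].
- eexists.
    apply: rt_step; apply: (@WExec _ _ _ _ _ prog w i); apply: WLdSb.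
    - exact: def_i'.
    - exact: aE.
    - exact: sbE.
  eexists; apply: (sim_ld_com (w' := WmmsState _ _ _) sm E _ _ _ _ _ _ obs') => //=.
  + by rewrite eqxx /exec_ld pcE -npcE.
  + by move=> j /negPf ->.
- have [j j_sb] := sim_source sm (mem_viewP tV).
  have [l1 [l2 sbE]] : exists l1 l2, sb (wprocs w j) = l1 ++ (a, v, t) :: l2.
    by case/splitPr: j_sb => l1 l2; exists l1, l2.
  (* By [obs'] the enlarged buffer is still a subsequence of the pending items, like all the
     others. *)
  have nocyc : no_cycle (fun k => sb (wprocs w k)) a v t i.
    apply: (coh_edge_acyclic (G := all_requests (segs s))) => [t'|k].
      have := sim_stores sm a t'; have := leq_b1 (t' \in wused w); lia.
    exists (port_view (segs s) k); first exact: view_subseq.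
    rewrite /=; case: eqP => [->|_]; first by case: obs'.
    by case: (sim_obs sm k a).
  eexists.
    apply: rt_trans; apply: rt_step; first exact: WCopy sbE nocyc.
    apply: (@WExec _ _ _ _ _ prog _ i) => /=; rewrite eqxx; apply: WLdSb.
    - exact: def_i'.
    - exact: aE.
    - by rewrite /= stores_to_rcons eqxx.
  eexists; apply: (sim_ld_com (w' := WmmsState _ _ _) sm E _ _ _ _ _ _ obs') => //=.
  + by rewrite eqxx /exec_ld /= pcE -npcE.
  + by move=> k /negPf ->.
  + by move=> e; rewrite mem_rcons inE orbC => ->.
  + by move=> b ba; rewrite stores_to_rcons eq_sym (negPf ba) clear_ib.
- eexists.
    apply: rt_step; apply: (@WExec _ _ _ _ _ prog w i); apply: WLdMem.
    - exact: def_i'.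
    - exact: aE.
    - exact: sbN.
  eexists; apply: (sim_ld_com (w' := WmmsState _ _ _) sm E _ _ _ _ _ _ obs') => //=.
  + by rewrite eqxx /exec_ld pcE -npcE -vm.
  + by move=> j /negPf ->.
  + by move=> b ba; rewrite clear_ib.
- eexists.
    apply: rt_step; apply: (@WExec _ _ _ _ _ prog w i); apply: WLdIb.
    - exact: def_i'.
    - exact: aE.
    - exact: sbN.
    - exact: ibE.
  eexists; apply: (sim_ld_com (w' := WmmsState _ _ _) sm E _ _ _ _ _ _ obs') => //=.
  + by rewrite eqxx /exec_ld pcE -npcE.
  + by move=> j /negPf ->.
  + by move=> b ba; rewrite ibE !ib_values_cat clear_ib.
Qed.

Lemma step_st_com s w H K i idx epc npc g h srcs a v t es : sim s w H K ->
  let p := procs s i in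
  rob p = Entry idx epc npc (RSt PC g h srcs (Some a) (Some v) t) Done :: es ->
  exists2 w', wmms_step prog w w' & exists K',
  sim (OoosState [eta procs s with i |-> commit p es (rf p) (EvSt PC g h srcs a v)]
    [eta segs s with port T i |-> QSt n a v t :: segs s (port T i)]
    (hmem s) (used s)) w' H K'.
Proof.
move=> sm p E; have [pcE eok lok] := sim_head sm E.
move: eok; rewrite /entry_ok /=; case def_i: (fetch _ _) => [||g' h' srcs'||] //=.
case=> [[? ? ?] npcE [_ _ aE vE]]; subst g' h' srcs'; rewrite !pmap_Some in aE vE.
have def_i' : fetch (prog i) (wpc (wprocs w i)) = ISt PC g h srcs by rewrite pcE.
set p' := commit p es (rf p) (EvSt PC g h srcs a v).
have tags t' : \sum_j count_mem t' (rtags (rob ([eta procs s with i |-> p'] j)))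
    + (t == t') = \sum_j count_mem t' (rtags (rob (procs s j))).
  have := sum_update (fun p => count_mem t' (rtags (rob p))) (procs s) i p'.
  rewrite [procs s i]/= -/p E {2}/rtags /= -/(rtags es); lia.
(* The committing entry already accounts for one occurrence of [t] in [sim_tags], whose total is at
   most one. *)
have tN : t \notin wused w.
  have := sim_tags sm t; have := tags t; have := leq_b1 (t \in used s).
  rewrite eqxx /=; case: (t \in wused w) => //; lia.
set r := QSt n a v t; set f' := [eta segs s with port T i |-> r :: segs s (port T i)].
have nc : QCom Addr Val i \notin all_requests (segs s).
  by apply: (no_commit sm); rewrite /at_commit -/p E.
eexists.
  by apply: (@WExec _ _ _ _ _ prog w i); exact: (WSt _ def_i' aE vE tN).
have st : forall b t', count (has_tag t') (all_requests f') +
    count (fun x => x.2 == Some t') (H b) <= (t' \in t :: wused w).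
  move=> b t'; rewrite count_push /= inE; have := sim_stores sm b t'.
  have [<-|] := eqVneq t t'; last by rewrite addn0.
  by rewrite (negPf tN) /=; lia.
have ld : forall j k, count (is_load j k) (all_requests f')
    <= in_flight ([eta procs s with i |-> p'] j) k.
  move=> j k; rewrite count_push addn0 /=; have := sim_loads sm j k.
  by case: eqP => [->|//]; rewrite (commit_in_flight _ _ _ E).
have u j b : uniq (coherence j b (H b) (port_view f' j)).
  apply: (@push_uniq _ _ (t :: wused w)) => //; last exact: sim_initial sm b.
  by move=> k; apply: leq_trans (ld j k) (leq_b1 _).
exists (fun j b => if (j == i) && (b == a) then (v, Some t) else K j b).
split=> //=.
- move=> j; case: eqP => [->|_]; last exact: sim_proc sm j.
  rewrite /= pcE -npcE; apply: (commit_proc_ok _ (sim_proc sm i) E) => z y.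
  by [].
- by move=> j; case: eqP => _; rewrite /= (sim_rf sm).
- by move=> j; case: eqP => _; rewrite /= (sim_hist sm).
- move=> t'; have := sim_tags sm t'; rewrite -tags /= inE eq_sym.
  by have [<-|_] := eqVneq t t'; [rewrite (negPf tN)|]; rewrite ?addn0.
- move=> j; rewrite count_push addn0; have := sim_commits sm j; case: eqP => [->|//] _.
  by move/count_memPn: nc => ->.
- exact: (place_push sm).
- move=> b u' t'; rewrite mem_push => /orP[/eqP[-> -> ->]|/(sim_source sm)[j jsb]].
    by exists i; rewrite eqxx /= mem_rcons mem_head.
  by exists j; case: eqP jsb => [->|//] jsb; rewrite /= mem_rcons inE jsb orbT.
- exact: sim_initial sm.
- exact: sim_mem sm.
- move=> j x; case: eqVneq => [->|ji] xj.
    by move/mem_viewP; rewrite mem_push (negPf nc).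
  apply: (after_inserted (r := r)) => //; first exact: view_inserted.
  exact: sim_below sm j x xj.
- move=> j b; case: eqVneq => [->|ji] /=; last first.
    exact: (obs_inserted (u j b) (view_inserted _ _ _ _) (sim_obs sm j b)).
  have [->|ba] := eqVneq b a; last first.
    apply: (obs_inserted (u i b) (view_inserted _ _ _ _)).
    apply: (@obs_buffers _ _ _ _ _ _ _ _ (sb (wprocs w i)) (ib (wprocs w i))).
    + by rewrite stores_to_rcons eq_sym (negPf ba).
    + by rewrite ib_values_clear eq_sym (negPf ba).
    have := sim_obs sm i b; rewrite -/p E /= /executed_store /= eq_sym (negPf ba).
    by rewrite /access.
  have := u i a; rewrite /port_view view_push => ui.
  apply: obs_store ui _ _.
    by have := settled_bypass a lok; rewrite /= eqxx.
  exact: obs_settled (sub0seq _) (sim_obs sm i a).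
Qed.

(** * Rules of the memory hierarchy *)

Lemma sim_segs s w H K f : sim s w H K ->
  (forall P, count P (all_requests f) <= count P (all_requests (segs s))) ->
  (forall i j r, r \in f j -> issued_by i r -> j \in route (port T i)) ->
  (forall i e, e \in sb (wprocs w i) -> QCom Addr Val i \in port_view f i ->
    QSt n e.1.1 e.1.2 e.2 \in after (QCom Addr Val i) (port_view f i)) ->
  (forall i a, uniq (coherence i a (H a) (port_view f i)) ->
    observed i a (H a) (port_view f i) (wmem w a)
      (sb (wprocs w i)) (ib (wprocs w i)) (K i a) (settled a (rob (procs s i)))) ->
  sim (OoosState (procs s) f (hmem s) (used s)) w H K.
Proof.
move=> sm le pl bl obs.
(* The counting invariants all follow from [le], which is stated for every predicate at once. *)
have st a t : count (has_tag t) (all_requests f) +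
    count (fun x => x.2 == Some t) (H a) <= (t \in wused w).
  by apply: leq_trans (sim_stores sm a t); rewrite leq_add2r.
have ld i k : count (is_load i k) (all_requests f) <= in_flight (procs s i) k.
  exact: leq_trans (le _) (sim_loads sm i k).
split=> //=.
- exact: sim_proc sm.
- exact: sim_rf sm.
- exact: sim_hist sm.
- exact: sim_tags sm.
- by move=> i; apply: leq_trans (sim_commits sm i).
- move=> a v t; rewrite -has_pred1 has_count => lt0; apply: (sim_source sm (a := a) (v := v)).
  by rewrite -has_pred1 has_count (leq_trans lt0).
- exact: sim_initial sm.
- exact: sim_mem sm.
move=> i a; apply: obs; apply: views_uniq (sim_initial sm a) => [t|k].
  exact: leq_trans (st a t) (leq_b1 _).
exact: leq_trans (ld i k) (leq_b1 _).
Qed.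

(** A swap can lift [x] above [c] only when [c] itself is moved below [x]. The side condition
    excludes this, as [can_reorder] does for a [Commit] above a store. *)
Lemma after_swap (c x y z : request) A B :
  (y = c -> x <> z) ->
  (c \in A ++ y :: z :: B -> x \in after c (A ++ y :: z :: B)) ->
  c \in A ++ z :: y :: B -> x \in after c (A ++ z :: y :: B).
Proof.
move=> yx H; have memE (V : seq request) : (c \in V ++ z :: y :: B) = (c \in V ++ y :: z :: B).
  by rewrite !mem_cat !inE; congr (_ || _); rewrite orbCA.
rewrite memE => /H; rewrite !after_cat; case: ifP => _.
  by rewrite !mem_cat !inE; case/or4P => ->; rewrite ?orbT.
rewrite !after_cons; case: (eqVneq y c) (yx) => [yc /(_ yc) xz|_ _].
  rewrite inE => /orP[/eqP //|xB].
  by case: eqP; rewrite ?inE ?xB ?orbT.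
by case: eqP => // _ xB; rewrite inE xB orbT.
Qed.

Lemma sim_reorder s w H K j l1 rnew rold l2 : sim s w H K ->
  segs s j = l1 ++ rnew :: rold :: l2 -> can_reorder rnew rold ->
  sim (OoosState (procs s) [eta segs s with j |-> l1 ++ rold :: rnew :: l2]
         (hmem s) (used s)) w H K.
Proof.
move=> sm sj ok; have ns : forall i e, rnew = QCom Addr Val i ->
    QSt n e.1.1 e.1.2 e.2 <> rold :> request.
  by move=> i e rE Er; move: ok; rewrite /can_reorder rE -Er.
have vw i : port_view [eta segs s with j |-> l1 ++ rold :: rnew :: l2] i = port_view (segs s) i \/
    exists A B, port_view (segs s) i = A ++ rnew :: rold :: B /\
      port_view [eta segs s with j |-> l1 ++ rold :: rnew :: l2] i = A ++ rold :: rnew :: B.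
  have := view_update (segs s) j (port T i); case: ifP => [_ [A [B [fE uE]]]|_ uE].
    by right; exists (A ++ l1), (l2 ++ B); rewrite /port_view fE uE sj -!catA.
  by left; rewrite /port_view uE.
apply: sim_segs => //.
- move=> P; have := count_update (segs s) j (l1 ++ rold :: rnew :: l2) P.
  rewrite sj !count_cat [count P (_ :: _)]/= [X in _ = _ + (_ + X)]/=.
  set x := count P (all_requests _); lia.
- move=> i k r /=; case: eqP => [->|_] rk; apply: (sim_place sm).
    by move: rk; rewrite sj !mem_cat !inE; case/or4P => ->; rewrite ?orbT.
  by [].
- move=> i e e_sb; case: (vw i) => [->|[A [B [vE ->]]]]; first exact: sim_below sm i e e_sb.
  apply: after_swap; first exact: ns.
  by rewrite -vE; exact: sim_below sm i e e_sb.
- move=> i a _; apply: obs_pending (sim_obs sm i a).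
  by case: (vw i) => [->|[A [B [-> ->]]]] //; apply: pending_reorder.
Qed.

Lemma sim_flow s w H K j k l r : sim s w H K ->
  segs s j = rcons l r -> parent j = Some k ->
  sim (OoosState (procs s) [eta segs s with j |-> l, k |-> r :: segs s k]
         (hmem s) (used s)) w H K.
Proof.
move=> sm sj jk; have rj : r \in segs s j by rewrite sj mem_rcons mem_head.
apply: sim_segs => //.
- by move=> P; rewrite (count_flow _ sj jk).
- move=> i j' r' /=; case: eqP => [->|_] rk.
    by apply: (sim_place sm); rewrite sj mem_rcons inE rk orbT.
  case: eqP rk => [->|_]; last exact: sim_place sm _ _ _.
  rewrite inE => /orP[/eqP ->|]; last exact: sim_place sm _ _ _.
  move/(sim_place sm rj)/route_split => [q ->].
  by rewrite mem_cat routeE jk inE mem_route !orbT.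
- move=> i e e_sb; case: (view_flow (port T i) sj jk) => [|[jr ins]].
    by rewrite /port_view => ->; exact: sim_below sm i e e_sb.
  apply: (after_inserted (r := r)); last exact: sim_below sm i e e_sb.
    (* The [Commit] of processor [i] is on the route of [i], so a request inserted from outside that
       route is a different one. *)
    by apply: contraNneq jr => rE; apply: (sim_place sm rj); rewrite rE /= eqxx.
  by right; case: ins => A [B ?]; exists A, B.
- move=> i a u; apply: (obs_inserted (r := r) u _ (sim_obs sm i a)).
  by case: (view_flow (port T i) sj jk) => [|[_ [A [B ?]]]]; [left|right; exists A, B].
Qed.

(** Common to bypassing in a segment and reading the memory: in the sequence of [i] and [a] the
    answer stands right before the load, and for other processors and addresses the request carries
    no information. *)
Lemma sim_response s w H K i k a x tg f : sim s w H K ->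
  (forall P, count P (all_requests f) + P (QLd Val i k a)
             = count P (all_requests (segs s))) ->
  (forall j, {subset f j <= segs s j}) ->
  (forall j, port_view f j = port_view (segs s) j \/
     exists A B, port_view (segs s) j = A ++ QLd Val i k a :: B /\
                 port_view f j = A ++ B) ->
  (exists X Y,
     coherence i a (H a) (port_view (segs s) i) = X ++ inl x :: inr k :: Y /\
     coherence i a (H a) (port_view f i) = X ++ inl x :: Y) ->
  stag tg = x.2 ->
  sim (OoosState [eta procs s with i |-> resp_ld k x.1 tg (procs s i)] f
         (hmem s) (used s)) w H K.
Proof.
move=> sm cnt sub vw [X [Y [CE CE']]] tgE.
have cnt0 : count (is_load i k) (all_requests f) = 0.
  have := cnt (is_load i k); have := sim_loads sm i k; rewrite /= !eqxx /=.
  have := leq_b1 (in_flight (procs s i) k); lia.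
have fl : in_flight (procs s i) k.
  have := cnt (is_load i k); have := sim_loads sm i k; rewrite /= !eqxx /=.
  by case: in_flight => //; rewrite cnt0 => + E; rewrite -E.
have R := resp_ld_responded (sim_proc sm i) fl tgE.
set p' := resp_ld k x.1 tg (procs s i) in R *.
have le P : count P (all_requests f) <= count P (all_requests (segs s)).
  by rewrite -cnt leq_addr.
split=> /=.
- by move=> j; case: eqP => [->|_]; [case: R|exact: sim_proc sm j].
- by move=> j; case: eqP => [->|_]; rewrite (sim_rf sm) //; case: R.
- by move=> j; case: eqP => [->|_]; rewrite (sim_hist sm) //; case: R.
- move=> t; apply: leq_trans (sim_tags sm t); rewrite leq_add2r.
  have := sum_update (fun p => count_mem t (rtags (rob p))) (procs s) i p'.
  have := resp_rtags R t; rewrite /=; lia.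
- by move=> b t; apply: leq_trans (sim_stores sm b t); rewrite leq_add2r.
- move=> j k'; case: eqP => [->|_]; last exact: leq_trans (le _) (sim_loads sm j k').
  have [->|k'k] := eqVneq k' k; first by rewrite cnt0.
  by rewrite (resp_flight R k'k); exact: leq_trans (le _) (sim_loads sm i k').
- move=> j; have := leq_trans (le (pred1 (QCom Addr Val j))) (sim_commits sm j).
  case: eqP => [->|//]; have := resp_commit R.
  by case: (at_commit (procs s i)) => [->//|_]; rewrite leqn0 => /eqP->.
- by move=> i' j r /sub; exact: sim_place sm i' j r.
- move=> b v t; rewrite -has_pred1 has_count => lt0; apply: (sim_source sm (a := b) (v := v)).
  by rewrite -has_pred1 has_count (leq_trans lt0).
- exact: sim_initial sm.
- exact: sim_mem sm.
- move=> j e e_sb; have := sim_below sm e_sb; case: (vw j) => [->//|[A [B [-> ->]]]].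
  exact: after_deleted.
- have del j b S : (i = j -> a = b -> inr k \notin S) ->
      observed j b (H b) (port_view (segs s) j) (wmem w b) (sb (wprocs w j))
        (ib (wprocs w j)) (K j b) S ->
      observed j b (H b) (port_view f j) (wmem w b) (sb (wprocs w j))
        (ib (wprocs w j)) (K j b) S.
    by move=> kS; case: (vw j) => [->//|[A [B [-> ->]]]]; apply: obs_delete.
  move=> j b; case: eqP => [->|ji]; last first.
    by apply: del (sim_obs sm j b) => /esym.
  have [->|ba] := eqVneq b a.
    exact: (obs_collapse (sim_uniq i a sm) CE CE' (resp_settled R a) (sim_obs sm i a)).
  (* An awaiting load [k] from another address would have a second request with index [k], but the
     removed one was the only one. *)
  have kS : inr k \notin settled b (rob (procs s i)).
    apply/negP => kS; have := obs_chain (sim_obs sm i b).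
    rewrite chain_cons => /and3P[_ _ /andP[/allP/(_ _ kS) kC _]].
    have {kC} : inr k \in coherence i b (H b) (port_view (segs s) i) := kC.
    rewrite /coherence mem_cat mem_pending_load => /orP[/mapP[] //|/mem_viewP].
    rewrite -has_pred1 has_count -cnt /=.
    have -> : (QLd Val i k a == QLd Val i k b) = false.
      by apply/eqP => -[/esym/eqP]; rewrite (negPf ba).
    rewrite addn0 -has_count has_pred1 => b_in.
    move: cnt0 => /eqP; rewrite -leqn0 leqNgt -has_count => /hasP; case.
    by exists (QLd Val i k b) => //=; rewrite !eqxx.
  have := resp_settled R b; rewrite redirect_id // => sub'.
  apply: obs_settled sub' _; apply: del (sim_obs sm i b) => _ ab.
  by rewrite ab eqxx in ba.
Qed.

Lemma sim_bypass s w H K j l1 i k a v t l2 : sim s w H K ->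
  segs s j = l1 ++ QLd Val i k a :: QSt n a v t :: l2 ->
  sim (OoosState [eta procs s with i |-> resp_ld k v (TSt Addr t) (procs s i)]
         [eta segs s with j |-> l1 ++ QSt n a v t :: l2] (hmem s) (used s)) w H K.
Proof.
move=> sm sj; set f := [eta segs s with j |-> _].
have vw i' : if j \in route (port T i') then
    exists A B, port_view (segs s) i' = A ++ QLd Val i k a :: QSt n a v t :: B /\
                port_view f i' = A ++ QSt n a v t :: B
    else port_view f i' = port_view (segs s) i'.
  have := view_update (segs s) j (port T i'); case: ifP => [_ [A [B [fE uE]]]|_ uE].
    by exists (A ++ l1), (l2 ++ B); rewrite /port_view fE uE sj -!catA.
  by rewrite /port_view uE.
apply: (sim_response (x := (v, Some t)) (a := a)) => //.
- move=> P; have := count_update (segs s) j (l1 ++ QSt n a v t :: l2) P.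
  rewrite sj !count_cat [count P (_ :: _)]/= [X in _ = _ + (_ + X)]/= -/f.
  set y := count P (all_requests _); lia.
- move=> j' r /=; case: eqP => [->|//]; rewrite sj !mem_cat !inE.
  by case/or3P => ->; rewrite ?orbT.
- move=> i'; have := vw i'; case: ifP => _; last by left.
  by case=> A [B [-> ->]]; right; exists A, (QSt n a v t :: B).
- have := vw i; rewrite (sim_place sm (j := j) (r := QLd Val i k a)) /= ?eqxx //; last first.
    by rewrite sj mem_cat mem_head orbT.
  case=> A [B [-> ->]].
  exists (map inl (H a) ++ pending i a B), (pending i a A).
  by rewrite /coherence !pending_cat !pending_cons /= !eqxx /= -!catA.
Qed.

Section Root.

Variables (s : ostate) (w : wstate) (H : Addr -> seq value) (K : 'I_n -> Addr -> value).
Variables (j : 'I_(nseg T)) (l : seq request) (r : request).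
Hypothesis sm : sim s w H K.
Hypothesis sj : segs s j = rcons l r.
Hypothesis jr : parent j = None.

Let f := [eta segs s with j |-> l].

Lemma root_count P : count P (all_requests f) + P r = count P (all_requests (segs s)).
Proof.
have := count_update (segs s) j l P; rewrite sj -cats1 count_cat /= -/f.
set y := count P (all_requests _); lia.
Qed.

Lemma root_sub j' : {subset f j' <= segs s j'}.
Proof.
by move=> x; rewrite /f /=; case: eqP => [->|//] xl; rewrite sj mem_rcons inE xl orbT.
Qed.

Lemma root_view i : if j \in route (port T i)
  then port_view (segs s) i = rcons (port_view f i) r
  else port_view f i = port_view (segs s) i.
Proof. exact: view_root. Qed.

Lemma root_issued i : issued_by i r -> j \in route (port T i).
Proof. by apply: (sim_place sm); rewrite sj mem_rcons mem_head. Qed.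

End Root.

Lemma sim_flow_ld s w H K j l i k a : sim s w H K ->
  segs s j = rcons l (QLd Val i k a) -> parent j = None ->
  sim (OoosState [eta procs s with i |-> resp_ld k (hmem s a).1 (hmem s a).2 (procs s i)]
         [eta segs s with j |-> l] (hmem s) (used s)) w H K.
Proof.
move=> sm sj jr; have [h [x [HE vE tE _]]] := sim_mem sm a.
rewrite vE; apply: (sim_response (a := a)) => //.
- exact: root_count sj.
- exact: root_sub sj.
- move=> i'; have := root_view sj jr i'; case: ifP => _ E; [right|by left].
  by exists (port_view [eta segs s with j |-> l] i'), [::]; rewrite cats0 cats1.
- have := root_view sj jr i; rewrite (root_issued sm sj) /= ?eqxx // => ->.
  (* The load is at the bottom of its view, hence directly after the last value of the history,
     which is the memory value. *)
  exists (map inl h), (pending i a (port_view [eta segs s with j |-> l] i)).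
  rewrite /coherence HE map_rcons !cat_rcons -cats1 pending_cat pending_cons /=.
  by rewrite !eqxx.
Qed.

Lemma step_flow_com s w H K j l i : sim s w H K ->
  segs s j = rcons l (QCom Addr Val i) -> parent j = None ->
  exists2 w', wmms_step prog w w' &
  sim (OoosState [eta procs s with i |-> resp_com (procs s i)]
         [eta segs s with j |-> l] (hmem s) (used s)) w' H K.
Proof.
move=> sm sj jr; set f := [eta segs s with j |-> l].
have cnt := root_count sj; rewrite -/f in cnt.
have le P : count P (all_requests f) <= count P (all_requests (segs s)).
  by rewrite -cnt leq_addr.
have vw := root_view sj jr; rewrite -/f in vw.
have nc : QCom Addr Val i \notin all_requests f.
  apply/count_memPn; have := cnt (pred1 (QCom Addr Val i)); have := sim_commits sm i.
  rewrite /= eqxx; have := leq_b1 (at_commit (procs s i)); lia.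
have ac : at_commit (procs s i).
  have := cnt (pred1 (QCom Addr Val i)); have := sim_commits sm i; rewrite /= eqxx.
  by case: at_commit => //; lia.
(* The request is removed first, with its instruction still in the commit slot; the rest is an
   instance of [sim_retire]. *)
have sm1 : sim (OoosState (procs s) f (hmem s) (used s)) w H K.
  apply: (sim_segs sm) => //.
  - by move=> i' j' r' /(root_sub sj); exact: sim_place sm i' j' r'.
  - move=> i' e e_sb; have := vw i'; case: ifP => _ E; last first.
      by rewrite E; exact: sim_below sm i' e e_sb.
    move=> cV; have := sim_below sm e_sb; rewrite E mem_rcons inE cV orbT => /(_ isT).
    by rewrite -cats1 after_cat cV mem_cat inE orbF.
  - move=> i' a _; have := vw i'; case: ifP => _ E; last by rewrite E; exact: sim_obs sm i' a.
    apply: obs_pending (sim_obs sm i' a); rewrite E -cats1 pending_cat pending_cons /=.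
    by [].
(* A buffered store would lie below the [Commit], which is at the bottom. *)
have sb0 : sb (wprocs w i) = [::].
  case def_sb: (sb _) => [//|e q]; have e_sb : e \in sb (wprocs w i) by rewrite def_sb mem_head.
  have := sim_below sm e_sb; have := vw i; rewrite (root_issued sm sj) /= ?eqxx // => ->.
  rewrite mem_rcons mem_head -cats1 after_cat => /(_ isT).
  case: ifP => [/mem_viewP|_]; first by rewrite (negPf nc).
  by rewrite after_cons eqxx.
move: ac; rewrite /at_commit /resp_com; case E: (rob (procs s i)) => [//|e es].
case eE: (e_ins e) => //; have [pcE eok _] := sim_head sm E.
move: eok; rewrite /entry_ok eE; case def_i: (fetch _ _) => //= npcE _.
eexists.
  by apply: (@WExec _ _ _ _ _ prog w i); apply: WCom; rewrite ?pcE //; exact: def_i.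
apply: (sim_retire sm1 E) => //=; rewrite ?eqxx //=.
- by rewrite /load_in_flight eE.
- by rewrite /rtag eE.
- by move=> z u; rewrite /reg_update /dest eE.
- by rewrite (sim_rf sm).
- by rewrite pcE npcE.
- by move=> j' /negPf ->.
- move=> a; have := sim_obs sm1 i a; rewrite /= E /= /executed_store /access eE.
  by rewrite cat0s.
Qed.

Lemma deq_sb_fields a m t q :
  [/\ wrf (deq_sb a m t q) = wrf q, wpc (deq_sb a m t q) = wpc q,
      whist (deq_sb a m t q) = whist q
    & forall e, e \in sb (deq_sb a m t q) = (e \in sb q) && (e.2 != t)].
Proof.
rewrite /deq_sb /sb_has_tag; case: ifPn => [_|/hasPn nt].
  by split=> // e; rewrite mem_filter andbC.
case: ifP => _; split=> // e; case e_sb: (e \in sb q) => //=; by rewrite nt.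
Qed.

Lemma step_flow_st s w H K j l a v t : sim s w H K ->
  segs s j = rcons l (QSt n a v t) -> parent j = None ->
  exists2 w', wmms_step prog w w' & exists H',
  sim (OoosState (procs s) [eta segs s with j |-> l]
         [eta hmem s with a |-> (v, TSt Addr t)] (used s)) w' H' K.
Proof.
move=> sm sj jr; set f := [eta segs s with j |-> l].
have cnt := root_count sj; rewrite -/f in cnt.
have le P : count P (all_requests f) <= count P (all_requests (segs s)).
  by rewrite -cnt leq_addr.
have cnt0 : count (has_tag t) (all_requests f) = 0.
  have := cnt (has_tag t); have := sim_stores sm a t; rewrite /= eqxx.
  have := leq_b1 (t \in wused w); lia.
have tN (V : seq request) : subseq V (all_requests f) -> ~~ has (has_tag t) V.
  by move=> sub; rewrite has_count -leqNgt -cnt0; apply: leq_count_subseq.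
have tV i : ~~ has (has_tag t) (port_view f i) by apply/tN/view_subseq.
have vw i : port_view (segs s) i = rcons (port_view f i) (QSt n a v t) \/
            port_view (segs s) i = port_view f i.
  by have := root_view sj jr i; case: ifP => _ E; [left|right].
have sbV i : forall e, e \in sb (wprocs w i) ->
    QSt n e.1.1 e.1.2 e.2 \in port_view (segs s) i.
  by move=> e; exact: sim_obs_in_view sm.
pose H' := [eta H with a |-> rcons (H a) (v, Some t)].
have st b t' : count (has_tag t') (all_requests f) +
    count (fun x => x.2 == Some t') (H' b) <= (t' \in wused w).
  rewrite /H' /=; have := sim_stores sm b t'; have /= := cnt (has_tag t').
  move=> <-; case: (b =P a) => [->|_] le_t.
    by rewrite -cats1 count_cat /= (inj_eq (@Some_inj _)) addn0 (addnC (count _ (H a))) addnA.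
  by apply: leq_trans le_t; rewrite leq_add2r leq_addr.
have ld i k : count (is_load i k) (all_requests f) <= in_flight (procs s i) k.
  exact: leq_trans (le _) (sim_loads sm i k).
have nn b : count (fun x => x.2 == None) (H' b) <= 1.
  rewrite /H' /=; have := sim_initial sm b; case: eqP => [->|_] //.
  by rewrite -cats1 count_cat /= !addn0.
have u i b : uniq (coherence i b (H' b) (port_view f i)).
  apply: views_uniq (nn b) => [t'|k]; first exact: leq_trans (st b t') (leq_b1 _).
  exact: leq_trans (ld i k) (leq_b1 _).
have oldest i : sb_has_tag t (sb (wprocs w i)) ->
    exists S1, stores_to a (sb (wprocs w i)) = (a, v, t) :: S1.
  move=> tag; have sub := obs_sub (sim_obs sm i a).
  have [S1 E _] := tagged_oldest (vw i) (tV i) (@sbV i) sub tag.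
  by exists S1.
(* [WDeqSb] starts from a store buffer; until it is written, the store is in at least one. *)
have [i0 i0sb] : exists i, (a, v, t) \in sb (wprocs w i).
  apply: (sim_source sm); apply/all_requestsP; exists j.
  by rewrite sj mem_rcons mem_head.
have [S0 S0E] : exists S1, stores_to a (sb (wprocs w i0)) = (a, v, t) :: S1.
  by apply: oldest; apply/hasP; exists (a, v, t) => //; rewrite /sb_tag /=.
eexists.
  apply: WDeqSb S0E _ => i /oldest[S1 E]; by rewrite /oldest_store E.
exists H'; split=> /=.
- move=> i; case: (deq_sb_fields a (wmem w a) t (wprocs w i)) => _ -> _ _.
  exact: sim_proc sm i.
- move=> i; case: (deq_sb_fields a (wmem w a) t (wprocs w i)) => -> _ _ _.
  exact: sim_rf sm i.
- move=> i; case: (deq_sb_fields a (wmem w a) t (wprocs w i)) => _ _ -> _.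
  exact: sim_hist sm i.
- exact: sim_tags sm.
- exact: st.
- exact: ld.
- by move=> i; apply: leq_trans (le _) (sim_commits sm i).
- by move=> i j' r /(root_sub sj); exact: sim_place sm i j' r.
- move=> b v' t' in_f; have [i i_sb] : exists i, (b, v', t') \in sb (wprocs w i).
    apply: (sim_source sm); rewrite -has_pred1 has_count; apply: leq_trans (le _).
    by rewrite -has_count has_pred1.
  exists i; case: (deq_sb_fields a (wmem w a) t (wprocs w i)) => _ _ _ ->.
  rewrite i_sb /=; apply/eqP => tt'; have := tN _ (subseq_refl _).
  by case/negP; apply/hasP; exists (QSt n b v' t') => //=; rewrite tt'.
- exact: nn.
- move=> b; have [h [x [HE vE tE mE]]] := sim_mem sm b; rewrite /H' /=.
  by case: eqP => _; [exists (H a), (v, Some t)|exists h, x].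
- move=> i e; case: (deq_sb_fields a (wmem w a) t (wprocs w i)) => _ _ _ ->.
  case/andP => e_sb et; have := sim_below sm e_sb; case: (vw i) => [->|-> //].
  move=> bl cV; move: bl; rewrite mem_rcons inE cV -cats1 after_cat cV orbT => /(_ isT).
  rewrite mem_cat inE => /orP[//|/eqP[_ _ E]]; by rewrite E eqxx in et.
- move=> i b; rewrite /H' /=; case: eqP => [->|/eqP ba].
    have := u i a; rewrite /H' /= eqxx => ui.
    exact: (obs_dequeue (vw i) (tV i) (@sbV i) ui (sim_obs sm i a)).
  exact: (obs_dequeue_other (vw i) (tV i) (@sbV i) _ ba (sim_obs sm i b)).
Qed.

(** * From single steps to executions *)

Lemma simulation_step s s' w H K : sim s w H K -> ooos_step prog s s' ->
  exists2 w', clos_refl_trans _ (wmms_step prog) w w' &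
  exists H' K', sim s' w' H' K'.
Proof.
move=> sm; case.
- move=> i out p used' step.
  have rt w' : wmms_step prog w w' -> clos_refl_trans _ (wmms_step prog) w w'.
    exact: rt_step.
  have stay p0 : quiet (prog i) (wpc (wprocs w i)) (procs s i) p0 ->
      exists2 w', clos_refl_trans _ (wmms_step prog) w w' & exists H' K',
        sim (OoosState [eta procs s with i |-> p0] (segs s) (hmem s) (used s)) w' H' K'.
    by exists w; [exact: rt_refl|exists H, K; exact: sim_quiet].
  have ok := sim_proc sm i.
  case: step => /= {out p used'}.
  + move=> idx npc t le_idx pok tN; exists w; first exact: rt_refl.
    by exists H, K; exact: sim_fetch.
  + move=> idx pc npc op srcs dst v0 npc' v gE rd opE.
    exact: stay (nm_ex_quiet ok gE rd opE).
  + move=> idx pc npc g srcs dst v t gE rd.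
    exact: stay (ld_addr_quiet ok gE rd).
  + move=> idx pc npc g srcs dst a x v gE.
    exact: stay (ld_pred_quiet ok v gE).
  + move=> idx pc npc g srcs dst a v res t gE _ hit.
    exact: stay (ld_bypass_quiet ok gE hit).
  + move=> idx pc npc g srcs dst a v gE _ top nlf; exists w; first exact: rt_refl.
    by exists H, K; apply: (sim_ld_req sm gE top nlf).
  + move=> idx pc npc g h srcs a0 v0 t a v gE rd -> ->.
    exact: stay (st_ex_quiet ok gE rd).
  + move=> idx pc npc op srcs dst v es /(step_nm_com sm)[w' /rt ww' sm'].
    by exists w' => //; exists H, K.
  + move=> idx pc npc g srcs dst a v t es /(step_ld_com sm)[w' ww' [K' sm']].
    by exists w' => //; exists H, K'.
  + move=> idx pc npc es /(step_rec_com sm)[w' /rt ww' [K' sm']].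
    by exists w' => //; exists H, K'.
  + move=> idx pc npc g h srcs a v t es /(step_st_com sm)[w' /rt ww' [K' sm']].
    by exists w' => //; exists H, K'.
  + move=> idx pc npc es E; exists w; first exact: rt_refl.
    by exists H, K; exact: (sim_com_req sm E).
- move=> j l1 rnew rold l2 sj ok; exists w; first exact: rt_refl.
  by exists H, K; exact: sim_reorder.
- move=> j l1 i k a v t l2 sj; exists w; first exact: rt_refl.
  by exists H, K; exact: sim_bypass.
- move=> j k l r sj jk; exists w; first exact: rt_refl.
  by exists H, K; exact: sim_flow.
- move=> j l i k a sj jr; exists w; first exact: rt_refl.
  by exists H, K; exact: sim_flow_ld.
- move=> j l i sj jr; have [w' ww' sm'] := step_flow_com sm sj jr.
  by exists w'; [exact: rt_step|exists H, K].
- move=> j l a v t sj jr; have [w' ww' [H' sm']] := step_flow_st sm sj jr.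
  by exists w'; [exact: rt_step|exists H', K].
Qed.

Lemma view_empty j : view (fun _ : 'I_(nseg T) => [::] : seq request) j = [::].
Proof. by rewrite /view; elim: (route j). Qed.

Lemma sim_init : sim (ooos_init T ini) (wmms_init ini)
  (fun a => [:: (init_mem ini a, None)]) (fun _ a => (init_mem ini a, None)).
Proof.
have all0 : all_requests (fun _ : 'I_(nseg T) => [::] : seq request) = [::].
  by rewrite /all_requests; elim: (topological T).
split=> //=; rewrite ?all0 //.
- by move=> t; rewrite big1.
- by move=> a; exists [::], (init_mem ini a, None).
- move=> i a; rewrite /port_view view_empty; split=> //=.
    by left; exists [::], [::].
  by rewrite /chain /= mem_head.
Qed.

Lemma simulation s : clos_refl_trans _ (ooos_step prog) (ooos_init T ini) s ->
  exists2 w, clos_refl_trans _ (wmms_step prog) (wmms_init ini) w &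
  exists H K, sim s w H K.
Proof.
have [H0 [K0 sm0]] : exists H K, sim (ooos_init T ini) (wmms_init ini) H K.
  by do 2!eexists; exact: sim_init.
move: (ooos_init T ini) (wmms_init ini) H0 K0 sm0 => s0 w0 H0 K0 sm0 run.
elim: run w0 H0 K0 sm0 => {s0 s} [s s' step|s|s s' s'' _ IH1 _ IH2] w0 H0 K0 sm0.
- exact: simulation_step sm0 step.
- by exists w0; [exact: rt_refl|exists H0, K0].
- have [w1 run1 [H1 [K1 sm1]]] := IH1 _ _ _ sm0.
  have [w2 run2 sm2] := IH2 _ _ _ sm1.
  by exists w2 => //; exact: rt_trans run1 run2.
Qed.

End Simulation.

Theorem theorem5 (PC Reg Addr Val : eqType) (n : nat) (T : hmb_tree n)
    (prog : 'I_n -> program PC Reg Addr Val)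
    (ini : init_state PC Reg Addr Val n)
    (b : behavior PC Reg Addr Val n) :
  ooos_hmb_behavior T prog ini b -> wmms_behavior prog ini b.
Proof.
case=> s [run drained histE memE].
have [w runw [H [K sm]]] := simulation run.
exists w; split=> //.
(* A buffered store is also a pending request, and none is left. *)
- move=> i; case def_sb: (sb _) => [//|e q].
  have e_sb : e \in sb (wprocs w i) by rewrite def_sb mem_head.
  have /mem_viewP/all_requestsP[j e_j] := sim_obs_in_view sm e_sb.
  by case/hasP: (drained j); eexists; first exact: e_j.
- by move=> i; rewrite (sim_hist sm) histE.
- by move=> a; have [h [x [_ vE _ ->]]] := sim_mem sm a; rewrite -memE vE.
Qed.
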